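(* Consider either the MH dynamics (with $q\ge2$) or the cyclic dynamics (with $q\ge3$). Let $\mathbf a\in\mathcal S$ and suppose that the original process $\sigma_\beta(\cdot)$ starts from $\mathbf a$. Then, as $\beta\to\infty$, the law of the trace process $Y_\beta(\cdot)$ converges, in the sense of the usual Skorokhod topology, to the law of the limiting Markov chain $Y(\cdot)$ starting from $\mathbf a$, where $Y(\cdot)$ is the continuous-time Markov chain on $\mathcal S$ with uniform jump rates $$r_Y(\mathbf a',\mathbf b')=\kappa^{-1}\qquad\text{for all distinct }\mathbf a',\mathbf b'\in\mathcal S .$$
   Context: Fix integers $K,L$ with $11\le K\le L$ and an integer $q\ge2$. Let $\Lambda=\mathbb T_K\times\mathbb T_L$ with $\mathbb T_n=\mathbb Z/n\mathbb Z$; $x\sim y$ means nearest neighbors. Let $S=\{1,\dots,q\}$, $\mathcal X=S^\Lambda$, $$H(\sigma)=\sum_{\{x,y\}\subset\Lambda,\ x\sim y}\mathbf 1\{\sigma(x)\ne\sigma(y)\}.$$ For $a\in S$, $\mathbf a\in\mathcal X$ is the configuration with all spins equal to $a$; $\mathcal S=\{\mathbf 1,\dots,\mathbf q\}$. For $x\in\Lambda$, $a\in S$, $\sigma^{x,a}$ is the configuration obtained from $\sigma$ by updating the spin at $x$ to $a$; $\tau_x\sigma$ is obtained from $\sigma$ by replacing $\sigma(x)$ with $\sigma(x)+1$ (convention $q+1=1$). For each $\beta>0$, $\sigma_\beta(\cdot)$ is one of the following continuous-time Markov chains on $\mathcal X$. MH dynamics: jump rates $r_\beta(\sigma,\zeta)=e^{-\beta\max\{H(\zeta)-H(\sigma),0\}}$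 if $\zeta=\sigma^{x,a}\ne\sigma$ for some $x\in\Lambda,a\in S$, and $0$ otherwise. Cyclic dynamics ($q\ge3$): jump rates $r_\beta(\sigma,\zeta)=\exp\{-\beta[\max_{a\in S}H(\sigma^{x,a})-H(\sigma)]\}$ if $\zeta=\tau_x\sigma$ for some $x\in\Lambda$, and $0$ otherwise. $\Gamma=2K+2$ for the MH dynamics and $\Gamma=2K+4$ for the cyclic dynamics. The accelerated process is $\widetilde\sigma_\beta(t)=\sigma_\beta(e^{\Gamma\beta}t)$. The trace process $Y_\beta$ of $\widetilde\sigma_\beta$ on $\mathcal S$ is obtained by turning off the clock when $\widetilde\sigma_\beta\notin\mathcal S$: with $A(t)=\int_0^t\mathbf 1\{\widetilde\sigma_\beta(u)\in\mathcal S\}du$ and $A^{-1}(t)=\sup\{s\ge0:A(s)\le t\}$, set $Y_\beta(t)=\widetilde\sigma_\beta(A^{-1}(t))$; it is a continuous-time Markov chain on $\mathcal S$. The constant $\kappa=\kappa(K,L)\in(0,\infty)$ is the Eyring--Kramers constant of the dynamics under consideration, i.e. the number such that $\lim_{\beta\to\infty}e^{-\Gamma\beta}\mathbb E_{\mathbf a}[\tau_{\mathbf b}]=\kappa$ for all distinct $\mathbf a,\mathbf b\in\mathcal S$ (equivalently $\lim_{\beta\to\infty}e^{-\Gamma\beta}\mathbb E_{\mathbf a}[\tau_{\mathcal S\setminus\{\mathbf a\}}]=\kappa/(q-1)$ for all $\mathbf a\in\mathcal S$), where $\mathbb E_{\mathbf a}$ is the expectation for $\sigma_\beta(\cdot)$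 started at $\mathbf a$, $\tau_{\mathcal P}$ is the hitting time of $\mathcal P\subseteq\mathcal X$ and $\tau_{\mathbf b}=\tau_{\{\mathbf b\}}$. *)

(* Defs.v *)
(* MathComp-Analysis development, over an arbitrary R : realType. *)
From HB Require Import structures.
From mathcomp Require Import all_boot all_order all_algebra.
From mathcomp Require Import all_classical all_reals all_analysis.

Set Implicit Arguments.
Unset Strict Implicit.
Unset Printing Implicit Defensive.

Import Order.TTheory GRing.Theory Num.Theory.
Import numFieldNormedType.Exports.
Local Open Scope classical_set_scope.
Local Open Scope ring_scope.

(** * The space D([0, oo), T) for a discrete state space T *)

Section Cadlag.
Context {R : realType} {T : Type}.
Implicit Type f : R -> T.

(* Right-continuity and existence of left limits are with respect to the
   discrete topology of T.  The time set is [0, oo): paths are frozen on the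
   negative half-line, so that functions on R with this property are in
   bijection with cadlag functions on [0, oo). *)
Definition cadlag f : Prop :=
  [/\ forall t, t < 0 -> f t = f 0,
      forall t, 0 <= t -> \forall s \near t^'+, f s = f t
    & forall t, 0 < t -> exists c, \forall s \near t^'-, f s = c].

Lemma cadlag_cst (c : T) : cadlag (fun=> c).
Proof.
split=> // [t _|t _]; first exact: nearW.
by exists c; exact: nearW.
Qed.

End Cadlag.

Record skorokhod (R : realType) (T : Type) := Skorokhod {
  path_of :> R -> T;
  path_of_cadlag : cadlag path_of }.

Definition cst_path (R : realType) (T : Type) (c : T) : skorokhod R T :=
  Skorokhod (cadlag_cst c).

(** * The Skorokhod J1 topology *)

Section SkorokhodTopology.
Context (R : realType) (T : Type).
Local Notation D := (skorokhod R T).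

(* Increasing bijections of [0, oo) (hence homeomorphisms). *)
Definition time_change (lam : R -> R) : Prop :=
  (forall s t, 0 <= s -> s < t -> lam s < lam t) /\
  set_bij `[0, +oo[ `[0, +oo[ lam.

(* [g] is [eps]-close to [f] up to the horizon [N].  Since T is discrete (any
   two distinct points are at distance 1), uniform closeness of [g \o lam] to
   [f] on [0, N] is equality there.  The induced convergence f_n --> f is:
   there are time changes lam_n with sup_t |lam_n t - t| --> 0 and, for every N,
   sup_(t <= N) dist (f_n (lam_n t), f t) --> 0, which characterizes the
   (metrizable) Skorokhod topology of D([0, oo)), see Jacod and Shiryaev,
   Limit Theorems for Stochastic Processes, Theorem VI.1.14. *)
Definition skorokhod_ball (N eps : R) : set (D * D) :=
  [set fg : D * D | exists lam : R -> R,
     [/\ time_change lam,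
         forall t : R, 0 <= t -> `|lam t - t| <= eps
       & forall t : R, 0 <= t <= N -> fg.1 t = fg.2 (lam t)]].

Definition skorokhod_entourage : set_system (D * D) :=
  [set E | exists N eps : R, 0 < eps /\ skorokhod_ball N eps `<=` E].

Lemma time_change_ge0 lam t : time_change lam -> 0 <= t -> 0 <= lam t.
Proof.
move=> [_ [lam_fun _ _]] t0.
have /= := lam_fun t; rewrite !in_itv /= !andbT; exact.
Qed.

Lemma time_change_id : time_change id.
Proof.
split=> //; split=> //.
by move=> x /= xP; exists x.
Qed.

Lemma time_change_comp lam mu :
  time_change lam -> time_change mu -> time_change (mu \o lam).
Proof.
move=> hl hm; case: (hl) => [l1 l2]; case: (hm) => [m1 m2]; split.
  move=> s t s0 st /=; apply: m1; last exact: l1.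
  exact: time_change_ge0.
exact: set_bij_comp l2 m2.
Qed.

Lemma time_change_inv lam : time_change lam -> exists mu,
  [/\ time_change mu,
      forall t, 0 <= t -> lam (mu t) = t
    & forall t, 0 <= t -> mu (lam t) = t].
Proof.
move=> hl; case: (hl) => [l1 [_ _ l4]].
have inj s t : 0 <= s -> 0 <= t -> lam s = lam t -> s = t.
  move=> s0 t0 e; have [st|ts|//] := ltgtP s t.
    by have := l1 _ _ s0 st; rewrite e ltxx.
  by have := l1 _ _ t0 ts; rewrite e ltxx.
have /choice[mu muP] : forall t, exists s, 0 <= t -> 0 <= s /\ lam s = t.
  move=> t; have [t0|t0] := leP 0 t; last by exists 0.
  have /= := l4 t; rewrite in_itv /= andbT => /(_ t0)[s /=].
  by rewrite in_itv /= andbT => s0 st; exists s.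
have mulam t : 0 <= t -> mu (lam t) = t.
  move=> t0; have [m0 e] := muP _ (time_change_ge0 hl t0).
  exact: inj.
exists mu; split=> //; last by move=> t /muP[].
split=> [s t s0 st|].
  have [ms0 es] := muP _ s0.
  have [mt0 et] := muP _ (le_trans s0 (ltW st)).
  rewrite ltNge; apply/negP; rewrite le_eqVlt => /predU1P[e|lt].
    by move: st; rewrite -es -et e ltxx.
  by move: (l1 _ _ mt0 lt); rewrite es et ltNge (ltW st).
split.
- by move=> t /=; rewrite !in_itv /= !andbT => /muP[].
- move=> s t; rewrite !inE /= !in_itv /= !andbT => s0 t0 e.
  by rewrite -(muP _ s0).2 -(muP _ t0).2 e.
- move=> t; rewrite /= in_itv /= andbT => t0; exists (lam t); last exact: mulam.
  by rewrite /= in_itv /= andbT; exact: time_change_ge0.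
Qed.

Lemma skorokhod_ball_le N N' eps eps' : N' <= N -> eps <= eps' ->
  skorokhod_ball N eps `<=` skorokhod_ball N' eps'.
Proof.
move=> NN ee [f g] [lam [l1 l2 l3]]; exists lam; split => //.
  by move=> t t0; exact: le_trans (l2 _ t0) ee.
by move=> t /andP[t0 tN]; apply: l3; rewrite t0 (le_trans tN).
Qed.

Lemma skorokhod_entourage_filter : Filter skorokhod_entourage.
Proof.
split.
- by exists 0, 1; split.
- move=> E E' [N [e [e0 EN]]] [N' [e' [e'0 EN']]].
  exists (Num.max N N'), (Num.min e e'); split; first by rewrite lt_min e0.
  by move=> fg h; split; [apply: EN|apply: EN'];
    apply: skorokhod_ball_le h; rewrite ?le_max ?ge_min lexx ?orbT.
- by move=> E E' EE' [N [e [e0 EN]]]; exists N, e; split=> // fg /EN/EE'.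
Qed.

Lemma skorokhod_entourage_refl E : skorokhod_entourage E -> diagonal `<=` E.
Proof.
move=> [N [e [e0 EN]]] [f g] /= fg; apply: EN; exists id; split=> //=.
- exact: time_change_id.
- by move=> t _; rewrite subrr normr0 ltW.
- by move=> t _; rewrite -[f]/((f, g).1) fg.
Qed.

Lemma skorokhod_entourage_inv E :
  skorokhod_entourage E -> skorokhod_entourage E^-1%relation.
Proof.
move=> [N [e [e0 EN]]]; exists (N + e), e; split=> // -[f g] [lam [l1 l2 l3]].
apply: EN => /=; have [mu [m1 lm ml]] := time_change_inv l1.
have mu_near t : 0 <= t -> `|mu t - t| <= e.
  move=> t0; have := l2 _ (time_change_ge0 m1 t0).
  by rewrite lm// distrC.
exists mu; split=> //= t /andP[t0 tN].
have /= := l3 (mu t); rewrite lm// => -> //.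
rewrite (time_change_ge0 m1 t0)/=.
have := mu_near _ t0; rewrite ler_distl => /andP[_ /le_trans]; apply.
by rewrite lerD2r.
Qed.

Lemma skorokhod_entourage_split E : skorokhod_entourage E ->
  exists2 E', skorokhod_entourage E' & (E' \; E')%relation `<=` E.
Proof.
move=> [N [e [e0 EN]]].
exists (skorokhod_ball (N + e / 2) (e / 2)).
  by exists (N + e / 2), (e / 2); split=> //; rewrite divr_gt0.
move=> [f h] /= [g [lam [l1 l2 l3]] [mu [m1 m2 m3]]]; apply: EN.
exists (mu \o lam); split=> /=; first exact: time_change_comp.
  move=> t t0; rewrite -(subrKA (lam t)) (splitr e).
  apply: le_trans (ler_normD _ _) _; apply: lerD; last exact: l2.
  exact/m2/time_change_ge0.
move=> t /andP[t0 tN]; rewrite -[RHS]m3 /=; last first.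
  rewrite (time_change_ge0 l1 t0)/=.
  have := l2 _ t0; rewrite ler_distl => /andP[_ /le_trans]; apply.
  by rewrite lerD2r.
by apply: l3; rewrite /= t0 (le_trans tN)// lerDl ltW// divr_gt0.
Qed.

End SkorokhodTopology.

HB.instance Definition _ (R : realType) (T : Type) :=
  gen_eqMixin (skorokhod R T).
HB.instance Definition _ (R : realType) (T : Type) :=
  gen_choiceMixin (skorokhod R T).
HB.instance Definition _ (R : realType) (T : Type) :=
  isUniform.Build (skorokhod R T)
    (@skorokhod_entourage_filter R T) (@skorokhod_entourage_refl R T)
    (@skorokhod_entourage_inv R T) (@skorokhod_entourage_split R T).

(** * Convergence in law of D([0, oo), T)-valued random elements *)

(* The laws of [Y b] under [P b] converge weakly to the law of [Y'] under [Q] as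
   b --> +oo, for the Skorokhod topology. *)
Definition cvg_in_law (R : realType) (T : Type)
    (d : R -> measure_display) (Om : forall b, measurableType (d b))
    (P : forall b, probability (Om b) R) (Y : forall b, Om b -> skorokhod R T)
    (d' : measure_display) (Om' : measurableType d')
    (Q : probability Om' R) (Y' : Om' -> skorokhod R T) : Prop :=
  forall F : skorokhod R T -> R,
    continuous F -> (exists M : R, forall f, `|F f| <= M) ->
    ('E_(P b)[fun w => F (Y b w)])%E @[b --> +oo] --> ('E_Q[fun w => F (Y' w)])%E.

(** * Continuous-time Markov chains *)

Section MarkovChain.
Context {R : realType} {T : finType}.
Variable r : T -> T -> R.

Definition holding_rate (x : T) : R := \sum_(y | y != x) r x y.

Definition jump_proba (x y : T) : R :=
  if y == x then 0 else r x y / holding_rate x.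

(* [X] is a continuous-time Markov chain started at [x0] with jump rates [r]
   (diagonal values of [r] are ignored), in the jump chain/holding time sense:
   [xi n] is the n-th visited state and [h n] the time spent there; [xi] is a
   discrete-time Markov chain with transition matrix [jump_proba] and, given
   [xi], the [h n] are independent exponential variables of parameters
   [holding_rate (xi n)].  Absorbing states (zero holding rate) are not covered
   by this definition. *)
Definition is_ctmc (d : measure_display) (Om : measurableType d)
    (P : probability Om R) (x0 : T) (X : Om -> skorokhod R T) : Prop :=
  (forall t x, measurable [set w | X w t = x]) /\
  exists (xi : nat -> Om -> T) (h : nat -> Om -> R),
  [/\ forall n x, measurable [set w | xi n w = x],
      forall n, measurable_fun [set: Om] (h n),
      forall n w, 0 < h n w,
      forall n w (t : R), \sum_(i < n) h i w <= t < \sum_(i < n.+1) h i w ->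
        X w t = xi n w
    & forall n (x : nat -> T) (s : nat -> R), (forall i, 0 <= s i) ->
        P [set w | forall i, (i <= n)%N -> xi i w = x i /\ s i < h i w] =
        ((x 0%N == x0)%:R * \prod_(i < n) jump_proba (x i) (x i.+1) *
         \prod_(i < n.+1) expR (- (holding_rate (x i) * s i)))%:E].

End MarkovChain.

(** * Hitting times, trace paths *)

Section PathFunctionals.
Context {R : realType} {T : Type}.
Implicit Types (A : set T) (f : R -> T) (t : R).

(* +oo if [A] is never visited *)
Definition hitting_time A f : \bar R :=
  ereal_inf [set t%:E | t in [set t | 0 <= t /\ A (f t)]].

Definition occupation_time A f t : \bar R :=
  (\int[lebesgue_measure]_(u in `[0%R, t]) (\1_[set u | A (f u)] u)%:E)%E.

Definition inv_occupation_time A f t : R :=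
  sup [set s | 0 <= s /\ (occupation_time A f s <= t%:E)%E].

Definition trace A f t : T := f (inv_occupation_time A f t).

End PathFunctionals.

(** * The Potts model on the K x L torus *)

Section Potts.
Variables K L q : nat.

Definition site := ('I_K * 'I_L)%type.
Definition spin := 'I_q.
Definition config := {ffun site -> spin}.

(* [ordS] is the cyclic successor. *)
Definition nearest_neighbor (x y : site) : bool :=
  ((x.1 == y.1) && ((y.2 == ordS x.2) || (x.2 == ordS y.2))) ||
  ((x.2 == y.2) && ((y.1 == ordS x.1) || (x.1 == ordS y.1))).

(* the number of unordered pairs {x, y} of neighbors with different spins *)
Definition H (s : config) : nat :=
  #|([set [set p.1; p.2] | p : site * site
       & nearest_neighbor p.1 p.2 && (s p.1 != s p.2)])%SET|.

Definition update (s : config) (x : site) (a : spin) : config :=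
  [ffun y => if y == x then a else s y].

(* spins are cyclically incremented *)
Definition tau (x : site) (s : config) : config := update s x (ordS (s x)).

Definition constant_config (a : spin) : config := [ffun=> a].

Definition is_ground (s : config) : bool :=
  [exists a, s == constant_config a].

Definition ground := {s : config | is_ground s}.

Inductive dynamics := MH | Cyclic.

Definition min_spins (D : dynamics) : nat :=
  (match D with MH => 2 | Cyclic => 3 end)%N.

Definition Gamma (D : dynamics) : nat :=
  (match D with MH => 2 * K + 2 | Cyclic => 2 * K + 4 end)%N.

Context {R : realType}.

Definition MH_rate (beta : R) (s z : config) : R :=
  if (z != s) && [exists x, exists a, z == update s x a]
  then expR (- (beta * Num.max ((H z)%:R - (H s)%:R) 0)) else 0.

(* For q >= 2 there is at most one site [x] with [z = tau x s]. *)
Definition Cyclic_rate (beta : R) (s z : config) : R :=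
  if [pick x | z == tau x s] is Some x
  then expR (- (beta * ((\max_(a : spin) H (update s x a))%N%:R - (H s)%:R)))
  else 0.

Definition rate (D : dynamics) : R -> config -> config -> R :=
  match D with MH => MH_rate | Cyclic => Cyclic_rate end.

(* [kappa] is the limit of exp(- Gamma beta) E_a[tau_b] for distinct ground
   states, where [sigma beta] under [P beta x] is the (non-accelerated) dynamics
   at inverse temperature [beta] started at [x]. *)
Definition is_Eyring_Kramers_constant (D : dynamics)
    (d : R -> measure_display) (Om : forall b, measurableType (d b))
    (P : forall b, config -> probability (Om b) R)
    (sigma : forall b, Om b -> skorokhod R config) (kappa : R) : Prop :=
  0 < kappa /\
  forall a b : ground, a <> b ->
    ((expR (- ((Gamma D)%:R * beta)))%:E *
     \int[P beta (val a)]_w hitting_time [set val b] (sigma beta w))%E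
    @[beta --> +oo] --> kappa%:E.

Definition accelerated (D : dynamics) (beta : R) (f : R -> config) : R -> config :=
  fun t => f (expR ((Gamma D)%:R * beta) * t).

(* The trace on the ground states of the accelerated path [f], as an element of
   D([0, oo), ground).  The default value, the constant path at [a], is only
   used when the trace is not well defined (in particular when the total time
   spent in [ground] is finite), which is a null event. *)
Definition trace_process (D : dynamics) (beta : R) (a : ground) (f : R -> config) :
    skorokhod R ground :=
  xget (cst_path R a)
    [set y : skorokhod R ground | forall t, 0 <= t ->
       val (y t) = trace [set s | is_ground s] (accelerated D beta f) t].

End Potts.

(* Main.v *)
Require Import Defs.
From mathcomp Require Import all_boot all_order all_algebra.
From mathcomp Require Import all_classical all_reals all_analysis.
From mathcomp Require Import measurable_realfun ring lra.

Set Implicit Arguments.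
Unset Strict Implicit.
Unset Printing Implicit Defensive.

Import Order.TTheory GRing.Theory Num.Theory.
Import numFieldNormedType.Exports.
Local Open Scope classical_set_scope.
Local Open Scope ring_scope.

(** The proof has three independent ingredients; theta stands for
    exp (Gamma beta) throughout.

    The trace is a jump process with many self-loops.  At each visit of the jump
    chain to a ground state, record the state and the time spent there.  By the
    strong Markov property the recorded states form a Markov chain on the ground
    states, whose kernel [trace_kernel] charges the diagonal, and given this chain
    the recorded times are independent exponential variables
    ([visit_jump_process]).  Deleting the time spent elsewhere, as the trace does,
    leaves exactly these states and times ([trace_process_follows]).  A sojourn of
    the trace in a ground state is thus a geometric number of short exponential
    times, of rate [trace_intensity].

    The rates of the trace converge to 1 / kappa ([trace_rate_cvg]).  The
    definition of kappa says that all mean hitting times between ground states are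
    equivalent to kappa theta.  An exact identity for cycles a, b, a
    ([cycle_formula]) bounds the part of this time spent off the ground states by
    the Gibbs weight of these configurations, which is O(exp (- beta)).  The mean
    times spent on the ground states before hitting b solve the linear system
    of the trace chain ([trace_generator]), and a chain whose mean hitting times
    are nearly all equal to kappa has rates nearly equal to 1 / kappa
    ([rates_of_mean_times]).  The energy enters only through the stationarity of
    the Gibbs measure, the gap 1 above the ground states, and the
    lower bound exp (- 4 beta) for the exit rate of a ground state, which makes
    [trace_intensity] tend to infinity as Gamma > 4.

    Convergence of rates implies convergence in law ([jump_path_cvg_in_law]).
    For a bounded continuous F it is enough to show that E F(Y) is at most the
    lower limit of the expectations of F along the traces when F is nonnegative:
    apply this to M + F and to M - F.  The paths whose first n sojourns have given
    states and nearly given durations form a [cell]; replacing F by its infimum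
    over the cell of Y loses little, by continuity ([cell_nbhs]).  The probability
    that the trace falls in a cell is bounded below by a sum over the numbers of
    self-loops: Chebyshev's inequality shows that a sojourn with m steps has
    a length close to m divided by the rate ([block_event_ge]), and the geometric
    weights of the m in the right range converge to an exponential probability
    ([cvg_expr_trunc]). *)

(** * Generators of irreducible chains *)

Section Generator.
Context {R : realType} {T : finType}.
Variable r : T -> T -> R.
Implicit Types (u v : T -> R) (B : pred T).

Definition generator u y : R := \sum_z r y z * (u z - u y).

Lemma generatorB u v y :
  generator (fun z => u z - v z) y = generator u y - generator v y.
Proof.
rewrite /generator -sumrB; apply: eq_bigr => z _.
by rewrite -mulrBr; congr (_ * _); ring.
Qed.

Lemma generatorZ c u y : generator (fun z => c * u z) y = c * generator u y.
Proof. by rewrite /generator mulr_sumr; apply: eq_bigr => z _; ring. Qed.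

Lemma generator_sum (I : finType) (P : pred I) (u : I -> T -> R) y :
  generator (fun z => \sum_(i | P i) u i z) y = \sum_(i | P i) generator (u i) y.
Proof.
rewrite /generator exchange_big/=; apply: eq_bigr => z _.
by rewrite -sumrB mulr_sumr.
Qed.

Lemma generator_cst c y : generator (fun=> c) y = 0.
Proof. by rewrite /generator big1// => z _; rewrite subrr mulr0. Qed.

Hypothesis r_ge0 : forall y z, 0 <= r y z.
Hypothesis r_irr : forall y z, connect [rel y z | 0 < r y z] y z.

(** At a point where u is positive and maximal, the generator is a sum of
    nonpositive terms; they all vanish, so the maximum propagates along the
    edges, and irreducibility carries it to b, where u is nonpositive. *)
Lemma maximum_principle B b u : B b ->
  (forall y, ~~ B y -> 0 <= generator u y) -> (forall y, B y -> u y <= 0) ->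
  forall y, u y <= 0.
Proof.
move=> Bb Lu uB y.
have [m _ mP] := @arg_maxP _ _ _ b xpredT u isT.
have {}mP w : u w <= u m by exact: mP.
apply: le_trans (mP y) _; rewrite leNgt; apply/negP => um.
suff {y} um_all y : connect [rel y z | 0 < r y z] m y -> u y = u m.
  by have := uB _ Bb; rewrite (um_all b (r_irr m b)) leNgt um.
move=> /connectP[p]; elim: p y m um mP => [|z p ih] y m um mP /=.
  by move=> _ ->.
move=> /andP[rmz zp] yE.
suff uz : u z = u m.
  by rewrite -uz; apply: (ih y z) => //; [rewrite uz|move=> w; rewrite uz].
have Bm : ~~ B m by apply/negP => /uB; rewrite leNgt um.
have tm_ge0 w : 0 <= r m w * (u m - u w) by rewrite mulr_ge0// subr_ge0.
have sum0 : \sum_w r m w * (u m - u w) = 0.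
  apply/eqP; rewrite eq_le sumr_ge0 ?andbT// -oppr_ge0 -sumrN.
  apply: le_trans (Lu _ Bm) _.
  by apply: ler_sum => w _; rewrite -mulrN opprB.
have := psumr_eq0P (fun w _ => tm_ge0 w) sum0 (erefl : xpredT z).
move/eqP; rewrite mulf_eq0 (gt_eqF rmz)/= subr_eq0 => /eqP -> //.
Qed.

Lemma dirichlet_unique B b u v : B b ->
  (forall y, ~~ B y -> generator u y = generator v y) ->
  (forall y, B y -> u y = v y) -> u =1 v.
Proof.
move=> Bb Luv uvB y; apply/eqP; rewrite eq_le -[X in X && _]subr_le0.
rewrite -[X in _ && X]subr_le0; apply/andP; split.
  apply: (@maximum_principle B b (fun z => u z - v z)) => // z Bz.
    by rewrite generatorB Luv// subrr.
  by rewrite uvB// subrr.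
apply: (@maximum_principle B b (fun z => v z - u z)) => // z Bz.
  by rewrite generatorB Luv// subrr.
by rewrite uvB// subrr.
Qed.

(** The problem is a square linear system, and uniqueness makes it
    invertible. *)
Lemma dirichlet_exists B b (g c : T -> R) : B b ->
  exists u, (forall y, B y -> u y = g y) /\
            (forall y, ~~ B y -> generator u y = c y).
Proof.
move=> Bb.
pose a y z : R := if B y then (z == y)%:R else r y z - (z == y)%:R * \sum_w r y w.
have aE u y : \sum_z a y z * u z = if B y then u y else generator u y.
  rewrite /a; case: ifPn => By.
    rewrite (bigD1 y)//= eqxx mul1r big1 ?addr0// => z /negPf ->.
    by rewrite mul0r.
  under eq_bigr do rewrite mulrBl.
  rewrite sumrB /generator; under [RHS]eq_bigr do rewrite mulrBr.
  rewrite sumrB; congr (_ - _).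
  rewrite (bigD1 y)//= eqxx mul1r [X in _ + X]big1 ?addr0 ?mulr_suml//.
  by move=> z /negPf ->; rewrite !mul0r.
pose M : 'M[R]_#|T| := \matrix_(i, j) a (enum_val i) (enum_val j).
pose fn (v : 'cV[R]_#|T|) z : R := v (enum_rank z) 0.
have ME (v : 'cV[R]_#|T|) y : (M *m v) (enum_rank y) 0 = if B y then fn v y else generator (fn v) y.
  rewrite -aE mxE (reindex _ (onW_bij _ (@enum_rank_bij T)))/=.
  by apply: eq_bigr => z _; rewrite mxE !enum_rankK.
have Munit : M \in unitmx.
  rewrite -unitmx_tr -row_free_unit -kermx_eq0; apply/eqP/row_matrixP => i.
  rewrite row0; set w := row i _.
  have : w *m M^T = 0 by apply/sub_kermxP; exact: row_sub.
  move=> /(congr1 trmx); rewrite trmx_mul trmxK trmx0 => Mw.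
  have fw0 : fn w^T =1 (fun=> 0).
    apply: (dirichlet_unique Bb) => y By.
      by have := ME w^T y; rewrite Mw mxE (negPf By) generator_cst.
    by have := ME w^T y; rewrite Mw mxE By.
  apply/rowP => j; have := fw0 (enum_val j).
  by rewrite /fn enum_valK mxE => ->; rewrite mxE.
pose rhs : 'cV[R]_#|T| :=
  \col_i (if B (enum_val i) then g (enum_val i) else c (enum_val i)).
exists (fn (invmx M *m rhs)); split=> y By.
  by have := ME (invmx M *m rhs) y; rewrite mulKVmx// mxE enum_rankK By.
by have := ME (invmx M *m rhs) y; rewrite mulKVmx// mxE enum_rankK (negPf By).
Qed.

(** [om b y] is the probability that the chain started at y enters G at b. *)
Definition hitting_distribution (G : pred T) (om : T -> T -> R) : Prop :=
  forall b, G b -> (forall y, G y -> om b y = (y == b)%:R) /\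
                   (forall y, ~~ G y -> generator (om b) y = 0).

Lemma hitting_distribution_exists (G : pred T) b0 : G b0 ->
  exists om, hitting_distribution G om.
Proof.
move=> Gb0; have /choice[om omP] : forall b, exists u,
    (forall y, G y -> u y = (y == b)%:R) /\
    (forall y, ~~ G y -> generator u y = 0).
  by move=> b; exact: (dirichlet_exists _ _ Gb0).
by exists om => b _; exact: omP.
Qed.

Section HittingDistribution.
Variables (G : pred T) (om : T -> T -> R) (b0 : T).
Hypotheses (Gb0 : G b0) (omP : hitting_distribution G om).

Lemma hitting_distribution_ge0 b y : G b -> 0 <= om b y.
Proof.
move=> Gb; have [om1 om2] := omP Gb.
rewrite -oppr_le0; apply: (@maximum_principle G b0 (fun z => - om b z)) => //.
  move=> z Gz; have := generatorZ (-1) (om b) z; rewrite om2// mulr0.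
  by under [X in generator X]eq_fun do rewrite mulN1r; move=> ->.
by move=> z Gz; rewrite om1// oppr_le0.
Qed.

Lemma harmonic_extension f : (forall y, ~~ G y -> generator f y = 0) ->
  forall y, f y = \sum_(b | G b) f b * om b y.
Proof.
move=> Lf y.
apply: (@dirichlet_unique G b0 f (fun y => \sum_(b | G b) f b * om b y)) => //.
  move=> z Gz; rewrite Lf// generator_sum big1// => b Gb.
  by rewrite generatorZ (omP Gb).2// mulr0.
move=> z Gz; rewrite (bigD1 z)//= (omP Gz).1// eqxx mulr1 big1 ?addr0//.
by move=> b /andP[Gb bz]; rewrite (omP Gb).1// eq_sym (negPf bz) mulr0.
Qed.

Lemma hitting_distribution_sum y : \sum_(b | G b) om b y = 1.
Proof.
have := @harmonic_extension (fun=> 1) _ y.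
under eq_bigr do rewrite mul1r.
by move=> <- // z _; rewrite generator_cst.
Qed.

(** The rate at which the chain leaves a with b as its next point in G. *)
Definition trace_rate a b : R := \sum_z r a z * om b z.

Lemma trace_rate_ge0 a b : G b -> 0 <= trace_rate a b.
Proof.
by move=> Gb; apply: sumr_ge0 => z _; rewrite mulr_ge0// hitting_distribution_ge0.
Qed.

(** A function which is harmonic off G is an average of its values on G, so
    that on such functions the chain may be replaced by its trace on G. *)
Lemma trace_generator f a : (forall y, ~~ G y -> generator f y = 0) ->
  generator f a = \sum_(c | G c) trace_rate a c * (f c - f a).
Proof.
move=> Lf; under eq_bigr do rewrite /trace_rate mulr_suml.
rewrite exchange_big/=; apply: eq_bigr => z _.
rewrite (harmonic_extension Lf z) -[X in _ - X]mul1r -(hitting_distribution_sum z).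
rewrite mulr_suml -sumrB mulr_sumr.
by apply: eq_bigr => c _; ring.
Qed.

End HittingDistribution.

(** Here f and g are the mean time and the mean time spent in A before
    hitting b, and f', g' those before hitting a. Over a cycle from a to b
    and back, the fraction of time spent in A is mu(A) / mu(T). *)
Lemma cycle_formula (mu : T -> R) (A : pred T) (a b : T) (f f' g g' : T -> R) :
    (forall y, 0 < mu y) -> (forall u, \sum_y mu y * generator u y = 0) ->
    a != b -> f b = 0 -> f' a = 0 -> g b = 0 -> g' a = 0 ->
    (forall y, y != b -> generator f y = -1) ->
    (forall y, y != a -> generator f' y = -1) ->
    (forall y, y != b -> generator g y = - (A y)%:R) ->
    (forall y, y != a -> generator g' y = - (A y)%:R) ->
  (g a + g' b) * (\sum_y mu y) = (\sum_(y | A y) mu y) * (f a + f' b).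
Proof.
move=> mu0 mu_inv ab fb f'a gb g'a Lf Lf' Lg Lg'.
set m := \sum_y mu y; set mA := \sum_(y | A y) mu y.
have defect c (E : pred T) h : (forall y, y != c -> generator h y = - (E y)%:R) ->
    mu c * (generator h c + (E c)%:R) = \sum_(y | E y) mu y.
  move=> Lh; have := mu_inv h; rewrite (bigD1 c)//= => /eqP.
  rewrite addr_eq0 => /eqP; rewrite mulrDr => ->.
  rewrite (eq_bigr (fun y => - (mu y * (E y)%:R))); last first.
    by move=> y /Lh ->; rewrite mulrN.
  rewrite sumrN opprK addrC -(bigD1 c (P := xpredT))//= [RHS]big_mkcond/=.
  by apply: eq_bigr => y _; case: (E y); rewrite ?mulr1 ?mulr0.
(* By stationarity the generators at the target point are determined by the
   integrals against mu, so that phi is harmonic at a as well as off a and b. *)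
pose phi y := m * (g y - g' y) - mA * (f y - f' y).
have Lphi y : generator phi y = m * (generator g y - generator g' y) -
    mA * (generator f y - generator f' y).
  by rewrite /phi generatorB !generatorZ !generatorB.
have Lphi0 y : y != b -> generator phi y = 0.
  move=> yb; rewrite Lphi Lg// Lf//.
  have [->{y yb}|ya] := eqVneq y a; last by rewrite Lg'// Lf'//; ring.
  have := defect a A g' Lg'; have := defect a xpredT f' Lf'.
  rewrite -/m -/mA /= => e1 e2; apply: (mulfI (lt0r_neq0 (mu0 a))).
  rewrite mulr0; transitivity (mA * (mu a * (generator f' a + 1)) -
    m * (mu a * (generator g' a + (A a)%:R))); first by ring.
  by rewrite e1 e2; ring.
have phi_cst : phi a = phi b.
  apply: (@dirichlet_unique (pred1 b) b phi (fun=> phi b)) => //=.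
    by move=> y yb; rewrite Lphi0// generator_cst.
  by move=> y /eqP ->.
by move: phi_cst; rewrite /phi fb f'a gb g'a; lra.
Qed.

End Generator.

(** * Rates and Gibbs measure of the Potts dynamics *)

(** The iterates of the cyclic successor reach every element. *)
Lemma ordS_ind n (p : pred 'I_n) (b : 'I_n) :
  p b -> (forall i, p i -> p (ordS i)) -> forall i, p i.
Proof.
move=> pb pS i.
have n0 : (0 < n)%N by apply: leq_ltn_trans (ltn_ord b).
have piter k : p (iter k (@ordS n) b) by elim: k => //= k; exact: pS.
have iterE k : val (iter k (@ordS n) b) = ((b + k) %% n)%N.
  elim: k => [|k ih]; first by rewrite addn0 modn_small.
  by rewrite iterS /= ih -addn1 modnDml addn1 addnS.
suff -> : i = iter (n - b + i) (@ordS n) b by [].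
by apply: val_inj; rewrite iterE addnA subnKC ?modnDl ?modn_small// ltnW.
Qed.

Lemma ordS_neq n (i : 'I_n) : (1 < n)%N -> ordS i != i.
Proof.
move=> n1; apply/eqP => /(congr1 val)/= /eqP.
have [lt|ge] := ltnP i.+1 n.
  by rewrite modn_small// gtn_eqF.
have -> : i.+1 = n by apply/eqP; rewrite eqn_leq ge ltn_ord.
rewrite modnn => /eqP i0; rewrite -i0 in ge.
by have := leq_trans n1 ge.
Qed.

Section Energy.
Variables K L q : nat.
Local Notation config := (config K L q).
Local Notation site := (site K L).
Implicit Types (s z : config) (x y : site) (a b : 'I_q).

Lemma update_id s x : update s x (s x) = s.
Proof. by apply/ffunP => y; rewrite ffunE; case: eqP => [->|]. Qed.

Lemma update_update s x a b : update (update s x a) x b = update s x b.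
Proof. by apply/ffunP => y; rewrite !ffunE; case: eqP. Qed.

Lemma update_at s x a : update s x a x = a.
Proof. by rewrite ffunE eqxx. Qed.

Lemma H_constant a : H (constant_config K L a) = 0%N.
Proof.
apply/eqP; rewrite cards_eq0; apply/eqP/setP => e; rewrite !inE.
by apply/imsetP => -[p]; rewrite inE !ffunE eqxx andbF.
Qed.

Lemma H_eq0 s (x0 : site) : H s = 0%N -> is_ground s.
Proof.
move=> /eqP; rewrite cards_eq0 => /eqP Hs.
have nn x y : nearest_neighbor x y -> s x = s y.
  move=> xy; apply/eqP/negPn/negP => sxy.
  suff : [set x; y]%SET \in (finset.set0 : {set {set site}}) by rewrite inE.
  by rewrite -Hs; apply/imsetP; exists (x, y); rewrite ?inE/= ?xy.
apply/existsP; exists (s x0); apply/eqP/ffunP => -[i j]; rewrite ffunE.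
apply/eqP; case: x0 => i0 j0; move: i.
apply: (@ordS_ind _ _ i0) => [|i /eqP <-]; last first.
  by rewrite -(nn (i, j))// /nearest_neighbor/= !eqxx/= orbT.
move: j; apply: (@ordS_ind _ _ j0) => [//|j /eqP <-].
by rewrite -(nn (i0, j))// /nearest_neighbor/= !eqxx.
Qed.

(** Only the four edges at x can join different spins. *)
Lemma H_update_constant a x b : (H (update (constant_config K L a) x b) <= 4)%N.
Proof.
pose nb : seq site := [:: (x.1, ordS x.2); (x.1, ord_pred x.2);
                          (ordS x.1, x.2); (ord_pred x.1, x.2)].
have nbP y : nearest_neighbor x y || nearest_neighbor y x -> y \in nb.
  rewrite /nearest_neighbor !inE -!pair_eqE/=.
  have ordSP n (i j : 'I_n) : (i == ordS j) = (j == ord_pred i).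
    by apply/eqP/eqP => ->; rewrite ?ordSK ?ord_predK.
  have pr n (i j : 'I_n) : (i == ordS j) = (ord_pred i == j).
    by rewrite ordSP eq_sym.
  case: y x {nb} => y1 y2 [x1 x2]/=.
  rewrite (ordSP _ x2 y2) (ordSP _ x1 y1) (eq_sym x1 y1) (eq_sym x2 y2).
  by case: (y1 == x1); case: (y2 == x2); case: (y2 == ordS x2);
    case: (y2 == ord_pred x2); case: (y1 == ordS x1); case: (y1 == ord_pred x1).
apply: (@leq_trans #|[set [set x; y]%SET | y in nb]%SET|); last first.
  by apply: leq_trans (leq_imset_card _ _) _; exact: card_size.
apply/subset_leq_card/fintype.subsetP => e /imsetP[[y z]]; rewrite inE/= => /andP[yz].
rewrite !ffunE; have [yx|yx] := eqVneq y x.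
  by rewrite yx in yz * => _ ->; apply/imsetP; exists z => //; apply: nbP; rewrite yz.
have [zx|zx] := eqVneq z x; last by rewrite eqxx.
rewrite zx in yz * => _ ->; apply/imsetP; exists y; rewrite 1?finset.setUC//.
by apply: nbP; rewrite yz orbT.
Qed.

Lemma is_ground_constant a : is_ground (constant_config K L a).
Proof. by apply/existsP; exists a. Qed.

End Energy.

Section Rates.
Variables (R : realType) (K L q : nat) (D : dynamics).
Hypotheses (K_gt0 : (0 < K)%N) (L_gt0 : (0 < L)%N) (q_ge : (min_spins D <= q)%N).
Local Notation config := (config K L q).
Local Notation site := (site K L).
Implicit Types (s z : config) (x y : site) (a b : 'I_q).
Variable beta : R.
Local Notation rate := (@rate K L q R D beta).

Let q_gt1 : (1 < q)%N. Proof. by case: D q_ge => //; exact: ltnW. Qed.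

Definition site0 : site := (Ordinal K_gt0, Ordinal L_gt0).

Lemma rate_ge0 s z : 0 <= rate s z.
Proof.
rewrite /Defs.rate; case: D; rewrite ?/MH_rate ?/Cyclic_rate.
  by case: ifP => // _; exact: expR_ge0.
by case: pickP => // *; exact: expR_ge0.
Qed.

Lemma tau_neq x s : tau x s != s.
Proof.
apply/eqP => /(congr1 (fun s => s x)); rewrite update_at => /eqP.
by rewrite (negPf (ordS_neq _ q_gt1)).
Qed.

Lemma rate_diag s : rate s s = 0.
Proof.
rewrite /Defs.rate; case: D; rewrite ?/MH_rate ?/Cyclic_rate ?eqxx//.
by case: pickP => // x; rewrite eq_sym (negPf (tau_neq _ _)).
Qed.

Lemma holding_rateE s : holding_rate rate s = \sum_z rate s z.
Proof. by rewrite (bigD1 s)//= rate_diag add0r. Qed.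

(** Under the cyclic dynamics the spin at x reaches a by successive
    increments. *)
Lemma rate_update_connect s x a : connect [rel s z | 0 < rate s z] s (update s x a).
Proof.
move: a; rewrite /Defs.rate; case: D => /=.
  move=> a; have [->|ne] := eqVneq (update s x a) s; first exact: connect0.
  apply: connect1 => /=; rewrite /MH_rate ne /= ifT ?expR_gt0//.
  by apply/existsP; exists x; apply/existsP; exists a.
apply: (@ordS_ind _ _ (s x)) => [|a sa]; first by rewrite update_id connect0.
apply: connect_trans sa _; apply: connect1 => /=; rewrite /Cyclic_rate.
case: pickP => [y _|/(_ x)]; first exact: expR_gt0.
by rewrite /tau update_at update_update eqxx.
Qed.

Lemma rate_irreducible s z : connect [rel s z | 0 < rate s z] s z.
Proof.
have step (l : seq site) s' : connect [rel s z | 0 < rate s z] s'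
    [ffun y => if y \in l then z y else s' y].
  elim: l s' => [|x l ih] s'.
    suff -> : [ffun y => if y \in [::] then z y else s' y] = s' by exact: connect0.
    by apply/ffunP => y; rewrite ffunE.
  apply: connect_trans (rate_update_connect _ x (z x)) _.
  apply: connect_trans (ih _) _; rewrite (_ : [ffun _ => _] = [ffun y =>
    if y \in x :: l then z y else s' y]) ?connect0//.
  apply/ffunP => y; rewrite !ffunE inE.
  by have [->|] := eqVneq y x; case: ifP.
suff e : [ffun y => if y \in enum {: site} then z y else s y] = z.
  by have := step (enum {: site}) s; rewrite e.
by apply/ffunP => y; rewrite ffunE mem_enum.
Qed.

Lemma holding_rate_gt0 s : 0 < holding_rate rate s.
Proof.
pose z := tau site0 s; have zs : z != s := tau_neq _ _.
have /connectP[[|w p] /=] := rate_irreducible s z.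
  by move=> _ zE; rewrite zE eqxx in zs.
move=> /andP[sw _] _; rewrite holding_rateE (bigD1 w)//=.
by apply: ltr_wpDr => //; apply: sumr_ge0 => v _; exact: rate_ge0.
Qed.

(** The exponent 4 is less than Gamma, so the accelerated process leaves the
    ground states faster and faster. *)
Lemma holding_rate_constant a : 0 <= beta ->
  expR (- (beta * 4)) <= holding_rate rate (constant_config K L a).
Proof.
move=> b0; pose s := constant_config K L a.
suff [z zs] : exists z, expR (- (beta * 4)) <= rate s z.
  rewrite holding_rateE (bigD1 z)//=.
  by apply: le_trans zs _; rewrite lerDl; apply: sumr_ge0 => v _; exact: rate_ge0.
exists (tau site0 s); rewrite /Defs.rate; case: D.
  rewrite /MH_rate tau_neq/= ifT; last first.
    by apply/existsP; exists site0; apply/existsP; exists (ordS (s site0)).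
  rewrite ler_expR lerN2 ler_wpM2l// ge_max ler0n andbT H_constant subr0.
  by rewrite ler_nat; exact: H_update_constant.
rewrite /Cyclic_rate; case: pickP => [y _|/(_ site0)]; last by rewrite eqxx.
rewrite ler_expR lerN2 ler_wpM2l// H_constant subr0 ler_nat.
by apply/bigmax_leqP => b _; exact: H_update_constant.
Qed.

Definition gibbs s : R := expR (- (beta * (H s)%:R)).

Lemma gibbs_gt0 s : 0 < gibbs s. Proof. exact: expR_gt0. Qed.

Lemma MH_rate_sym s z : gibbs s * MH_rate beta s z = gibbs z * MH_rate beta z s.
Proof.
rewrite /MH_rate eq_sym; case: eqVneq => [->//|sz] /=.
have sym s' z' : [exists x, exists a, z' == update s' x a] ->
    [exists x, exists a, s' == update z' x a].
  move=> /existsP[x /existsP[a /eqP ->]]; apply/existsP; exists x.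
  by apply/existsP; exists (s' x); rewrite update_update update_id.
have -> : [exists x, exists a, s == update z x a] =
          [exists x, exists a, z == update s x a] by apply/idP/idP; exact: sym.
case: ifP => _; last by rewrite !mulr0.
rewrite /gibbs -!expRD; congr expR.
rewrite -!opprD -!mulrDr; congr (- (_ * _)).
by case: (leP ((H z)%:R - (H s)%:R) (0 : R)) => ?;
  case: (leP ((H s)%:R - (H z)%:R) (0 : R)) => ?; lra.
Qed.

Lemma Cyclic_rateE s z : Cyclic_rate beta s z = \sum_x (z == tau x s)%:R *
  expR (- (beta * ((\max_(a : 'I_q) H (update s x a))%N%:R - (H s)%:R))).
Proof.
have tau_inj x y : tau x s = tau y s -> x = y.
  move=> e; apply/eqP/negPn/negP => xy; have := congr1 (fun s => s x) e.
  rewrite update_at ffunE (negPf xy) => /eqP.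
  by rewrite (negPf (ordS_neq _ q_gt1)).
rewrite /Cyclic_rate; case: pickP => [x /eqP zx|h].
  rewrite (bigD1 x)//= {1}zx eqxx mul1r [X in _ = _ + X]big1 ?addr0// => y yx.
  rewrite zx; case: eqP => [/tau_inj e|]; last by rewrite mul0r.
  by rewrite e eqxx in yx.
by rewrite big1// => x _; rewrite h mul0r.
Qed.

(** The Metropolis rates are reversible. For the cyclic rates, the flow from
    s to [tau x s] depends on the spins off x only, hence is constant along
    the cycles of [tau x]. *)
Lemma gibbs_stationary (u : config -> R) :
  \sum_s gibbs s * generator rate u s = 0.
Proof.
rewrite /Defs.rate /generator; case: D.
  under eq_bigr do rewrite mulr_sumr.
  set S := LHS; suff : S = - S by lra.
  rewrite {1}/S exchange_big/= /S -sumrN; apply: eq_bigr => s _.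
  rewrite -sumrN; apply: eq_bigr => z _.
  by rewrite !mulrA MH_rate_sym -mulrN opprB.
pose c x s : R := expR (- (beta * (\max_(a : 'I_q) H (update s x a))%N%:R)).
transitivity (\sum_s \sum_x c x s * (u (tau x s) - u s)).
  apply: eq_bigr => s _; under eq_bigr do rewrite Cyclic_rateE mulr_suml.
  rewrite exchange_big mulr_sumr/=; apply: eq_bigr => x _.
  rewrite (bigD1 (tau x s))//= eqxx mul1r [X in _ + X]big1 ?addr0; last first.
    by move=> z /negPf ->; rewrite !mul0r.
  rewrite mulrA; congr (_ * _); rewrite /gibbs /c -expRD; congr expR.
  by ring.
rewrite exchange_big/= big1// => x _.
under eq_bigr do rewrite mulrBr.
rewrite sumrB; apply/eqP; rewrite subr_eq0; apply/eqP.
have tau_inj : injective (@tau K L q x).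
  move=> s z e; have sx : s x = z x.
    have := congr1 (fun s => s x) e; rewrite !update_at.
    exact: can_inj (@ordSK q) _ _.
  by rewrite -(update_id s x) -(update_id z x) -sx -(update_update s x (ordS (s x)))
    -/(tau x s) e update_update.
rewrite [RHS](reindex_inj tau_inj)/=; apply: eq_bigr => s _; congr (_ * _).
rewrite /c; congr expR; congr (- (_ * _%:R)).
by apply: eq_bigr => a _; rewrite update_update.
Qed.

Lemma gibbs_sum_ge1 : 1 <= \sum_s gibbs s.
Proof.
have q0 : (0 < q)%N by exact: ltnW.
rewrite (bigD1 (constant_config K L (Ordinal q0)))//=.
rewrite {1}/gibbs H_constant mulr0 oppr0 expR0 lerDl.
by apply: sumr_ge0 => s _; exact/ltW/gibbs_gt0.
Qed.

(** A configuration which is not a ground state has energy at least 1. *)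
Lemma gibbs_nonground : 0 <= beta ->
  \sum_(s | ~~ is_ground s) gibbs s <= #|{: config}|%:R * expR (- beta).
Proof.
move=> b0; apply: (@le_trans _ _ (\sum_(s : config) expR (- beta))).
  rewrite [leLHS]big_mkcond/=; apply: ler_sum => s _; case: ifPn => [gs|_].
    rewrite ler_expR lerN2 ler_peMr// ler1n lt0n.
    by apply: contraNN gs => /eqP /(H_eq0 site0).
  exact: expR_ge0.
by rewrite sumr_const -[leLHS]mulr_natl.
Qed.

End Rates.

(** * Time changes and neighborhoods in the Skorokhod space *)

Section JumpTimes.
Context {R : realType}.
Implicit Types (h t J : nat -> R) (s e c a b u : R).

Definition jump_time h n : R := \sum_(i < n) h i.

Definition divergent h : Prop := forall s, exists n, s < jump_time h n.

Lemma jump_time0 h : jump_time h 0 = 0.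
Proof. by rewrite /jump_time big_ord0. Qed.

Lemma jump_timeS h n : jump_time h n.+1 = jump_time h n + h n.
Proof. by rewrite /jump_time big_ord_recr. Qed.

Lemma jump_time_le h m n : (forall i, 0 < h i) -> (m <= n)%N ->
  jump_time h m <= jump_time h n.
Proof.
move=> h0 /subnK <-; elim: (n - m)%N => // k ih.
by rewrite addSn jump_timeS; apply: le_trans ih _; rewrite lerDl ltW.
Qed.

Lemma jump_time_ge0 h n : (forall i, 0 < h i) -> 0 <= jump_time h n.
Proof. by move=> h0; apply: sumr_ge0 => i _; exact/ltW. Qed.

Lemma jump_time_itv h s : (forall i, 0 < h i) -> divergent h -> 0 <= s ->
  exists n, jump_time h n <= s < jump_time h n.+1.
Proof.
move=> h0 /(_ s) hs s0.
have [n sn nP] := find_ex_minn hs.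
case: n sn nP => [|n]; first by rewrite jump_time0 ltNge s0.
move=> sn nP; exists n; rewrite sn andbT leNgt; apply/negP => /nP.
by rewrite ltnn.
Qed.

Lemma jump_time_itv_inj h s m n : (forall i, 0 < h i) ->
  jump_time h m <= s < jump_time h m.+1 -> jump_time h n <= s < jump_time h n.+1 ->
  m = n.
Proof.
move=> h0 /andP[m1 m2] /andP[n1 n2].
case: (ltngtP m n) => // [mn|nm].
  by have := le_lt_trans (le_trans (jump_time_le h0 mn) n1) m2; rewrite ltxx.
by have := le_lt_trans (le_trans (jump_time_le h0 nm) m1) n2; rewrite ltxx.
Qed.

(** The increasing piecewise linear map that is the identity up to c, maps
    [c, c + a] onto [c, c + b], and is a translation beyond. *)
Definition bend c a b u : R :=
  if u <= c then u else if u <= c + a then c + (u - c) * (b / a) else u + (b - a).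

Lemma bend_lt c a b u v : 0 < a -> 0 < b -> u < v -> bend c a b u < bend c a b v.
Proof.
move=> a0 b0 uv; rewrite /bend; set m := b / a.
have m0 : 0 < m by rewrite divr_gt0.
have am : b = a * m by rewrite /m mulrC divfK// gt_eqF.
rewrite am; have [uc|uc] := leP u c; have [vc|vc] := leP v c => //; try lra.
- by case: ifPn => [vca|]; [nra|rewrite -ltNge => vca; nra].
- have [uca|uca] := leP u (c + a); have [vca|vca] := leP v (c + a); try nra.
Qed.

Lemma bendK c a b u : 0 < a -> 0 < b -> bend c b a (bend c a b u) = u.
Proof.
move=> a0 b0; rewrite {2}/bend.
have [uc|uc] := leP u c; first by rewrite /bend uc.
have [uca|uca] := leP u (c + a).
  have p0 : 0 < (u - c) * (b / a) by rewrite mulr_gt0 ?divr_gt0 ?subr_gt0.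
  rewrite /bend leNgt ltrDl p0/= lerD2l ifT.
    by field; rewrite !gt_eqF.
  by rewrite mulrCA -[leRHS]mulr1 ler_wpM2l ?(ltW b0)// ler_pdivrMr// mul1r lerBlDl.
rewrite /bend ifF; last by apply/negbTE; rewrite -ltNge; lra.
by rewrite ifF; [lra|apply/negbTE; rewrite -ltNge; lra].
Qed.

Lemma bend_ge0 c a b u : 0 <= c -> 0 < a -> 0 < b -> 0 <= u -> 0 <= bend c a b u.
Proof.
move=> c0 a0 b0 u0; rewrite /bend; case: ifPn => //; rewrite -ltNge => cu.
case: ifPn => [_|]; last by rewrite -ltNge; lra.
by rewrite addr_ge0// mulr_ge0// ?divr_ge0 ?ltW// subr_gt0.
Qed.

Lemma time_change_bend c a b : 0 <= c -> 0 < a -> 0 < b -> time_change (bend c a b).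
Proof.
move=> c0 a0 b0; split; first by move=> s t _; exact: bend_lt.
split.
- move=> s /=; rewrite !in_itv/= !andbT; exact: bend_ge0.
- by move=> s t _ _ /(congr1 (bend c b a)); rewrite !bendK.
- move=> s /=; rewrite in_itv/= andbT => s0; exists (bend c b a s).
    by rewrite /= in_itv/= andbT bend_ge0.
  by rewrite bendK.
Qed.

(** Interpolate linearly between the knots, one [bend] at a time; the
    distance to the identity is largest at a knot. *)
Lemma time_change_knots t J e n : t 0 = 0 -> J 0 = 0 ->
    (forall i, (i < n)%N -> t i < t i.+1) -> (forall i, (i < n)%N -> J i < J i.+1) ->
    (forall i, (i <= n)%N -> `|J i - t i| <= e) ->
  exists lam, [/\ time_change lam, forall s, 0 <= s -> `|lam s - s| <= e,
    forall s, t n <= s -> lam s = s + (J n - t n) &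
    forall i s, (i < n)%N -> t i <= s < t i.+1 -> J i <= lam s < J i.+1].
Proof.
move=> t0 J0; elim: n => [|n ih] tlt Jlt close.
  exists id; split => //; first exact: time_change_id.
    by move=> s _; rewrite subrr normr0; apply: le_trans (close 0 isT); exact: normr_ge0.
  by move=> s _; rewrite t0 J0; lra.
have [|||lam [lamT lam_e lam_n lam_i]] := ih.
- by move=> i ni; apply: tlt; exact: ltnW.
- by move=> i ni; apply: Jlt; exact: ltnW.
- by move=> i ni; apply: close; exact: leq_trans ni _.
have mono (u : nat -> R) k : (forall i, (i < k)%N -> u i < u i.+1) ->
    forall i j, (i <= j)%N -> (j <= k)%N -> u i <= u j.
  move=> uS i j /subnK <-; elim: (j - i)%N => // m IH mk.
  by rewrite addSn in mk *; apply: le_trans (IH (ltnW mk)) _; exact/ltW/uS.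
have tn0 : 0 <= t n by rewrite -t0; apply: (mono _ n.+1).
have Jn0 : 0 <= J n by rewrite -J0; apply: (mono _ n.+1).
pose a := t n.+1 - t n; pose b := J n.+1 - J n.
have a0 : 0 < a by rewrite subr_gt0 tlt.
have b0 : 0 < b by rewrite subr_gt0 Jlt.
have lamlt s : 0 <= s -> s < t n -> lam s < J n.
  move=> s0 stn; have := lam_n (t n) (lexx _); rewrite [_ + _](_ : _ = J n); last by lra.
  by move=> <-; exact: lamT.1.
have lamle s : 0 <= s -> s <= t n -> lam s <= J n.
  move=> s0; rewrite le_eqVlt => /predU1P[->|/(lamlt _ s0)/ltW//].
  by rewrite lam_n// addrCA subrr addr0.
exists (bend (J n) a b \o lam); split.
- exact: (time_change_comp lamT (time_change_bend Jn0 a0 b0)).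
- move=> s s0 /=; have [stn|tns] := leP s (t n).
    by rewrite /bend lamle//; exact: lam_e.
  rewrite /bend lam_n; last exact: ltW.
  rewrite ifF; last by apply/negbTE; rewrite -ltNge; lra.
  have := close _ (leqnSn n); have := close _ (leqnn n.+1).
  rewrite !ler_norml => /andP[B1 B2] /andP[A1 A2]; case: ifPn => [sa|].
    set v := s - t n; have v0 : 0 < v by rewrite subr_gt0.
    have va : v <= a by move: sa; rewrite /v /a; lra.
    pose th := v / a.
    have th0 : 0 <= th by rewrite divr_ge0 ?ltW.
    have th1 : th <= 1 by rewrite ler_pdivrMr// mul1r.
    have -> : J n + (s + (J n - t n) - J n) * (b / a) - s =
              (J n - t n) + th * (b - a).
      by rewrite /th /v; field; rewrite gt_eqF.
    have -> : b - a = (J n.+1 - t n.+1) - (J n - t n) by rewrite /a /b; ring.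
    move: A1 A2 B1 B2; set A := J n - t n; set B := J n.+1 - t n.+1 => A1 A2 B1 B2.
    have p1 : 0 <= (1 - th) * (e - A) by rewrite mulr_ge0 ?subr_ge0.
    have p2 : 0 <= th * (e - B) by rewrite mulr_ge0 ?subr_ge0.
    have p3 : 0 <= (1 - th) * (A + e) by rewrite mulr_ge0 ?subr_ge0// -lerBlDr sub0r.
    have p4 : 0 <= th * (B + e) by rewrite mulr_ge0// -lerBlDr sub0r.
    by apply/andP; split; lra.
  by rewrite /a /b => _; apply/andP; split; lra.
- move=> s ts /=; have tns : t n < s by apply: lt_le_trans ts; exact: tlt.
  rewrite /bend lam_n; last exact: ltW.
  rewrite ifF; last by apply/negbTE; rewrite -ltNge; lra.
  case: ifPn => [sa|_]; last by rewrite /a /b; lra.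
  have sE : s = t n.+1 by apply/eqP; rewrite eq_le ts andbT; move: sa; rewrite /a; lra.
  have -> : s + (J n - t n) - J n = a by rewrite sE /a; ring.
  by rewrite mulrC divfK ?gt_eqF// sE /b; ring.
- move=> i s; rewrite ltnS leq_eqVlt => /predU1P[->{i}|ni] /andP[ts st] /=.
    rewrite /bend lam_n//; case: ifPn => [c|].
      have sE : s = t n by apply/eqP; rewrite eq_le ts andbT; lra.
      by rewrite sE; have := Jlt n (ltnSn n); lra.
    rewrite -ltNge => c; rewrite ifT; last by rewrite /a; lra.
    set v := s - t n; have v0 : 0 < v by rewrite /v; lra.
    have -> : s + (J n - t n) - J n = v by rewrite /v; ring.
    have vba : v * (b / a) < b.
      by rewrite mulrCA gtr_pMr// ltr_pdivrMr// mul1r /v /a; lra.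
    rewrite lerDl mulr_ge0 ?divr_ge0 ?ltW//=.
    by move: vba; rewrite /b; lra.
  have [s0 stn] : 0 <= s /\ s < t n.
    split; first by apply: le_trans ts; rewrite -t0; apply: (mono _ n.+1) => //; exact/leqW/ltnW.
    by apply: lt_le_trans st _; apply: (mono _ n.+1).
  rewrite /bend lamle//; last exact: ltW.
  by apply: lam_i => //; rewrite ts st.
Qed.

End JumpTimes.

Section Cells.
Context {R : realType} {T : Type}.
Implicit Types (f Y : skorokhod R T) (x : nat -> T) (h : nat -> R).

Definition follows (f : R -> T) x h : Prop :=
  forall n t, jump_time h n <= t < jump_time h n.+1 -> f t = x n.

(** Paths whose first n sojourns are in the states [(c i).1] and last about
    [(c i).2] times dt. The tolerance of one dt on each side of the interval
    of [bin] leaves room for the fluctuations of a sojourn made of many short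
    steps. *)
Definition cell n (c : 'I_n -> T * nat) (dt : R) : set (skorokhod R T) :=
  [set f | exists2 J : nat -> R, J 0%N = 0 & forall i : 'I_n, [/\ J i < J i.+1,
     ((c i).2%:R - 1) * dt <= J i.+1 - J i <= ((c i).2%:R + 2) * dt &
     forall t, J i <= t < J i.+1 -> f t = (c i).1]].

(** The intervals are open on the left because the law of a jump process is
    given through the events s < h. *)
Definition bin (dt s : R) : nat := (`|Num.ceil (s / dt)|%N).-1.

Lemma binP dt s m : 0 < dt -> 0 < s ->
  bin dt s = m <-> m%:R * dt < s <= m.+1%:R * dt.
Proof.
move=> dt0 s0; have sdt : 0 < s / dt by rewrite divr_gt0.
have c0 : (0 < Num.ceil (s / dt))%R by rewrite ceil_gt0.
rewrite -ltr_pdivlMr// -ler_pdivrMr// /bin.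
have cE : Num.ceil (s / dt) = `|Num.ceil (s / dt)|%N%:Z by rewrite gez0_abs// ltW.
have n0 : (0 < `|Num.ceil (s / dt)|)%N by rewrite absz_gt0 gt_eqF.
have := ceil_itv (s / dt); rewrite cE; move: n0.
set n := `|_|%N => n0 /andP[]; rewrite intrD/= -!pmulrn => n1 n2.
have nE : n = n.-1.+1 by rewrite prednK.
split=> [<-|/andP[m1 m2]].
  by rewrite -nE n2 andbT -(ltrD2r (-1)); move: n1; rewrite nE -natr1 ; lra.
have : (m < n)%N by rewrite -(ltr_nat R); exact: lt_le_trans m1 n2.
have : (n.-1 < m.+1)%N.
  by rewrite -(ltr_nat R); apply: lt_le_trans m2; move: n1; rewrite nE -natr1; lra.
by rewrite nE !ltnS => a b; apply/eqP; rewrite eqn_leq a.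
Qed.

Lemma cell_self Y x h n dt : 0 < dt -> (forall i, 0 < h i) -> follows Y x h ->
  cell (fun i : 'I_n => (x i, bin dt (h i))) dt Y.
Proof.
move=> dt0 h0 Yxh; exists (jump_time h); first exact: jump_time0.
move=> i; rewrite jump_timeS/= addrAC subrr add0r.
have /(binP _ dt0 (h0 i))/andP[b1 b2] := erefl (bin dt (h i)).
split; first by rewrite ltrDl.
  by move: b2; rewrite -natr1 => b2; apply/andP; split; nra.
by move=> t; rewrite -jump_timeS; exact: Yxh.
Qed.

(** Each sojourn contributes an error of at most 2 dt to the jump times. *)
Lemma cell_ball Y f x h n dt N e : 0 < dt -> (forall i, 0 < h i) -> follows Y x h ->
  cell (fun i : 'I_n => (x i, bin dt (h i))) dt f ->
  N < jump_time h n -> n%:R * (2 * dt) <= e -> skorokhod_ball N e (Y, f).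
Proof.
move=> dt0 h0 Yxh [J J0 JP] Nn ne.
have close i : (i <= n)%N -> `|J i - jump_time h i| <= i%:R * (2 * dt).
  elim: i => [_|i ih ni]; first by rewrite J0 jump_time0 subrr normr0 mul0r.
  have [_ + _] := JP (Ordinal ni); rewrite /= jump_timeS => /andP[j1 j2].
  have /(binP _ dt0 (h0 i)) := erefl (bin dt (h i)).
  move: j1 j2; set k := bin _ _ => j1 j2 /andP[]; rewrite -natr1 => b1 b2.
  have := ih (ltnW ni); rewrite !ler_norml -natr1 => /andP[c1 c2].
  by apply/andP; split; nra.
have [|||lam [lamT lam_e _ lam_i]] :=
    @time_change_knots _ (jump_time h) J e n (jump_time0 h) J0.
- by move=> i _; rewrite jump_timeS ltrDl.
- by move=> i ni; have [] := JP (Ordinal ni).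
- move=> i ni; apply: le_trans (close _ ni) _; apply: le_trans ne.
  by rewrite ler_wpM2r ?mulr_ge0 ?(ltW dt0)// ler_nat.
exists lam; split => //= t /andP[t0 tN].
have tn : t < jump_time h n by exact: le_lt_trans tN Nn.
have [i ni it] : exists2 i, (i < n)%N & jump_time h i <= t < jump_time h i.+1.
  have hn : exists m, t < jump_time h m by exists n.
  have [m tm mP] := find_ex_minn hn.
  case: m tm mP => [|m] tm mP; first by move: tm; rewrite jump_time0 ltNge t0.
  exists m; first exact: mP.
  by rewrite tm andbT leNgt; apply/negP => /mP; rewrite ltnn.
have [_ _ fE] := JP (Ordinal ni); rewrite fE; first exact: Yxh.
exact: lam_i.
Qed.

(** Chosen so that n times the mesh, the error after n sojourns, tends to 0. *)
Definition mesh n : R := (n.+1%:R ^+ 2)^-1.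

Lemma mesh_gt0 n : 0 < mesh n.
Proof. by rewrite invr_gt0 exprn_gt0// ltr0n. Qed.

Lemma cell_nbhs Y x h (U : set (skorokhod R T)) : (forall i, 0 < h i) ->
  divergent h -> follows Y x h -> nbhs Y U ->
  \forall n \near \oo, cell (fun i : 'I_n => (x i, bin (mesh n) (h i))) (mesh n) `<=` U.
Proof.
move=> h0 hoo Yxh; rewrite -nbhs_entourageE => -[E [N [e [e0 NE]]] EU].
have [m Nm] := hoo N.
near=> n.
move=> f fc; apply: EU; rewrite /xsection/= inE; apply: NE.
apply: (cell_ball (mesh_gt0 n) h0 Yxh fc).
  by apply: lt_le_trans Nm _; apply: jump_time_le => //; near: n; exact: nbhs_infty_ge.
have n0 : (0 : R) < n.+1%:R by rewrite ltr0n.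
have : 2 / e <= n%:R by near: n; exact: nbhs_infty_ger.
rewrite ler_pdivrMr// => ne; rewrite /mesh -natr1 in n0 *.
rewrite mulrA ler_pdivrMr ?exprn_gt0//.
have : (0 : R) <= n%:R by rewrite ler0n.
by move: ne n0; set k := n%:R => ne n0 k0; nra.
Unshelve. all: by end_near. Qed.

End Cells.

(** * Trace paths *)

Section FollowedPaths.
Context {R : realType} {T : Type}.
Implicit Types (f : R -> T) (x : nat -> T) (h : nat -> R).

Lemma skorokhod_follows x h : (forall i, 0 < h i) -> divergent h ->
  exists y : skorokhod R T, follows y x h.
Proof.
move=> h0 hoo.
have /choice[N NP] : forall t : R, exists n, 0 <= t ->
    jump_time h n <= t < jump_time h n.+1.
  move=> t; have [t0|t0] := leP 0 t; last by exists 0%N.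
  by have [n nP] := jump_time_itv h0 hoo t0; exists n.
pose y t := if t < 0 then x 0%N else x (N t).
have yE n t : jump_time h n <= t < jump_time h n.+1 -> y t = x n.
  move=> nt; have t0 : 0 <= t.
    by apply: le_trans (andP nt).1; exact: jump_time_ge0.
  by rewrite /y ltNge t0/=; congr x; exact: (jump_time_itv_inj h0 (NP _ t0) nt).
suff yc : cadlag y by exists (Skorokhod yc).
have y0 : y 0 = x 0%N by apply: yE; rewrite jump_timeS jump_time0 lexx add0r h0.
split=> [t t0|t t0|t t0].
- by rewrite y0 /y t0.
- have [n /andP[n1 n2]] := jump_time_itv h0 hoo t0.
  rewrite (yE n t) ?n1//.
  have := nbhs_right_lt n2; apply: filterS2 (nbhs_right_gt t) => s ts sn.
  by apply: yE; rewrite sn (le_trans n1)// ltW.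
- have [n n1 n2] : exists2 n, jump_time h n < t & t <= jump_time h n.+1.
    have [n /andP[n1 n2]] := jump_time_itv h0 hoo (ltW t0).
    move: n1; rewrite le_eqVlt => /predU1P[tE|n1]; last by exists n => //; exact: ltW.
    case: n n2 tE => [|n] n2 tE; first by move: t0; rewrite -tE jump_time0 ltxx.
    by exists n; rewrite -tE// jump_timeS ltrDl.
  exists (x n); have := nbhs_left_lt t.
  apply: filterS2 (nbhs_left_gt n1) => s ns st.
  by apply: yE; rewrite ltW//= (lt_le_trans st).
Qed.

Lemma jump_time_scale h c n : jump_time (fun i => h i / c) n = jump_time h n / c.
Proof. by rewrite /jump_time mulr_suml. Qed.

Lemma follows_scale f x h c : 0 < c -> follows f x h ->
  follows (fun t => f (c * t)) x (fun i => h i / c).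
Proof.
move=> c0 fx n t; rewrite !jump_time_scale ler_pdivrMr// ltr_pdivlMr// mulrC.
exact: fx.
Qed.

Lemma divergent_scale h c : 0 < c -> divergent h -> divergent (fun i => h i / c).
Proof.
move=> c0 hoo s; have [n sn] := hoo (s * c); exists n.
by rewrite jump_time_scale ltr_pdivlMr.
Qed.

End FollowedPaths.

Section OccupationTime.
Context {R : realType} {T : Type}.
Variables (A : set T) (f : R -> T) (x : nat -> T) (h : nat -> R).
Hypotheses (h_gt0 : forall i, 0 < h i) (h_div : divergent h) (fx : follows f x h).

Let mu := @lebesgue_measure R.

(* The times spent in A, as a countable union of intervals. *)
Let E : set R := \bigcup_n (if `[< A (x n) >] then
  `[jump_time h n, jump_time h n.+1[%classic else set0).

Let mE : measurable E.
Proof. by apply: bigcupT_measurable => n; case: ifP => _; [exact: measurable_itv|exact: measurable0]. Qed.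

Let EP t : 0 <= t -> E t <-> A (f t).
Proof.
move=> t0; have [n tn] := jump_time_itv h_gt0 h_div t0.
split=> [[m _]|Aft].
  case: asboolP => // Am; rewrite /= in_itv/= => tm.
  by rewrite (fx tm).
exists n => //; rewrite asboolT; first by rewrite /= in_itv/= tn.
by rewrite -(fx tn).
Qed.

Let occ t : \bar R := mu (E `&` `[0, t[).

Let occ_le s t : s <= t -> (occ s <= occ t)%E.
Proof.
move=> st; apply: le_measure; rewrite ?inE.
- exact: measurableI.
- exact: measurableI.
- by move=> u [Eu /=]; rewrite !in_itv/= => /andP[u0 us]; split=> //;
    rewrite u0 (lt_le_trans us).
Qed.

Let occE t : 0 <= t -> occupation_time A f t = occ t.
Proof.
move=> t0; rewrite /occupation_time.
transitivity (\int[mu]_(u in `[0%R, t]) (\1_E u)%:E)%E.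
  apply: eq_integral => u; rewrite inE/= in_itv/= => /andP[u0 _].
  congr EFin; rewrite !indicE; congr (_%:R); congr nat_of_bool.
  by apply/idP/idP; rewrite !inE => /(EP u0).
rewrite integral_indic//.
have -> : E `&` `[0, t]%classic = (E `&` `[0, t[) `|` (E `&` [set t]).
  apply/seteqP; split=> u.
    move=> [Eu] /=; rewrite in_itv/= => /andP[u0].
    rewrite le_eqVlt => /predU1P[ut|ut]; first by right.
    by left; split=> //=; rewrite in_itv/= u0.
  move=> [[Eu]|[Eu ut]]/=; rewrite !in_itv/=; last by split=> //; rewrite ut t0 lexx.
  by move=> /andP[u0 ut]; rewrite u0 ltW.
rewrite /mu measureU//=.
- rewrite [X in (_ + X)%E](_ : _ = 0%E) ?adde0//.
  apply/eqP; rewrite eq_le measure_ge0 andbT -(lebesgue_measure_set1 t).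
  by apply: le_measure; rewrite ?inE//; exact: measurableI.
- exact: measurableI.
- exact: measurableI.
- by apply/seteqP; split=> u //= -[[_ +] [_ ut]]; rewrite in_itv/= ut ltxx andbF.
Qed.

Let occ_time n : R := \sum_(i < n) (`[< A (x i) >])%:R * h i.

Let occ_jump n u : 0 <= u <= h n ->
  (occ (jump_time h n + u) = occ (jump_time h n) + ((`[< A (x n) >])%:R * u)%:E)%E.
Proof.
move=> /andP[u0 un]; rewrite /occ.
have Jn0 : 0 <= jump_time h n by exact: jump_time_ge0.
have -> : E `&` `[0, jump_time h n + u[ = (E `&` `[0, jump_time h n[) `|`
    (if `[< A (x n) >] then `[jump_time h n, jump_time h n + u[%classic else set0).
  apply/seteqP; split=> s /=.
    move=> [Es]; rewrite in_itv/= => /andP[s0 su].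
    have [sn|ns] := ltP s (jump_time h n); first by left; split=> //=; rewrite in_itv/= s0.
    right; have sn : jump_time h n <= s < jump_time h n.+1.
      by rewrite ns/= jump_timeS (lt_le_trans su)// lerD2l.
    move/(EP s0): Es; rewrite (fx sn) => Axn.
    by rewrite asboolT//= in_itv/= ns.
  move=> [[Es]|].
    by rewrite !in_itv/= => /andP[-> sn]; split=> //=; rewrite (lt_le_trans sn)// lerDl.
  case: asboolP => //= Axn; rewrite !in_itv/= => /andP[ns su].
  have s0 : 0 <= s by exact: le_trans ns.
  rewrite s0 su; split=> //; apply/(EP s0); rewrite (@fx n s)// ns/=.
  by rewrite jump_timeS (lt_le_trans su)// lerD2l.
rewrite /mu measureU//=; last 3 first.
- exact: measurableI.
- by case: ifP => // _.
- case: ifP => _; last by rewrite setI0.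
  apply/seteqP; split=> s //= -[[_]]; rewrite !in_itv/= => /andP[_ sn] /andP[ns _].
  by have := le_lt_trans ns sn; rewrite ltxx.
congr (_ + _)%E; case: ifP => _; last by rewrite measure0 mul0r.
rewrite lebesgue_measure_itv/= lte_fin ltrDl mul1r.
move: u0; rewrite le_eqVlt => /predU1P[<-|u0]; first by rewrite ltxx.
by rewrite u0 -EFinD addrAC subrr add0r.
Qed.

Let occ_jump_time n : occ (jump_time h n) = (occ_time n)%:E.
Proof.
elim: n => [|n ih].
  by rewrite jump_time0 /occ /mu set_itv_ge ?bnd_simp ?ltxx// setI0 measure0 /occ_time big_ord0.
rewrite jump_timeS occ_jump; last by rewrite lexx ltW.
by rewrite ih -EFinD /occ_time big_ord_recr.
Qed.

(** While the path is in a state of A the occupation time grows at unit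
    speed, so its inverse is a translation there. *)
Lemma trace_jump n t : A (x n) -> occ_time n <= t < occ_time n + h n ->
  trace A f t = x n.
Proof.
move=> Axn /andP[t1 t2]; rewrite /trace.
have Jn0 : 0 <= jump_time h n by exact: jump_time_ge0.
pose s := jump_time h n + (t - occ_time n).
have s0 : 0 <= s by rewrite addr_ge0// subr_ge0.
have occ_in u : 0 <= u <= h n ->
    occupation_time A f (jump_time h n + u) = (occ_time n + u)%:E.
  move=> /andP[u0 un]; rewrite occE ?addr_ge0// occ_jump ?u0//.
  by rewrite occ_jump_time asboolT// mul1r.
have Ss : 0 <= s /\ (occupation_time A f s <= t%:E)%E.
  by split=> //; rewrite occ_in ?lee_fin; lra.
have ubs : ubound [set s | 0 <= s /\ (occupation_time A f s <= t%:E)%E] s.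
  move=> v [v0 vt]; rewrite leNgt; apply/negP => sv.
  pose w := Num.min v (jump_time h n.+1).
  have sw : s < w by rewrite lt_min sv/= jump_timeS /s ltrD2l ltrBlDl.
  have w1 : w <= jump_time h n.+1 by rewrite ge_min lexx orbT.
  have w2 : w <= v by rewrite ge_min lexx.
  have w0 : 0 <= w by exact: le_trans s0 (ltW sw).
  have : (occupation_time A f w <= t%:E)%E.
    by apply: le_trans vt; rewrite !occE//; exact: occ_le.
  have -> : w = jump_time h n + (w - jump_time h n) by rewrite addrC subrK.
  rewrite occ_in; last by move: w1 sw; rewrite jump_timeS /s; lra.
  by rewrite lee_fin; move: sw; rewrite /s; lra.
have -> : inv_occupation_time A f t = s.
  apply/eqP; rewrite eq_le; apply/andP; split.
    by apply: ge_sup => //; exists s.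
  by apply: ub_le_sup => //; exists s.
by apply: fx; rewrite jump_timeS /s; lra.
Qed.

Lemma trace_follows (nu : nat -> nat) : nu 0%N = 0%N ->
    (forall k, (nu k < nu k.+1)%N) -> (forall k, A (x (nu k))) ->
    (forall k j, (nu k < j < nu k.+1)%N -> ~ A (x j)) ->
  follows (trace A f) (x \o nu) (h \o nu).
Proof.
move=> nu0 nuS nuA nuNA k t; rewrite jump_timeS.
have -> : jump_time (h \o nu) k = occ_time (nu k).
  elim: k => [|k ih]; first by rewrite nu0 jump_time0 /occ_time big_ord0.
  rewrite jump_timeS ih -(subnKC (nuS k)).
  have : (nu k.+1 - (nu k).+1 + (nu k).+1 <= nu k.+1)%N by rewrite subnK.
  elim: (nu k.+1 - (nu k).+1)%N => [_|j IH jn].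
    by rewrite addn0 /occ_time big_ord_recr/= asboolT// mul1r.
  rewrite IH; last by apply: leq_trans jn; rewrite addSn leqnSn.
  rewrite addnS /occ_time [RHS]big_ord_recr/= asboolF ?mul0r ?addr0//.
  apply: (nuNA k); rewrite ltn_addr//= addSn.
  by apply: leq_trans jn; rewrite addSn addnS addnC.
by apply: trace_jump; exact: nuA.
Qed.

End OccupationTime.

(** A path following z with these times exists, so the trace process is given
    by its defining property and not by the default value. *)
Lemma trace_process_follows (R : realType) (K L q : nat) (D : dynamics) (beta : R)
    (a : ground K L q) (f : R -> config K L q) (x : nat -> config K L q)
    (h : nat -> R) (nu : nat -> nat) (z : nat -> ground K L q) :
    (forall i, 0 < h i) -> divergent h -> follows f x h -> nu 0%N = 0%N ->
    (forall k, (nu k < nu k.+1)%N) -> (forall k, val (z k) = x (nu k)) ->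
    (forall k j, (nu k < j < nu k.+1)%N -> ~~ is_ground (x j)) ->
    divergent (h \o nu) ->
  follows (trace_process D beta a f) z
          (fun k => h (nu k) / expR ((Gamma K D)%:R * beta)).
Proof.
move=> h0 hoo fx nu0 nuS zE nuNA goo.
set c := expR _; have c0 : 0 < c by exact: expR_gt0.
pose h' i := h i / c; have h'0 i : 0 < h' i by rewrite divr_gt0.
have h'oo : divergent h' by exact: divergent_scale.
have fx' : follows (accelerated D beta f) x h' by exact: follows_scale.
have nuA k : is_ground (x (nu k)) by rewrite -zE; exact: valP.
have tr := @trace_follows _ _ [set s | is_ground s] _ _ _ h'0 h'oo fx' nu nu0 nuS nuA
  (fun k j kj => negP (nuNA k j kj)).
have g0 k : 0 < (h' \o nu) k by exact: h'0.
have g'oo : divergent (h' \o nu) by exact: (divergent_scale c0 goo).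
have [y yP] := skorokhod_follows z g0 g'oo.
have : [set y : skorokhod R (ground K L q) | forall t, 0 <= t ->
    val (y t) = trace [set s | is_ground s] (accelerated D beta f) t]
    (trace_process D beta a f).
  apply: (@xgetPex _ (cst_path R a)); exists y => t t0.
  have [n tn] := jump_time_itv g0 g'oo t0.
  by rewrite (yP n t tn) (tr n t tn) zE.
move=> trP n t tn; apply: val_inj; rewrite trP; first by rewrite (tr n t tn) zE.
by apply: le_trans (andP tn).1; exact: jump_time_ge0.
Qed.

(** * Integrals of arbitrary nonnegative functions, layer cakes *)

Section IntegralExtras.
Import HBNNSimple.
Context {R : realType} {d : measure_display} {Om : measurableType d}.
Variable P : {measure set Om -> \bar R}.
Local Open Scope ereal_scope.

(** The integral of a nonnegative function is the supremum of the integrals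
    of the simple functions below it, so it is monotone on arbitrary
    functions. This matters because a functional of a random path is only
    almost everywhere equal to a measurable function. *)
Lemma ge0_le_integral_any (D : set Om) (f g : Om -> \bar R) :
  (forall w, D w -> 0 <= f w) -> (forall w, D w -> f w <= g w) ->
  \int[P]_(w in D) f w <= \int[P]_(w in D) g w.
Proof.
move=> f0 fg.
have g0 w : D w -> 0 <= g w by move=> Dw; exact: le_trans (f0 _ Dw) (fg _ Dw).
rewrite (ge0_integralE _ f0) (ge0_integralE _ g0); apply: ge_ereal_sup => _ [h /= hf <-].
apply: ereal_sup_ubound; exists h => //= w; apply: le_trans (hf w) _.
by rewrite !patchE; case: ifPn => //; rewrite inE; exact: fg.
Qed.

(** A simple function below f may be set to 0 on the null set without
    changing its integral, and is then below g. *)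
Lemma ge0_integral_eq_off_null (N : set Om) (f g : Om -> \bar R) :
  measurable N -> P N = 0 -> (forall w, 0 <= f w) -> (forall w, 0 <= g w) ->
  (forall w, ~ N w -> f w = g w) -> \int[P]_w f w = \int[P]_w g w.
Proof.
move=> mN PN.
suff le f' g' : (forall w, 0 <= f' w) -> (forall w, 0 <= g' w) ->
    (forall w, ~ N w -> f' w = g' w) -> \int[P]_w f' w <= \int[P]_w g' w.
  move=> f0 g0 fg; apply/eqP; rewrite eq_le le//= le// => w /fg //.
move=> f0 g0 fg; rewrite [leLHS]ge0_integralTE//.
apply: ge_ereal_sup => _ [h /= hf <-]; rewrite -integralT_nnsfun.
have mh : measurable_fun setT (fun w => (h w)%:E) by exact/measurable_EFinP.
rewrite (@ge0_negligible_integral _ _ _ P setT N)//=; last first.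
  by move=> w _; rewrite lee_fin.
rewrite integral_mkcond; apply: ge0_le_integral_any => w _.
  by apply: erestrict_ge0 => v _; rewrite lee_fin.
rewrite patchE; case: ifPn => // ; rewrite inE => -[_ Nw].
by rewrite -fg.
Qed.

Lemma integral_eq_off_null (N : set Om) (f g : Om -> \bar R) :
  measurable N -> P N = 0 -> (forall w, ~ N w -> f w = g w) ->
  \int[P]_w f w = \int[P]_w g w.
Proof.
move=> mN PN fg; rewrite [LHS]integralE [RHS]integralE.
by congr (_ - _); apply: (ge0_integral_eq_off_null mN PN) => // w Nw;
  rewrite ?funeposE ?funenegE fg.
Qed.

Lemma integral_expR (c l : R) : (0 < l)%R ->
  \int[lebesgue_measure]_(t in `[0%R, +oo[) (c * expR (- (l * t)))%:E = (c / l)%:E.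
Proof.
move=> l0.
transitivity (\int[lebesgue_measure]_(t in `[0%R, +oo[)
    ((c / l)%:E * (exponential_pdf l t)%:E)).
  apply: eq_integral => t; rewrite inE/= in_itv/= andbT => t0.
  rewrite exponential_pdfE// -EFinM; congr EFin.
  by rewrite mulNr mulrA divfK// gt_eqF.
have intl := integrable_exponential_pdf l0.
rewrite integralZl//; last exact: integrableS intl.
rewrite -[RHS]mule1; congr (_ * _); rewrite -(integral_exponential_pdf l0).
rewrite integral_mkcond/=; apply: eq_integral => t _; rewrite patchE.
case: ifPn => //; rewrite notin_setE/= in_itv/= andbT => /negP; rewrite -ltNge => t0.
by rewrite lt0_exponential_pdf.
Qed.

End IntegralExtras.

Section LayerCake.
Context {R : realType} {d : measure_display} {Om : measurableType d}.
Variable P : probability Om R.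
Local Open Scope ereal_scope.
Implicit Types (D : set Om) (f g h : Om -> R).

Lemma measurable_gt h t : measurable_fun setT h -> measurable [set w | (t < h w)%R].
Proof.
move=> mh; have := mh measurableT _ (measurable_itv `]t, +oo[); rewrite setTI.
by congr measurable; apply/seteqP; split=> w /=; rewrite in_itv/= andbT.
Qed.

(** Tonelli's theorem on the region under the graph of h. *)
Lemma layer_cake D f h : measurable D ->
    measurable_fun setT f -> (forall w, 0 <= f w)%R ->
    measurable_fun setT h -> (forall w, 0 <= h w)%R ->
  \int[P]_(w in D) (f w * h w)%:E =
  \int[lebesgue_measure]_(t in `[0%R, +oo[)
    \int[P]_(w in D `&` [set w | (t < h w)%R]) (f w)%:E.
Proof.
move=> mD mf f0 mh h0.
pose k (p : Om * measurableTypeR R) : \bar R :=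
  (\1_D p.1 * f p.1 * \1_[set p : Om * R | 0 <= p.2 < h p.1]%R p)%:E.
have k0 p : 0 <= k p by rewrite lee_fin !mulr_ge0.
have mS : measurable ([set p : Om * measurableTypeR R | 0 <= p.2 < h p.1]%R).
  pose S1 (p : Om * measurableTypeR R) := (0 <= p.2)%R.
  pose S2 (p : Om * measurableTypeR R) := (p.2 < h p.1)%R.
  rewrite [X in measurable X](_ : _ = S1 @^-1` [set true] `&` S2 @^-1` [set true]).
    apply: measurableI.
      have : measurable_fun setT S1 by exact: measurable_fun_ler.
      by move=> /(_ measurableT [set true]); rewrite setTI; exact.
    have : measurable_fun setT S2.
      by apply: measurable_fun_ltr => //; exact: (measurableT_comp mh).
    by move=> /(_ measurableT [set true]); rewrite setTI; exact.
  by apply/seteqP; split => p /= /andP.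
have mk : measurable_fun setT k.
  apply/measurable_EFinP; apply: measurable_funM; last exact: measurable_indic.
  apply: measurable_funM; last exact: (measurableT_comp mf).
  by apply: (measurableT_comp (measurable_indic mD)).
transitivity (\int[P]_w \int[lebesgue_measure]_t k (w, t)).
  rewrite integral_mkcond/=; apply: eq_integral => w _; rewrite patchE.
  rewrite /k/=; case: ifPn => wD; last first.
    rewrite integral0_eq// => t _; rewrite indicE (negPf wD) mul0r mul0r.
    by [].
  rewrite indicE wD mul1r.
  have kE t : \1_[set p : Om * R | 0 <= p.2 < h p.1]%R (w, t) =
      \1_(`[0%R, h w[%classic : set R) t :> R.
    by rewrite !indicE; congr (_%:R); congr nat_of_bool; apply/idP/idP;
      rewrite !inE/= in_itv.
  under eq_integral do rewrite kE EFinM.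
  rewrite ge0_integralZl//; last 2 first.
  - by apply/measurable_EFinP; apply: measurable_indic; exact: measurable_itv.
  - by rewrite lee_fin.
  rewrite EFinM; congr (_ * _).
  rewrite integral_indic//= setIT lebesgue_measure_itv/= lte_fin.
  by have := h0 w; rewrite le_eqVlt => /predU1P[<-|->]; rewrite ?ltxx ?sube0.
rewrite fubini_tonelli//= [RHS]integral_mkcond; apply: eq_integral => t _.
rewrite patchE; case: ifPn => [|]; last first.
  rewrite notin_setE/= in_itv/= andbT => /negP t0; apply: integral0_eq => w _.
  rewrite /k [X in (_ * X)%R]indicE memNset; first by rewrite mulr0.
  by move=> /= /andP[t1 _]; rewrite t1 in t0.
rewrite inE/= in_itv/= andbT => t0; rewrite [RHS]integral_mkcond/=.
apply: eq_integral => w _; rewrite /k/= !indicE patchE in_setI.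
case: (w \in D); last by rewrite !mul0r.
rewrite mul1r; case: (ltP t (h w)) => th.
  by rewrite !mem_set ?mulr1//= t0.
by rewrite !memNset ?mulr0//= ?t0/= ltNge th.
Qed.

Lemma layer_cake1 D h (c l : R) : measurable D -> (0 < l)%R ->
    measurable_fun setT h -> (forall w, 0 <= h w)%R ->
    (forall t, 0 <= t -> P (D `&` [set w | t < h w]) = (c * expR (- (l * t)))%:E)%R ->
  \int[P]_(w in D) (h w)%:E = (c / l)%:E.
Proof.
move=> mD l0 mh h0 tail.
have := @layer_cake D (cst 1%R) h mD (measurable_cst _) (fun=> ler01) mh h0.
under eq_integral do rewrite /= mul1r; move=> ->.
rewrite -integral_expR//; apply: eq_integral => t; rewrite inE/= in_itv/= andbT => t0.
rewrite -tail// integral_cst ?mul1e//; apply: measurableI => //; exact: measurable_gt.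
Qed.

Lemma layer_cake2 D g h (c l1 l2 : R) : measurable D ->
    (0 < l1)%R -> (0 < l2)%R ->
    measurable_fun setT g -> (forall w, 0 <= g w)%R ->
    measurable_fun setT h -> (forall w, 0 <= h w)%R ->
    (forall s t, (0 <= s)%R -> (0 <= t)%R ->
      P (D `&` [set w | (s < g w)%R /\ (t < h w)%R])
        <= (c * expR (- (l1 * s)) * expR (- (l2 * t)))%:E) ->
  \int[P]_(w in D) (g w * h w)%:E <= (c / l1 / l2)%:E.
Proof.
move=> mD l10 l20 mg g0 mh h0 tail; rewrite layer_cake//.
rewrite -integral_expR//.
apply: ge0_le_integral_any => t; rewrite /= in_itv/= andbT => t0.
  by apply: integral_ge0 => w _; rewrite lee_fin.
have mDt : measurable (D `&` [set w | (t < h w)%R]).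
  by apply: measurableI => //; exact: measurable_gt.
have := @layer_cake _ (cst 1%R) g mDt (measurable_cst _) (fun=> ler01) mg g0.
under eq_integral do rewrite /= mul1r; move=> ->.
rewrite mulrAC -integral_expR//; apply: ge0_le_integral_any => s;
  rewrite /= in_itv/= andbT => s0; first by apply: integral_ge0.
rewrite integral_cst ?mul1e; last first.
  by apply: measurableI => //; exact: measurable_gt.
rewrite mulrAC; apply: le_trans (tail _ _ s0 t0).
rewrite (_ : D `&` [set w | (t < h w)%R] `&` [set w | (s < g w)%R] =
  D `&` [set w | (s < g w)%R /\ (t < h w)%R])//.
by apply/seteqP; split=> w /= => [[[]]|[? []]].
Qed.

End LayerCake.

(** * Jump processes *)

Section MeasureExtras.
Context {R : realType} {d : measure_display} {Om : measurableType d}.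
Variable P : probability Om R.

Lemma measure_seq_partition (T : eqType) (X : Om -> T) (E : set Om) (s : seq T) :
  measurable E -> (forall y, measurable [set w | X w = y]) -> uniq s ->
  (P (E `&` [set w | X w \in s]) = \sum_(y <- s) P (E `&` [set w | X w = y]))%E.
Proof.
move=> mE mX; have mEs (r : seq T) : measurable (E `&` [set w | X w \in r]).
  apply: measurableI => //; elim: r => [|y r ih].
    by rewrite (_ : [set w | _] = set0)//; apply/seteqP; split.
  rewrite (_ : [set w | _] = [set w | X w = y] `|` [set w | X w \in r]).
    exact: measurableU.
  by apply/seteqP; split=> w /=; rewrite inE => /predU1P.
elim: s => [_|y s ih /= /andP[ys us]].
  rewrite big_nil (_ : E `&` _ = set0) ?measure0//.
  by apply/seteqP; split=> w // [].
rewrite big_cons -ih// -measureU//.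
- congr (P _); apply/seteqP; split=> w /=; rewrite inE.
    by move=> [Ew /predU1P[|]]; [left|right].
  by move=> [[Ew /eqP ->//]|[Ew ->]]; rewrite ?orbT.
- exact: measurableI.
- apply/seteqP; split=> w //= -[[_ Xw] [_]].
  by rewrite Xw (negPf ys).
Qed.

Lemma measure_fin_partition (T : finType) (X : Om -> T) (E : set Om) :
  measurable E -> (forall y, measurable [set w | X w = y]) ->
  (P E = \sum_(y : T) P (E `&` [set w | X w = y]))%E.
Proof.
move=> mE mX; rewrite -[RHS]big_enum -measure_seq_partition ?enum_uniq//.
by congr (P _); apply/seteqP; split=> w /= => [Ew|[]//]; rewrite mem_enum.
Qed.

Lemma measurable_pred (T : finType) (X : Om -> T) (Q : pred T) :
  (forall y, measurable [set w | X w = y]) -> measurable [set w | Q (X w)].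
Proof.
move=> mX; rewrite (_ : [set w | _] = \bigcup_(y in [set y | Q y]) [set w | X w = y]).
  by apply: fin_bigcup_measurable => //; exact: finite_finset.
by apply/seteqP; split=> w /=; [move=> Qw; exists (X w)|move=> [y Qy ->]].
Qed.

Lemma measure_bigsetU_le n (A : nat -> set Om) : (forall i, measurable (A i)) ->
  (P (\big[setU/set0]_(i < n) A i) <= \sum_(i < n) P (A i))%E.
Proof.
move=> mA; elim: n => [|n ih]; first by rewrite !big_ord0 measure0.
rewrite !big_ord_recr/=; apply: le_trans (measureU2 _ _ (mA n)) _.
  exact: bigsetU_measurable.
exact: leeD2r.
Qed.

Lemma null_setU (A B : set Om) : measurable A -> measurable B ->
  P A = 0%E -> P B = 0%E -> P (A `|` B) = 0%E.
Proof. by move=> mA mB PA PB; rewrite measureU0. Qed.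

Lemma measure_eq_off_null (N A B : set Om) : measurable N -> P N = 0%E ->
  measurable A -> measurable B -> (forall w, ~ N w -> A w <-> B w) -> P A = P B.
Proof.
move=> mN PN.
suff le A' B' : measurable A' -> measurable B' -> (forall w, ~ N w -> A' w -> B' w) ->
    (P A' <= P B')%E.
  move=> mA mB AB; apply/eqP; rewrite eq_le; apply/andP; split; apply: le => // w /AB[];
  by [].
move=> mA mB AB; apply: (@le_trans _ _ (P (B' `|` N))).
  apply: le_measure; rewrite ?inE//; first exact: measurableU.
  by move=> w Aw; have [Nw|/AB] := pselect (N w); [right|left; auto].
by rewrite measureU0.
Qed.

Lemma null_bigcup (A : nat -> set Om) : (forall n, measurable (A n)) ->
  (forall n, P (A n) = 0%E) -> P (\bigcup_n A n) = 0%E.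
Proof.
move=> mA PA; apply/eqP; rewrite eq_le measure_ge0 andbT.
apply: le_trans (measure_sigma_subadditive P mA _ (fun=> id)) _.
  exact: bigcupT_measurable.
by rewrite eseries0// => i _ _; exact: PA.
Qed.

Lemma measurable_forall_le (F : nat -> set Om) n :
  (forall i, measurable (F i)) ->
  measurable [set w | forall i, (i <= n)%N -> F i w].
Proof.
move=> mF.
exact: (@bigcap_measurableType _ _ F [set i | (i <= n)%N] (fun i _ => mF i)).
Qed.

End MeasureExtras.

Definition extend (X : Type) n (x : nat -> X) (y : X) i := if (i <= n)%N then x i else y.

Section JumpProcess.
Context {R : realType} {T : finType} {d : measure_display} {Om : measurableType d}.
Variable P : probability Om R.

(** A jump chain and its holding times, without a path. The kernel pm may
    charge the diagonal, as it does for the successive visits to a set of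
    states, which include returns to the state just left. *)
Record jump_process (pm : T -> T -> R) (lam : T -> R) (x0 : T)
    (xi : nat -> Om -> T) (h : nat -> Om -> R) : Prop := JumpProcess {
  jump_process_chain : forall n x, measurable [set w | xi n w = x];
  jump_process_time : forall n, measurable_fun [set: Om] (h n);
  jump_process_gt0 : forall n w, 0 < h n w;
  jump_process_law : forall n (x : nat -> T) (s : nat -> R), (forall i, 0 <= s i) ->
    P [set w | forall i, (i <= n)%N -> xi i w = x i /\ s i < h i w] =
    ((x 0%N == x0)%:R * \prod_(i < n) pm (x i) (x i.+1) *
     \prod_(i < n.+1) expR (- (lam (x i) * s i)))%:E }.

Variables (pm : T -> T -> R) (lam : T -> R) (x0 : T).
Variables (xi : nat -> Om -> T) (h : nat -> Om -> R).
Hypothesis JP : jump_process pm lam x0 xi h.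
Hypothesis lam_gt0 : forall x, 0 < lam x.
Implicit Types (x : nat -> T) (s : nat -> R) (n : nat).

Definition cylinder n x s : set Om :=
  [set w | forall i, (i <= n)%N -> xi i w = x i /\ s i < h i w].

Definition word n x : set Om := [set w | forall i, (i <= n)%N -> xi i w = x i].

Definition word_proba n x : R := (x 0%N == x0)%:R * \prod_(i < n) pm (x i) (x i.+1).

Lemma measurable_cylinder n x s : measurable (cylinder n x s).
Proof.
apply: (@measurable_forall_le _ _ (fun i => [set w | xi i w = x i] `&` [set w | s i < h i w])).
move=> i; apply: measurableI; first exact: (jump_process_chain JP).
exact/measurable_gt/(jump_process_time JP).
Qed.

Lemma measurable_word n x : measurable (word n x).
Proof.
by apply: measurable_forall_le => i; exact: (jump_process_chain JP).
Qed.

Lemma word_cylinder n x : word n x = cylinder n x (fun=> 0).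
Proof.
apply/seteqP; split=> w xw i /xw; last by case.
by move=> ?; split => //; exact: (jump_process_gt0 JP).
Qed.

Lemma proba_word n x : P (word n x) = (word_proba n x)%:E.
Proof.
rewrite word_cylinder (jump_process_law JP)//; congr EFin.
by rewrite [X in _ * X]big1 ?mulr1// => i _; rewrite mulr0 oppr0 expR0.
Qed.

Lemma word_proba_ge0 n x : 0 <= word_proba n x.
Proof. by rewrite -lee_fin -proba_word. Qed.

Lemma word_extend n x y : word n.+1 (extend n x y) = word n x `&` [set w | xi n.+1 w = y].
Proof.
apply/seteqP; split=> w /=.
  move=> E; split=> [i ni|]; first by have := E i (leqW ni); rewrite /extend ni.
  by have := E n.+1 (leqnn _); rewrite /extend ltnn.
move=> [E1 E2] i; rewrite leq_eqVlt ltnS /extend => /predU1P[->|ni].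
  by rewrite ltnn.
by rewrite ni; exact: E1.
Qed.

Lemma word_proba_extend n x y : word_proba n.+1 (extend n x y) = word_proba n x * pm (x n) y.
Proof.
rewrite /word_proba big_ord_recr/= {1 4 5}/extend /= leqnn ltnn mulrA.
congr (_ * _ * _); apply: eq_bigr => i _.
by rewrite /extend ltnW// ltn_ord.
Qed.

Lemma measurable_deviation a b (l : nat -> R) e :
  measurable [set w | e <= `|\sum_(a <= i < b) (h i w - l i)|].
Proof.
have mD : measurable_fun setT (fun w => `|\sum_(a <= i < b) (h i w - l i)|).
  apply: measurableT_comp => //; apply: measurable_sum => i.
  by apply: measurable_funB => //; exact: (jump_process_time JP).
have := mD measurableT _ (measurable_itv `[e, +oo[); rewrite setTI.
by congr measurable; apply/seteqP; split=> w /=; rewrite in_itv/= andbT.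
Qed.

Lemma proba_word_gt n x i t : (i <= n)%N -> 0 <= t ->
  P (word n x `&` [set w | t < h i w]) =
  (word_proba n x * expR (- (lam (x i) * t)))%:E.
Proof.
move=> ni t0; pose s j := if j == i then t else 0.
have -> : word n x `&` [set w | t < h i w] = cylinder n x s.
  apply/seteqP; split=> w /=.
    move=> [xw tw] j jn; split; first exact: xw.
    by rewrite /s; case: eqP => [->//|_]; exact: (jump_process_gt0 JP).
  by move=> xs; split=> [j /xs[]//|]; have [_] := xs i ni; rewrite /s eqxx.
rewrite (jump_process_law JP); last by move=> j; rewrite /s; case: ifP.
congr ((_ * _)%:E); rewrite (bigD1 (Ordinal (ni : (i < n.+1)%N)))//= /s eqxx.
by rewrite big1 ?mulr1// => j /negPf ji; rewrite -val_eqE/= in ji; rewrite ji mulr0 oppr0 expR0.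
Qed.

Lemma proba_word_gt2 n x i j t u : (i <= n)%N -> (j <= n)%N -> i != j ->
  0 <= t -> 0 <= u ->
  P (word n x `&` [set w | t < h i w /\ u < h j w]) =
  (word_proba n x * expR (- (lam (x i) * t)) * expR (- (lam (x j) * u)))%:E.
Proof.
move=> ni nj ij t0 u0; pose s k := if k == i then t else if k == j then u else 0.
have -> : word n x `&` [set w | t < h i w /\ u < h j w] = cylinder n x s.
  apply/seteqP; split=> w /=.
    move=> [xw [tw uw]] k kn; split; first exact: xw.
    rewrite /s; case: eqP => [->//|_]; case: eqP => [->//|_].
    exact: (jump_process_gt0 JP).
  move=> xs; split=> [k /xs[]//|]; split.
    by have [_] := xs i ni; rewrite /s eqxx.
  by have [_] := xs j nj; rewrite /s eq_sym (negPf ij) eqxx.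
rewrite (jump_process_law JP); last by move=> k; rewrite /s; case: ifP => // _; case: ifP.
rewrite -[in RHS]mulrA; congr ((_ * _)%:E); rewrite (bigD1 (Ordinal (ni : (i < n.+1)%N)))//= /s eqxx.
congr (_ * _); rewrite (bigD1 (Ordinal (nj : (j < n.+1)%N)))/=; last first.
  by rewrite -val_eqE/= eq_sym.
rewrite eq_sym (negPf ij) eqxx big1 ?mulr1// => k /andP[/negPf ki /negPf kj].
by rewrite -val_eqE/= in ki; rewrite -val_eqE/= in kj; rewrite ki kj mulr0 oppr0 expR0.
Qed.

Let h_ge0 i w : 0 <= h i w. Proof. exact/ltW/(jump_process_gt0 JP). Qed.
Let mh i : measurable_fun setT (h i) := jump_process_time JP i.

Lemma expectation_time n x i : (i <= n)%N ->
  (\int[P]_(w in word n x) (h i w)%:E = (word_proba n x / lam (x i))%:E)%E.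
Proof.
move=> ni; apply: layer_cake1 => //; first exact: measurable_word.
by move=> t t0; exact: proba_word_gt.
Qed.

(** For i = j the event s < h, t < h is contained in the event (s + t) / 2 <
    h, which bounds its probability by that for two independent times of rate
    lam / 2. *)
Lemma expectation_time2 n x i j : (i <= n)%N -> (j <= n)%N ->
  (\int[P]_(w in word n x) (h i w * h j w)%:E <=
    (word_proba n x * (1 + 3 * (i == j)%:R) / lam (x i) / lam (x j))%:E)%E.
Proof.
move=> ni nj; have [<-|ij] := eqVneq i j.
  have -> : word_proba n x * (1 + 3 * true%:R) / lam (x i) / lam (x i) =
      word_proba n x / (lam (x i) / 2) / (lam (x i) / 2).
    by rewrite (_ : true%:R = 1 :> R)//; field; rewrite gt_eqF.
  have l0 : 0 < lam (x i) / 2 by rewrite divr_gt0.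
  apply: layer_cake2 => //; first exact: measurable_word.
  move=> s t s0 t0; have st0 : 0 <= Num.max s t by rewrite le_max s0.
  rewrite (_ : [set w | _] = [set w | Num.max s t < h i w]); last first.
    by apply/seteqP; split=> w /=; rewrite gt_max => /andP.
  rewrite proba_word_gt// lee_fin -mulrA ler_wpM2l ?word_proba_ge0//.
  rewrite -expRD ler_expR -opprD lerN2 -mulrDr -mulrA ler_wpM2l ?(ltW (lam_gt0 _))//.
  rewrite mulrC ler_pdivrMr// mulr_natr mulr2n.
  by apply: lerD; rewrite le_max lexx ?orbT.
rewrite mulr0 addr0 mulr1; apply: layer_cake2 => //; first exact: measurable_word.
by move=> s t s0 t0; rewrite proba_word_gt2.
Qed.

(** Given the states the times are independent, so that the variance of their
    sum is at most three times the sum of the squared means. *)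
Lemma chebyshev_word n x a b e : (b <= n.+1)%N -> 0 < e ->
  (P (word n x `&` [set w | (e <= `|\sum_(a <= i < b) (h i w - (lam (x i))^-1)|)%R])
   <= (word_proba n x * (3 / e ^+ 2 * \sum_(a <= i < b) (lam (x i)) ^- 2))%:E)%E.
Proof.
move=> bn e0; set W := word n x; set r := index_iota a b.
have mW : measurable W by exact: measurable_word.
have rn i : i \in r -> (i <= n)%N.
  by rewrite mem_index_iota => /andP[_ ib]; rewrite -ltnS (leq_trans ib).
pose S w := \sum_(i <- r) h i w; pose m := \sum_(i <- r) (lam (x i))^-1.
have S0 w : 0 <= S w by apply: sumr_ge0.
have m0 : 0 <= m by apply: sumr_ge0 => i _; rewrite invr_ge0 ltW.
have mS : measurable_fun setT S by exact: measurable_sum.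
have DE w : \sum_(i <- r) (h i w - (lam (x i))^-1) = S w - m by rewrite sumrB.
have p0 := word_proba_ge0 n x; set p := word_proba n x in p0 *.
have mW_fun (f : Om -> R) : measurable_fun setT f ->
    measurable_fun W (fun w => (f w)%:E).
  by move=> mf; apply/measurable_EFinP; exact: measurable_funTS.
have intS : (\int[P]_(w in W) (S w)%:E = (p * m)%:E)%E.
  under eq_integral do rewrite /S -sumEFin.
  rewrite ge0_integral_sum//; last 2 first.
  - by move=> i; exact: mW_fun.
  - by move=> i w _; rewrite lee_fin.
  rewrite [LHS]big_seq (eq_bigr (fun i => (p / lam (x i))%:E)); last first.
    by move=> i /rn ir; exact: expectation_time.
  by rewrite -big_seq sumEFin -mulr_sumr.
pose v := \sum_(i <- r) (lam (x i)) ^- 2.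
have intS2 : (\int[P]_(w in W) (S w * S w)%:E <= (p * (m * m + 3 * v))%:E)%E.
  have -> : (\int[P]_(w in W) (S w * S w)%:E =
      \sum_(i <- r) \sum_(j <- r) \int[P]_(w in W) (h i w * h j w)%:E)%E.
    under eq_integral do rewrite /S mulr_suml -sumEFin.
    rewrite ge0_integral_sum//; last 2 first.
    - by move=> i; apply: mW_fun; apply: measurable_funM.
    - by move=> i w _; rewrite lee_fin; apply: mulr_ge0 => //; exact: S0.
    apply: eq_bigr => i _; under eq_integral do rewrite mulr_sumr -sumEFin.
    rewrite ge0_integral_sum//.
    - by move=> j; apply: mW_fun; exact: measurable_funM.
    - by move=> j w _; rewrite lee_fin mulr_ge0.
  rewrite big_seq; under eq_bigr do rewrite big_seq.
  apply: (@le_trans _ _ (\sum_(i <- r | i \in r) \sum_(j <- r | j \in r)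
     (p * (1 + 3 * (i == j)%:R) / lam (x i) / lam (x j))%:E)%E).
    by apply: lee_sum => i ir; apply: lee_sum => j jr; apply: expectation_time2; exact: rn.
  rewrite le_eqVlt; apply/orP; left; apply/eqP.
  under eq_bigr do rewrite -big_seq sumEFin.
  rewrite -big_seq sumEFin; congr EFin; rewrite mulrDr.
  transitivity (\sum_(i <- r) (p * (lam (x i))^-1 * m + p * 3 * (lam (x i)) ^- 2)).
    apply: eq_big_seq => i ir.
    transitivity (\sum_(j <- r) (p * (lam (x i))^-1 * (lam (x j))^-1 +
        (j == i)%:R * (p * 3 * (lam (x i)) ^- 2))).
      apply: eq_bigr => j _; rewrite eq_sym; case: eqP => [->|_]; rewrite /= ?mulr1n ?mulr0n; last by ring.
      by field; rewrite gt_eqF.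
    rewrite big_split/= -mulr_sumr -/m; congr (_ + _).
    rewrite (bigD1_seq i)//= ?iota_uniq// eqxx mul1r big1 ?addr0// => j.
    by move=> /negPf ->; rewrite mul0r.
  rewrite big_split/= -mulr_suml -mulr_sumr -/m.
  by rewrite -mulr_sumr -/m -/v; ring.
have intV : (\int[P]_(w in W) ((S w - m) ^+ 2)%:E <= (p * (3 * v))%:E)%E.
  have E : (\int[P]_(w in W) ((S w - m) ^+ 2)%:E + (2 * m * (p * m))%:E =
      \int[P]_(w in W) (S w * S w)%:E + (m * m * p)%:E)%E.
    rewrite [in LHS]EFinM -intS -ge0_integralZl_EFin//; last 3 first.
    - by move=> w _; rewrite lee_fin.
    - exact: mW_fun.
    - by rewrite mulr_ge0.
    rewrite -ge0_integralD//; last 4 first.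
    - by move=> w _; rewrite lee_fin sqr_ge0.
    - by apply: mW_fun; apply: measurable_funX; exact: measurable_funB.
    - by move=> w _; rewrite -EFinM lee_fin !mulr_ge0.
    - by apply: measurable_funeM; exact: mW_fun.
    rewrite [in RHS]EFinM -/p -proba_word -/W -integral_cst// -ge0_integralD//; last 3 first.
    - by move=> w _; rewrite lee_fin mulr_ge0.
    - by apply: mW_fun; exact: measurable_funM.
    - by move=> w _; rewrite lee_fin mulr_ge0.
    apply: eq_integral => w _; rewrite /cst -EFinM -!EFinD; congr EFin; ring.
  rewrite -(@leeD2rE _ (2 * m * (p * m))%:E)// E -EFinD.
  apply: le_trans (leeD2r _ intS2) _; rewrite -EFinD lee_fin.
  by rewrite le_eqVlt; apply/orP; left; apply/eqP; ring.
set B := [set w | _].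
have mB : measurable B by exact: measurable_deviation.
have mWB : measurable (W `&` B) by exact: measurableI.
have step : ((e ^+ 2)%:E * P (W `&` B) <= (p * (3 * v))%:E)%E.
  apply: le_trans intV; rewrite -integral_cst//.
  apply: (@le_trans _ _ (\int[P]_(w in W `&` B) ((S w - m) ^+ 2)%:E)%E).
    apply: ge0_le_integral_any => w; first by rewrite lee_fin sqr_ge0.
    move=> [_]; rewrite /B/= DE lee_fin -[(S w - m) ^+ 2]real_normK ?num_real//.
    by rewrite ler_pXn2r ?nnegrE// ltW.
  apply: ge0_subset_integral => //.
  - by apply: mW_fun; apply: measurable_funX; exact: measurable_funB.
  - by move=> w _; rewrite lee_fin sqr_ge0.
have fin : P (W `&` B) \is a fin_num by exact: fin_num_measure.
move: step; rewrite -(fineK fin) -EFinM !lee_fin -/v => step.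
have e2 : 0 < e ^+ 2 by rewrite exprn_gt0.
have -> : p * (3 / e ^+ 2 * v) = (p * (3 * v)) / e ^+ 2 by field; rewrite gt_eqF.
by rewrite ler_pdivlMr// mulrC.
Qed.

End JumpProcess.

(** * Non-explosion, and Markov chains as jump processes *)

(** If the jump times accumulated at some time, the left limit there would
    make the states eventually constant. *)
Lemma cadlag_divergent (R : realType) (T : Type) (f : skorokhod R T)
    (x : nat -> T) (h : nat -> R) :
  (forall i, 0 < h i) -> (forall n, x n <> x n.+1) -> follows f x h -> divergent h.
Proof.
move=> h0 xS fx; apply: contrapT => /existsNP[s] /forallNP sP.
have ub n : jump_time h n <= s by rewrite leNgt; exact/negP.
pose S := [set jump_time h n | n in [set: nat]].
have Sub : has_ubound S by exists s => _ [n _ <-]; exact: ub.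
have S0 : S !=set0 by exists (jump_time h 0), 0%N.
have Sle n : jump_time h n <= sup S by apply: ub_le_sup => //; exists n.
have Slt n : jump_time h n < sup S.
  by apply: lt_le_trans (Sle n.+1); rewrite jump_timeS ltrDl.
have t0 : 0 < sup S by have := Slt 0%N; rewrite jump_time0.
have [_ _ /(_ _ t0)[c]] := path_of_cadlag f.
rewrite /at_left near_withinE => -[e /= e0 ec].
have [_ [n _ <-] nS] : exists2 v, S v & sup S - e < v.
  exact: (sup_adherent e0 (conj S0 Sub)).
have fc m : (n <= m)%N -> x m = c.
  move=> nm; rewrite -(fx m (jump_time h m)); last by rewrite lexx jump_timeS ltrDl h0.
  apply: ec; last exact: Slt.
  rewrite /ball/= ger0_norm ?subr_ge0// ltrBlDl -ltrBlDr.
  by apply: lt_le_trans nS _; exact: jump_time_le.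
by apply: (xS n); rewrite !fc.
Qed.

Section JumpProcessNull.
Context {R : realType} {T : finType} {d : measure_display} {Om : measurableType d}.
Variable P : probability Om R.
Variables (pm : T -> T -> R) (lam : T -> R) (x0 : T).
Variables (xi : nat -> Om -> T) (h : nat -> Om -> R).
Hypothesis JP : jump_process P pm lam x0 xi h.
Hypothesis lam_gt0 : forall x, 0 < lam x.

Definition history n w : {ffun 'I_n.+1 -> T} := [ffun i : 'I_n.+1 => xi i w].

Lemma history_word n (c : {ffun 'I_n.+1 -> T}) :
  [set w | history n w = c] = word xi n (fun i => c (inord i)).
Proof.
apply/seteqP; split=> w /=.
  by move=> <- i ni; rewrite ffunE inordK.
by move=> cw; apply/ffunP => i; rewrite ffunE cw ?inord_val// -ltnS.
Qed.

Lemma measurable_history n c : measurable [set w | history n w = c].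
Proof. by rewrite history_word; exact: (measurable_word JP). Qed.

Lemma sum_word_proba n : \sum_(c : {ffun 'I_n.+1 -> T})
  word_proba pm x0 n (fun i => c (inord i)) = 1.
Proof.
apply/EFin_inj; rewrite -sumEFin -(@probability_setT _ _ _ P).
rewrite (measure_fin_partition P measurableT (@measurable_history n)).
by apply: eq_bigr => c _; rewrite setTI history_word (proba_word JP).
Qed.

Lemma proba_eq0_words n (E : set Om) : measurable E ->
  (forall c : {ffun 'I_n.+1 -> T}, P (E `&` word xi n (fun i => c (inord i))) = 0%E) ->
  P E = 0%E.
Proof.
move=> mE E0; rewrite (measure_fin_partition P mE (@measurable_history n)).
by rewrite big1// => c _; rewrite history_word.
Qed.

Let mjump n : measurable_fun setT (fun w => jump_time (h ^~ w) n).
Proof. by apply: measurable_sum => i; exact: (jump_process_time JP). Qed.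

Let mjump_le C n : measurable [set w | jump_time (h ^~ w) n <= C].
Proof.
have := mjump n measurableT (measurable_itv `]-oo, C]); rewrite setTI.
by congr measurable; apply/seteqP; split=> w /=; rewrite in_itv.
Qed.

(** The first n times have a sum of mean of order n and variance of order n,
    so by Chebyshev's inequality the probability that it stays bounded by C
    is O(1/n). *)
Lemma jump_process_divergent : exists N, [/\ measurable N, P N = 0%E &
  forall w, ~ N w -> divergent (h ^~ w)].
Proof.
pose E (C : nat) := [set w | forall n, jump_time (h ^~ w) n <= C%:R].
have mE C : measurable (E C).
  rewrite (_ : E C = \bigcap_n [set w | jump_time (h ^~ w) n <= C%:R]).
    by apply: bigcapT_measurable => n; exact: mjump_le.
  by apply/seteqP; split=> w Ew n; [move=> _|]; exact: Ew.
pose u := \sum_x lam x; pose v := \sum_x (lam x) ^- 2.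
have lamu x : lam x <= u.
  by rewrite /u (bigD1 x)//= lerDl sumr_ge0// => y _; exact/ltW.
have lamv x : (lam x) ^- 2 <= v.
  by rewrite /v (bigD1 x)//= lerDl sumr_ge0// => y _; rewrite invr_ge0 exprn_ge0// ltW.
have u0 : 0 < u := lt_le_trans (lam_gt0 x0) (lamu x0).
have v0 : 0 <= v by apply: le_trans (lamv x0); rewrite invr_ge0 exprn_ge0// ltW.
have PE C n : 2 * C%:R * u <= n.+1%:R ->
    (P (E C) <= (12 * u ^+ 2 * v / n.+1%:R)%:E)%E.
  move=> Cn; have n0 : (0 : R) < n.+1%:R by rewrite ltr0n.
  rewrite (measure_fin_partition P (mE C) (@measurable_history n)).
  set q := 12 * u ^+ 2 * v / n.+1%:R.
  have -> : q%:E = (\sum_(c : {ffun 'I_n.+1 -> T})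
      (word_proba pm x0 n (fun i => c (inord i)) * q)%:E)%E.
    by rewrite sumEFin -mulr_suml sum_word_proba mul1r.
  apply: lee_sum => c _; rewrite history_word; set x := (fun i : nat => _).
  (* Half of a lower bound for the mean of the sum. *)
  pose e := n.+1%:R / (2 * u).
  have e0 : 0 < e by rewrite divr_gt0// mulr_gt0.
  have := chebyshev_word JP lam_gt0 x 0 (leqnn n.+1) e0.
  set B := [set w | _]; move=> cheb.
  have EB : E C `&` word xi n x `<=` word xi n x `&` B.
    move=> w [Ew xw]; split=> //; rewrite /B /= sumrB.
    have m_ge : n.+1%:R / u <= \sum_(0 <= i < n.+1) (lam (x i))^-1.
      rewrite mulr_natl -[X in _ *+ X]subn0 -sumr_const_nat.
      by apply: ler_sum => i _; rewrite lef_pV2 ?posrE.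
    have S_le : \sum_(0 <= i < n.+1) h i w <= C%:R.
      by rewrite big_mkord; exact: Ew.
    have C_le : C%:R <= e by rewrite ler_pdivlMr ?mulr_gt0//; lra.
    have eE : n.+1%:R / u = 2 * e by rewrite /e; field; rewrite gt_eqF.
    rewrite distrC ger0_norm; first by lra.
    by rewrite subr_ge0; lra.
  have mB : measurable (word xi n x `&` B).
    apply: measurableI; first exact: (measurable_word JP).
    exact: (measurable_deviation JP).
  apply: le_trans (le_measure _ _ _ EB) _; rewrite ?inE//.
    by apply: measurableI => //; exact: (measurable_word JP).
  apply: le_trans cheb _; rewrite lee_fin ler_wpM2l ?(word_proba_ge0 JP)//.
  have -> : q = 3 / e ^+ 2 * (n.+1%:R * v).
    by rewrite /q /e; field; rewrite !gt_eqF.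
  rewrite ler_wpM2l ?divr_ge0 ?exprn_ge0 ?(ltW e0)//.
  rewrite mulr_natl -[X in _ *+ X]subn0 -sumr_const_nat.
  by apply: ler_sum => i _; exact: lamv.
have E0 C : P (E C) = 0%E.
  apply/eqP; rewrite eq_le measure_ge0 andbT; apply/lee_addgt0Pr => e e0.
  rewrite add0e.
  pose n := (Num.trunc (2 * C%:R * u + 12 * u ^+ 2 * v / e)).
  have c0 : 0 <= 12 * u ^+ 2 * v by rewrite mulr_ge0// mulr_ge0// exprn_ge0// ltW.
  have c1 : 0 <= 2 * C%:R * u by rewrite mulr_ge0// ltW.
  have nP : 2 * C%:R * u + 12 * u ^+ 2 * v / e < n.+1%:R by exact: Num.Theory.truncnS_gt.
  have c2 : 0 <= 12 * u ^+ 2 * v / e by rewrite divr_ge0// ltW.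
  apply: le_trans (PE C n _) _; first by lra.
  rewrite lee_fin ler_pdivrMr ?ltr0n// -ler_pdivrMl//.
  by apply: le_trans (ltW nP); rewrite mulrC lerDr.
exists (\bigcup_C E C); split.
- exact: bigcupT_measurable.
- exact: null_bigcup.
- move=> w Nw s; apply: contrapT => /forallNP sP; apply: Nw.
  exists (Num.trunc s).+1 => // n.
  have := sP n; move=> /negP; rewrite -leNgt => /le_trans; apply.
  exact/ltW/Num.Theory.truncnS_gt.
Qed.

Lemma jump_process_start : P [set w | xi 0%N w != x0] = 0%E.
Proof.
have m0 := measurable_pred (predC1 x0) (jump_process_chain JP 0).
apply: (@proba_eq0_words 0) => // c.
have [cx|cx] := eqVneq (c (inord 0)) x0.
  rewrite (_ : _ `&` _ = set0) ?measure0//; apply/seteqP; split=> w //= -[xw].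
  by move=> /(_ 0%N isT) E; rewrite E cx eqxx in xw.
apply/eqP; rewrite eq_le measure_ge0 andbT.
apply: (@le_trans _ _ (P (word xi 0 (fun i => c (inord i))))).
  apply: le_measure; rewrite ?inE; last exact: subIsetr.
    by apply: measurableI => //; exact: (measurable_word JP).
  exact: (measurable_word JP).
by rewrite (proba_word JP) /word_proba (negPf cx) mul0r.
Qed.

Lemma jump_process_move : (forall x, pm x x = 0) ->
  exists N, [/\ measurable N, P N = 0%E & forall w, ~ N w -> forall n, xi n w <> xi n.+1 w].
Proof.
move=> pm0; pose E n := [set w | xi n w = xi n.+1 w].
have mE n : measurable (E n).
  rewrite (_ : E n = \bigcup_(y in [set: T]) ([set w | xi n w = y] `&` [set w | xi n.+1 w = y])).
    apply: fin_bigcup_measurable; first exact: finite_finset.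
    by move=> y _; apply: measurableI; exact: (jump_process_chain JP).
  apply/seteqP; split=> w; first by move=> Ew; exists (xi n.+1 w).
  by move=> [y _ [/= a b]]; rewrite /E /= a b.
have E0 n : P (E n) = 0%E.
  apply: (@proba_eq0_words n.+1) => // c.
  have [cx|cx] := eqVneq (c (inord n)) (c (inord n.+1)); last first.
    rewrite (_ : _ `&` _ = set0) ?measure0//; apply/seteqP; split=> w //= -[xw cw].
    by move: cx; rewrite -(cw n)// -(cw n.+1)// xw eqxx.
  apply/eqP; rewrite eq_le measure_ge0 andbT.
  apply: (@le_trans _ _ (P (word xi n.+1 (fun i => c (inord i))))).
    apply: le_measure; rewrite ?inE; last exact: subIsetr.
      by apply: measurableI => //; exact: (measurable_word JP).
    exact: (measurable_word JP).
  by rewrite (proba_word JP) /word_proba big_ord_recr/= cx pm0 !mulr0.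
exists (\bigcup_n E n); split.
- exact: bigcupT_measurable.
- exact: null_bigcup.
- by move=> w Nw n e; apply: Nw; exists n.
Qed.

End JumpProcessNull.

Section CTMC.
Context {R : realType} {T : finType}.
Variable r : T -> T -> R.
Hypothesis holding_gt0 : forall x, 0 < holding_rate r x.

Lemma ctmc_jump_process (d : measure_display) (Om : measurableType d)
    (P : probability Om R) (x0 : T) (X : Om -> skorokhod R T) :
  is_ctmc r P x0 X -> exists xi h N,
  [/\ jump_process P (jump_proba r) (holding_rate r) x0 xi h,
      measurable N, P N = 0%E &
      forall w, ~ N w -> [/\ xi 0%N w = x0, divergent (h ^~ w) &
        follows (X w) (xi ^~ w) (h ^~ w)]].
Proof.
move=> [_ [xi [h [mxi mh h0 Xxi law]]]].
have JP : jump_process P (jump_proba r) (holding_rate r) x0 xi h by split.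
have pm0 x : jump_proba r x x = 0 by rewrite /jump_proba eqxx.
have [N [mN PN NP]] := jump_process_move JP pm0.
have m0 := measurable_pred (predC1 x0) (mxi 0%N).
exists xi, h, (N `|` [set w | xi 0%N w != x0]); split => //.
- exact: measurableU.
- by apply: null_setU => //; exact: (jump_process_start JP).
- move=> w /not_orP[/NP xiN /negP/negPn/eqP xi0].
  have fX : follows (X w) (xi ^~ w) (h ^~ w) by move=> n t; exact: Xxi.
  by split=> //; apply: cadlag_divergent fX => // i.
Qed.

Hypothesis r_ge0 : forall y z, 0 <= r y z.

Lemma jump_proba_ge0 y z : 0 <= jump_proba r y z.
Proof. by rewrite /jump_proba; case: eqP => // _; rewrite divr_ge0// ltW. Qed.

Lemma sum_jump_proba y : \sum_z jump_proba r y z = 1.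
Proof.
rewrite (bigD1 y)//= /jump_proba eqxx add0r.
transitivity (\sum_(z | z != y) r y z / holding_rate r y).
  by apply: eq_bigr => z /negPf ->.
by rewrite -mulr_suml -/(holding_rate r y) divff// gt_eqF.
Qed.

Lemma jump_probaE u y :
  \sum_z jump_proba r y z * u z = u y + generator r u y / holding_rate r y.
Proof.
have -> : generator r u y / holding_rate r y =
    \sum_z jump_proba r y z * (u z - u y).
  rewrite /generator mulr_suml; apply: eq_bigr => z _.
  rewrite /jump_proba; case: eqP => [->|_]; first by rewrite subrr !mulr0 mul0r.
  by ring.
under [in RHS]eq_bigr do rewrite mulrBr.
by rewrite sumrB -mulr_suml sum_jump_proba mul1r addrC subrK.
Qed.

End CTMC.

(** * The law of the visits to a subset *)

(** The value n.+1, when there is no later visit, keeps [visit] increasing. *)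
Definition next_visit (b : nat -> bool) n : nat :=
  xget n.+1 [set m | [/\ (n < m)%N, b m & forall j, (n < j < m)%N -> ~~ b j]].

Fixpoint visit (b : nat -> bool) k : nat :=
  if k is k'.+1 then next_visit b (visit b k') else 0%N.

Lemma next_visitP (b : nat -> bool) n : (exists2 m, (n < m)%N & b m) ->
  [/\ (n < next_visit b n)%N, b (next_visit b n) &
      forall j, (n < j < next_visit b n)%N -> ~~ b j].
Proof.
move=> [m nm bm].
have hm : exists m, (n < m)%N && b m by exists m; rewrite nm.
have [k /andP[nk bk] kP] := find_ex_minn hm.
suff : [set m | [/\ (n < m)%N, b m & forall j, (n < j < m)%N -> ~~ b j]] (next_visit b n) by [].
rewrite /next_visit; apply: xgetPex; exists k; split=> // j /andP[nj jk].
by apply/negP => bj; have := kP j; rewrite nj bj => /(_ isT); rewrite leqNgt jk.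
Qed.

Lemma next_visit_gt b n : (n < next_visit b n)%N.
Proof. by rewrite /next_visit; case: xgetP => // m _ []. Qed.

Lemma next_visit_in b n : b (next_visit b n) ->
  forall j, (n < j < next_visit b n)%N -> ~~ b j.
Proof.
rewrite /next_visit; case: xgetP => [m _ []//|].
by move=> _ _ j /andP[nj]; rewrite ltnS leqNgt nj.
Qed.

Lemma next_visitE b n d : (forall j, (j < d)%N -> ~~ b (n.+1 + j)%N) ->
  b (n.+1 + d)%N -> next_visit b n = (n.+1 + d)%N.
Proof.
move=> nb bd; have [lt bv nbv] := @next_visitP b n (ex_intro2 _ _ (n.+1 + d)%N (leq_addr _ _) bd).
case: (ltngtP (next_visit b n) (n.+1 + d)%N) => // h.
  have := nb (next_visit b n - n.+1)%N.
  by rewrite ltn_subLR// h subnKC// bv => /(_ isT).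
by have := nbv (n.+1 + d)%N; rewrite h leq_addr bd => /(_ isT).
Qed.

Lemma visitS_gt b k : (visit b k < visit b k.+1)%N.
Proof. exact: next_visit_gt. Qed.

Section Excursions.
Context {R : realType} {T : finType} {d : measure_display} {Om : measurableType d}.
Variable P : probability Om R.
Variables (pm : T -> T -> R) (lam : T -> R) (x0 : T).
Variables (xi : nat -> Om -> T) (h : nat -> Om -> R).
Hypothesis JP : jump_process P pm lam x0 xi h.
Variable G : pred T.

(** The probability to go from y to z in k.+1 steps with the k intermediate
    states outside G. *)
Fixpoint excursion_proba k y z : R :=
  if k is k'.+1 then \sum_(u | ~~ G u) pm y u * excursion_proba k' u z else pm y z.

Variable pG : T -> T -> R.
Hypothesis pG_cvg : forall y z, G z ->
  \sum_(0 <= k < N) excursion_proba k y z @[N --> \oo] --> pG y z.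

Let mxi n x := jump_process_chain JP n x.
Let mxiG n : measurable [set w | G (xi n w)] := measurable_pred G (mxi n).
Let mh n s : measurable [set w | s < h n w].
Proof. exact/measurable_gt/(jump_process_time JP). Qed.

(** The visits to G after time n begin with the states of l, with holding
    times above the thresholds of l. *)
Fixpoint next_visits (l : seq (T * R)) n : set Om :=
  if l is (z, s) :: l' then
    \bigcup_k ([set w | forall j, (j < k)%N -> ~~ G (xi (n.+1 + j)%N w)] `&`
      ([set w | xi (n.+1 + k)%N w = z] `&` [set w | s < h (n.+1 + k)%N w] `&`
       next_visits l' (n.+1 + k)%N))
  else setT.

Let exc k l z s n := [set w | forall j, (j < k)%N -> ~~ G (xi (n.+1 + j)%N w)] `&`
      ([set w | xi (n.+1 + k)%N w = z] `&` [set w | s < h (n.+1 + k)%N w] `&`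
       next_visits l (n.+1 + k)%N).

Let mexc k l z s n : (forall n, measurable (next_visits l n)) -> measurable (exc k l z s n).
Proof.
move=> ml; apply: measurableI; last first.
  by apply: measurableI => //; apply: measurableI.
case: k => [|k].
  by rewrite (_ : [set w | _] = setT)//; apply/seteqP; split.
rewrite (_ : [set w | _] =
    [set w | forall j, (j <= k)%N -> (~` [set w | G (xi (n.+1 + j)%N w)]) w]).
  by apply: measurable_forall_le => i; exact: measurableC.
by apply/seteqP; split=> w /= nG j jk; apply/negP; exact: nG.
Qed.

Lemma measurable_next_visits l n : measurable (next_visits l n).
Proof.
elim: l n => [|[z s] l ih] n; first exact: measurableT.
by apply: bigcupT_measurable => k; exact: mexc.
Qed.

Fixpoint visits_weight y (l : seq (T * R)) : R :=
  if l is (z, s) :: l' then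
    pG y z * expR (- (lam z * s)) * visits_weight z l' else 1.

Lemma cylinder_extend n x s y u :
  cylinder xi h n.+1 (extend n x y) (extend n s u) =
  cylinder xi h n x s `&` ([set w | xi n.+1 w = y] `&` [set w | u < h n.+1 w]).
Proof.
apply/seteqP; split=> w.
  move=> E; split.
    by move=> i ni; have := E i (leqW ni); rewrite /extend ni.
  by have := E n.+1 (leqnn _); rewrite /extend ltnn.
move=> [E1 [E2 E3]] i; rewrite leq_eqVlt ltnS /extend => /predU1P[->|ni].
  by rewrite ltnn.
by rewrite ni; exact: E1.
Qed.

Lemma proba_cylinder_extend n (x : nat -> T) (s : nat -> R) y u : (forall i, 0 <= s i) -> 0 <= u ->
  P (cylinder xi h n.+1 (extend n x y) (extend n s u)) =
  (fine (P (cylinder xi h n x s)) * (pm (x n) y * expR (- (lam y * u))))%:E.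
Proof.
move=> s0 u0; rewrite !(jump_process_law JP)//; last first.
  by move=> i; rewrite /extend; case: ifP.
rewrite /= /extend big_ord_recr [X in _ * _ * X]big_ord_recr/= ltnn leqnn.
congr EFin; rewrite (eq_bigr (fun i : 'I_n => pm (x i) (x i.+1))); last first.
  by move=> i _; rewrite ltnW// ltn_ord.
rewrite [X in _ * _ * (X * _)](eq_bigr (fun i : 'I_n.+1 => expR (- (lam (x i) * s i)))); last first.
  by move=> i _; rewrite -ltnS ltn_ord.
by ring.
Qed.

Let finP A : measurable A -> P A = (fine (P A))%:E.
Proof. by move=> mA; rewrite fineK// fin_num_measure. Qed.

Let h_gt0 n w : 0 < h n w. Proof. exact: (jump_process_gt0 JP). Qed.

(** The strong Markov property at the successive visits: sum over the length
    of the excursion before the first of them, and use induction on l. *)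
Lemma proba_next_visits (l : seq (T * R)) n (x : nat -> T) (s : nat -> R) :
  all (fun zs => G zs.1 && (0 <= zs.2)) l -> (forall i, 0 <= s i) ->
  P (cylinder xi h n x s `&` next_visits l n) =
  (fine (P (cylinder xi h n x s)) * visits_weight (x n) l)%:E.
Proof.
elim: l n x s => [|[z u] l ih] n x s /= => [_|/andP[/andP[Gz u0] Gl]] s0.
  by rewrite setIT mulr1; exact/finP/(measurable_cylinder JP).
pose q := expR (- (lam z * u)) * visits_weight z l.
have excE k : P (cylinder xi h n x s `&` exc k l z u n) =
    (fine (P (cylinder xi h n x s)) * (excursion_proba k (x n) z * q))%:E.
  elim: k n x s s0 => [|k IH] n x s s0 /=.
    rewrite (_ : _ `&` _ = cylinder xi h n.+1 (extend n x z) (extend n s u) `&`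
      next_visits l n.+1).
      rewrite ih//; last by move=> i; rewrite /extend; case: ifP.
      rewrite proba_cylinder_extend//= [extend n x z n.+1]/extend ltnn; congr EFin.
      by rewrite /q; ring.
    rewrite cylinder_extend /exc addn0; apply/seteqP; split=> w.
      by move=> [E1 [_ [E2 E3]]].
    by move=> [[E1 E2] E3].
  rewrite (measure_fin_partition P _ (mxi n.+1)); last first.
    apply: measurableI; first exact: (measurable_cylinder JP).
    by apply: mexc => m; exact: measurable_next_visits.
  rewrite mulr_suml mulr_sumr -sumEFin [RHS]big_mkcond/=; apply: eq_bigr => y _.
  case: ifPn => [Gy|/negPn Gy]; last first.
    rewrite (_ : _ `&` _ = set0) ?measure0//; apply/seteqP; split=> w //=.
    by move=> [[_ [/(_ 0%N isT) +] _]] xy; rewrite addn0 xy Gy.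
  rewrite (_ : _ `&` _ = cylinder xi h n.+1 (extend n x y) (extend n s 0) `&`
      exc k l z u n.+1).
    rewrite IH; last by move=> i; rewrite /extend; case: ifP.
    rewrite proba_cylinder_extend//= [extend n x y n.+1]/extend ltnn mulr0 oppr0 expR0 mulr1.
    by congr EFin; ring.
  rewrite cylinder_extend /exc; apply/seteqP; split=> w /=.
    move=> [[E1 [E2 E3]] E4]; split; first by split=> //; split=> //; exact: h_gt0.
    split; last by rewrite addSnnS.
    by move=> j jk; rewrite addSnnS; apply: E2.
  move=> [[E1 [E2 _]] [E3 E4]]; split=> //; split=> //; split; last by rewrite addnS -addSn.
  move=> [|j] jk; first by rewrite addn0 E2.
  by rewrite addnS -addSn; exact: E3.
rewrite setI_bigcupr measure_semi_bigcup//; last 3 first.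
- move=> k; apply: measurableI; first exact: (measurable_cylinder JP).
  by apply: mexc => m; exact: measurable_next_visits.
- apply/trivIsetP => i j _ _ ij; apply/seteqP; split=> w //=.
  wlog lij : i j ij / (i < j)%N.
    move=> W; have [lt|lt|eq] := ltngtP i j; first exact: (W i j ij lt).
      by move=> [A B]; apply: (W j i _ lt) => //; rewrite eq_sym.
    by rewrite eq eqxx in ij.
  move=> [[_ [_ [[/= wz _] _]]] [_ [/(_ i lij) + _]]].
  by rewrite wz Gz.
- apply: bigcupT_measurable => k; apply: measurableI; first exact: (measurable_cylinder JP).
  by apply: mexc => m; exact: measurable_next_visits.
rewrite (eq_eseriesr (fun k _ => excE k)).
apply/cvg_lim => //.
rewrite -mulrA -/q.
under eq_fun do rewrite sumEFin -mulr_sumr -mulr_suml.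
apply/fine_cvgP; split; first by near=> N.
apply: cvgM; first exact: cvg_cst.
by apply: cvgM; [exact: pG_cvg|exact: cvg_cst].
Unshelve. all: by end_near. Qed.

Let b w n := G (xi n w).

Definition visit_state k w : T := xi (visit (b w) k) w.
Definition visit_time k w : R := h (visit (b w) k) w.

Let mnext n m : measurable [set w | next_visit (b w) n = m].
Proof.
pose A m := [set w | [/\ (n < m)%N, b w m & forall j, (n < j < m)%N -> ~~ b w j]].
have mA j : measurable (A j).
  have [nj|nj] := ltnP n j; last first.
    rewrite (_ : A j = set0)//; apply/seteqP; split=> w // -[].
    by rewrite ltnNge nj.
  rewrite (_ : A j = [set w | G (xi j w)] `&`
    \bigcap_(i in [set i | (n < i < j)%N]) ~` [set w | G (xi i w)]).
    apply: measurableI => //; apply: bigcap_measurableType => i _.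
    exact: measurableC.
  apply/seteqP; split=> w /=; first by move=> [_ bj nb]; split=> // i /nb /negP.
  by move=> [bj nb]; split=> // i /nb /negP.
have uniqA w i j : A i w -> A j w -> i = j.
  move=> [ni bi nbi] [nj bj nbj]; case: (ltngtP i j) => // ij.
    by have := nbj i; rewrite ni ij bi => /(_ isT).
  by have := nbi j; rewrite nj ij bj => /(_ isT).
have [mE|mn] := eqVneq m n.+1.
  rewrite (_ : [set w | _] = A m `|` ~` \bigcup_j A j).
    by apply: measurableU => //; apply: measurableC; exact: bigcupT_measurable.
  apply/seteqP; split=> w /=; rewrite /next_visit; case: xgetP => [j -> Aj|nA].
  - by move=> <-; left.
  - by move=> _; right => -[j _]; exact: nA.
  - by move=> [Am|[]]; [exact: uniqA Aj Am|exact: (ex_intro2 _ _ _ I Aj)].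
  - by move=> [/nA|].
rewrite (_ : [set w | _] = A m)//; apply/seteqP; split=> w /=; rewrite /next_visit;
  case: xgetP => [j -> Aj|nA].
- by move=> <-.
- by move=> e; rewrite e eqxx in mn.
- exact: uniqA.
- by move=> /nA.
Qed.

Let mvisit k m : measurable [set w | visit (b w) k = m].
Proof.
elim: k m => [|k ih] m.
  have [->|m0] := eqVneq m 0%N.
    by rewrite (_ : [set w | _] = setT)//; apply/seteqP; split.
  rewrite (_ : [set w | _] = set0)//; apply/seteqP; split=> w //= e.
  by rewrite -e eqxx in m0.
rewrite (_ : [set w | _] = \bigcup_n ([set w | visit (b w) k = n] `&`
    [set w | next_visit (b w) n = m])).
  by apply: bigcupT_measurable => n; exact: measurableI.
apply/seteqP; split=> w /=; first by move=> e; exists (visit (b w) k).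
by move=> [n _ [/= -> ]].
Qed.

Lemma measurable_visit_state k y : measurable [set w | visit_state k w = y].
Proof.
rewrite (_ : [set w | _] = \bigcup_n ([set w | visit (b w) k = n] `&`
    [set w | xi n w = y])).
  by apply: bigcupT_measurable => n; exact: measurableI.
apply/seteqP; split=> w /=; first by move=> e; exists (visit (b w) k).
by move=> [n _ [/= + <-]]; rewrite /visit_state => ->.
Qed.

Lemma measurable_visit_time k : measurable_fun setT (visit_time k).
Proof.
move=> _ Y mY; rewrite setTI (_ : _ @^-1` _ =
    \bigcup_n ([set w | visit (b w) k = n] `&` (setT `&` h n @^-1` Y))).
  apply: bigcupT_measurable => n; apply: measurableI => //.
  exact: (jump_process_time JP).
apply/seteqP; split=> w /=; first by move=> e; exists (visit (b w) k).
by move=> [n _ [/= <- [_]]].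
Qed.

Lemma visit_cylinder m (z : nat -> T) (s : nat -> R) : (forall i, G (z i)) ->
  [set w | forall i, (i <= m)%N -> visit_state i w = z i /\ s i < visit_time i w] =
  cylinder xi h 0 z s `&` next_visits [seq (z i, s i) | i <- iota 1 m] 0.
Proof.
move=> Gz.
have step w k r : visit_state k w = z k -> (
    (forall i, (k < i <= k + r)%N -> visit_state i w = z i /\ s i < visit_time i w) <->
    next_visits [seq (z i, s i) | i <- iota k.+1 r] (visit (b w) k) w).
  elim: r k => [|r ih] k zk /=.
    by split=> // _ i; rewrite addn0 => /andP[/leq_trans h1 /h1]; rewrite ltnn.
  split.
    move=> H; have /H[z1 s1] : (k < k.+1 <= k + r.+1)%N.
      by rewrite leqnn addnS ltnS leq_addr.
    have Gv : b w (visit (b w) k.+1) by rewrite /b -/(visit_state _ _) z1.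
    have lt := visitS_gt (b w) k.
    exists (visit (b w) k.+1 - (visit (b w) k).+1)%N => //.
    rewrite subnKC//; split.
      move=> j jk; apply: (next_visit_in Gv).
      by rewrite leq_addr/= -ltn_subRL.
    split; first by split.
    by apply/(ih k.+1 z1) => i ki; apply: H; rewrite addnS -addSn ltnW ?(andP ki).1//= (andP ki).2.
  move=> [j _ [nG [[/= zj sj] nv]]].
  have vE : visit (b w) k.+1 = ((visit (b w) k).+1 + j)%N.
    by apply: next_visitE => //; rewrite /b zj.
  have z1 : visit_state k.+1 w = z k.+1 by rewrite /visit_state vE.
  rewrite -vE in nv; have /(ih k.+1 z1) H := nv.
  move=> i /andP[]; rewrite leq_eqVlt => /predU1P[<-|ki] ir.
    by split=> //; rewrite /visit_time vE.
  by apply: H; rewrite ki addSn -addnS.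
apply/seteqP; split=> w.
  move=> H; have [z0 s0] := H 0%N isT; split; first by move=> i; rewrite leqn0 => /eqP ->.
  by apply/(step w 0%N m z0) => i /andP[_ im]; apply: H.
move=> [/(_ 0%N isT)[z0 s0] nv] i; case: i => [|i] im; first by split.
by have /(step w 0%N m z0) := nv; apply.
Qed.

Lemma visit_law m (z : nat -> T) (s : nat -> R) : (forall i, 0 <= s i) ->
  (forall i, G (z i)) ->
  P [set w | forall i, (i <= m)%N -> visit_state i w = z i /\ s i < visit_time i w] =
  ((z 0%N == x0)%:R * \prod_(i < m) pG (z i) (z i.+1) *
     \prod_(i < m.+1) expR (- (lam (z i) * s i)))%:E.
Proof.
move=> s0 Gz; rewrite visit_cylinder// proba_next_visits//; last first.
  by apply/allP => _ /mapP[i _ ->]; rewrite Gz s0.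
rewrite (jump_process_law JP)//= big_ord0 mulr1 big_ord1; congr EFin.
have -> k r : visits_weight (z k) [seq (z i, s i) | i <- iota k.+1 r] =
    \prod_(k <= i < k + r) (pG (z i) (z i.+1) * expR (- (lam (z i.+1) * s i.+1))).
  elim: r k => [|r ih] k /=; first by rewrite addn0 big_geq.
  by rewrite ih [in RHS]big_ltn addnS ?ltnS ?leq_addr// addSn.
rewrite add0n big_split/= !big_mkord [in RHS]big_ord_recl/=.
by rewrite -!mulrA; congr (_ * _); rewrite mulrCA.
Qed.

End Excursions.

(** * Recurrence of the visits *)

Section ValueIteration.
Context {R : realType} {T : finType}.
Variable r : T -> T -> R.
Hypothesis r_ge0 : forall y z, 0 <= r y z.
Hypothesis r_irr : forall y z, connect [rel y z | 0 < r y z] y z.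
Hypothesis holding_gt0 : forall x, 0 < holding_rate r x.
Local Notation pm := (jump_proba r).
Local Notation lam := (holding_rate r).

Section Iteration.
Variables (B : pred T) (b0 : T) (g c u : T -> R).
Hypotheses (Bb0 : B b0) (g_ge0 : forall y, 0 <= g y) (c_ge0 : forall y, 0 <= c y).
Hypotheses (uB : forall y, B y -> u y = g y)
           (Lu : forall y, ~~ B y -> generator r u y = - (lam y * c y)).

(** The solution of the Dirichlet problem for the chain stopped after N
    steps: cost c at each step, reward g on B. *)
Fixpoint value_iteration N y : R :=
  if B y then g y else
  if N is N'.+1 then c y + \sum_z pm y z * value_iteration N' z else 0.

Let pm_ge0 y z : 0 <= pm y z. Proof. exact: jump_proba_ge0. Qed.

Let u_fix y : ~~ B y -> u y = c y + \sum_z pm y z * u z.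
Proof.
move=> By; rewrite jump_probaE// Lu// mulNr mulrAC divff ?gt_eqF// mul1r.
by rewrite addrC subrK.
Qed.

Lemma dirichlet_ge0 y : 0 <= u y.
Proof.
rewrite -oppr_le0.
apply: (@maximum_principle _ _ r r_ge0 r_irr B b0 (fun z => - u z)) => //.
  move=> z Bz; have := generatorZ r (-1) u z; rewrite Lu// mulN1r opprK.
  under [X in generator _ X]eq_fun do rewrite mulN1r.
  by move=> ->; rewrite mulr_ge0// ltW.
by move=> z Bz; rewrite uB// oppr_le0.
Qed.

Let vi_le_u N y : value_iteration N y <= u y.
Proof.
elim: N y => [|N ih] y /=; case: ifPn => By;
  [by rewrite uB|exact: dirichlet_ge0|by rewrite uB|].
by rewrite u_fix// lerD2l; apply: ler_sum => z _; rewrite ler_wpM2l.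
Qed.

Let vi_ge0 N y : 0 <= value_iteration N y.
Proof.
elim: N y => [|N ih] y /=; case: ifPn => // By.
by rewrite addr_ge0// sumr_ge0// => z _; rewrite mulr_ge0.
Qed.

Let vi_leS N y : value_iteration N y <= value_iteration N.+1 y.
Proof.
elim: N y => [|N ih] y; first by rewrite {1}/value_iteration; case: ifPn => By;
  [rewrite /= By|exact: vi_ge0].
rewrite /= ; case: ifPn => // By; rewrite lerD2l; apply: ler_sum => z _.
by rewrite ler_wpM2l//; exact: ih.
Qed.

(** The iterates increase and stay below u; their limit solves the same
    Dirichlet problem, which has a unique solution. *)
Lemma value_iteration_cvg y : value_iteration N y @[N --> \oo] --> u y.
Proof.
have cv z : cvgn (fun N => value_iteration N z).
  apply: nondecreasing_is_cvgn; last by exists (u z) => _ [N _ <-]; exact: vi_le_u.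
  by apply/nondecreasing_seqP => N; exact: vi_leS.
pose v z := limn (fun N => value_iteration N z).
have vE z : v z = if B z then g z else c z + \sum_w pm z w * v w.
  case: ifPn => Bz.
    rewrite /v (_ : value_iteration ^~ z = fun=> g z) ?lim_cst//.
    by apply/funext => -[|N] /=; rewrite Bz.
  apply: cvg_lim => //; rewrite -(cvg_shiftS (value_iteration ^~ z)) /= (negPf Bz).
  apply: cvgD; first exact: cvg_cst.
  apply: cvg_big => [|w _]; first exact: add_continuous.
  by apply: cvgM; [exact: cvg_cst|exact: cv].
suff -> : u y = v y by exact: cv.
apply: (@dirichlet_unique _ _ r r_ge0 r_irr B b0) => // z Bz; last by rewrite vE Bz uB.
rewrite Lu//; have := jump_probaE holding_gt0 v z; have := vE z; rewrite (negPf Bz).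
rewrite -[generator r v z](divfK (lt0r_neq0 (holding_gt0 z))).
rewrite mulfK ?lt0r_neq0//; set q := generator r v z / lam z => e2 e1.
have -> : q = - c z by lra.
by rewrite mulNr mulrC.
Unshelve. all: by end_near. Qed.

End Iteration.

(** Sum of the probabilities of the excursions of each length: the partial
    sums are value iterates for the harmonic function [om z]. *)
Lemma excursion_cvg (G : pred T) (om : T -> T -> R) y z :
  hitting_distribution r G om -> G z ->
  \sum_(0 <= k < N) excursion_proba pm G k y z @[N --> \oo] -->
  \sum_u pm y u * om z u.
Proof.
move=> omP Gz; have [om1 om2] := omP z Gz.
pose vi := value_iteration G (fun u => (u == z)%:R) (fun=> 0).
have viE N u : ~~ G u -> vi N u = \sum_(0 <= k < N) excursion_proba pm G k u z.
  elim: N u => [|N ih] u Gu; first by rewrite big_geq//= (negPf Gu).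
  rewrite big_nat_recl//= (negPf Gu) add0r (bigID G)/=; congr (_ + _).
    rewrite (bigD1 z)//= big1 ?addr0; last first.
      move=> v /andP[Gv vz]; rewrite /vi; case: N {ih} => /=; rewrite Gv (negPf vz) mulr0//.
    by rewrite /vi; case: N {ih} => /=; rewrite Gz eqxx mulr1.
  rewrite exchange_big/=; apply: eq_bigr => v Gv.
  by rewrite -mulr_sumr -/vi ih.
rewrite -cvg_shiftS /=.
have -> : (fun N => \sum_(0 <= k < N.+1) excursion_proba pm G k y z) =
    (fun N => \sum_u pm y u * vi N u).
  apply/funext => N; rewrite big_nat_recl//= [RHS](bigID G)/=; congr (_ + _).
    rewrite (bigD1 z)//= big1 ?addr0; last first.
      by move=> v /andP[Gv vz]; rewrite /vi; case: N => /=; rewrite Gv (negPf vz) mulr0.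
    by rewrite /vi; case: N => /=; rewrite Gz eqxx mulr1.
  rewrite exchange_big/=; apply: eq_bigr => v Gv.
  by rewrite -mulr_sumr -viE.
apply: cvg_big => [|u _]; first exact: add_continuous.
apply: cvgM; first exact: cvg_cst.
by apply: (@value_iteration_cvg G z) => // v Gv; rewrite om2// mulr0 oppr0.
Qed.

End ValueIteration.

Section Recurrence.
Context {R : realType} {T : finType} {d : measure_display} {Om : measurableType d}.
Variable P : probability Om R.
Variables (pm : T -> T -> R) (lam : T -> R) (x0 : T).
Variables (xi : nat -> Om -> T) (h : nat -> Om -> R).
Hypothesis JP : jump_process P pm lam x0 xi h.
Variable (G : pred T) (pG : T -> T -> R).
Hypothesis Gx0 : G x0.
Hypothesis pG_cvg : forall y z, G z ->
  \sum_(0 <= k < N) excursion_proba pm G k y z @[N --> \oo] --> pG y z.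
Hypothesis pG_sum : forall y, G y -> \sum_(z | G z) pG y z = 1.
Local Notation Z := (visit_state xi G).
Local Notation g := (visit_time xi h G).

Let mZ k y : measurable [set w | Z k w = y] := measurable_visit_state JP G k y.

Let mZG k : measurable [set w | G (Z k w)] := measurable_pred G (mZ k).

Let g_gt0 k w : 0 < g k w. Proof. exact: (jump_process_gt0 JP). Qed.

Let mwordZ n z : measurable (word Z n z).
Proof. by apply: measurable_forall_le => i; exact: mZ. Qed.

Let proba_wordZ n (z : nat -> T) : (forall i, (i <= n)%N -> G (z i)) ->
  P (word Z n z) = (word_proba pG x0 n z)%:E.
Proof.
move=> Gz; pose z' i := if (i <= n)%N then z i else x0.
have Gz' i : G (z' i) by rewrite /z'; case: ifP => // /Gz.
have := @visit_law _ _ _ _ _ _ _ _ _ _ JP G pG pG_cvg n z' (fun=> 0) (fun=> lexx _) Gz'.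
rewrite (_ : [set w | _] = word Z n z); last first.
  apply/seteqP; split=> w E i ni; have := E i ni; rewrite /z' ni.
    by case.
  by split.
move=> ->; congr EFin; rewrite [X in _ * X]big1 ?mulr1; last first.
  by move=> i _; rewrite mulr0 oppr0 expR0.
rewrite /word_proba /z' /=; congr (_ * _); apply: eq_bigr => i _.
by rewrite ltn_ord ltnW.
Qed.

Let escape n := [set w | (forall i, (i <= n)%N -> G (Z i w)) /\ ~~ G (Z n.+1 w)].

Let mescape n : measurable (escape n).
Proof.
rewrite (_ : escape n = [set w | forall i, (i <= n)%N -> [set w | G (Z i w)] w] `&`
   ~` [set w | G (Z n.+1 w)]).
  by apply: measurableI; [exact: measurable_forall_le|exact: measurableC].
by apply/seteqP; split=> w [E1 /negP E2].
Qed.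

Let escape0 n : P (escape n) = 0%E.
Proof.
have mhist c : measurable [set w | history Z n w = c].
  by rewrite history_word; exact: mwordZ.
rewrite (measure_fin_partition P (mescape n) mhist) big1// => c _.
rewrite history_word; set z := (fun i : nat => _).
have [Gz|/existsNP[i /not_implyP[ni Gz]]] := pselect (forall i, (i <= n)%N -> G (z i)); last first.
  rewrite (_ : _ `&` _ = set0) ?measure0//; apply/seteqP; split=> w //=.
  by move=> [[Gw _] wz]; apply: Gz; rewrite -wz//; exact: Gw.
have := measure_fin_partition P (mwordZ n z) (mZ n.+1).
rewrite (bigID G)/= [X in (X + _)%E](_ : _ = P (word Z n z)); last first.
  transitivity (\sum_(y | G y) (word_proba pG x0 n z * pG (z n) y)%:E)%E.
    apply: eq_bigr => y Gy.
    rewrite -word_extend proba_wordZ ?word_proba_extend// => i _.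
    by rewrite /extend; case: ifP => // /Gz.
  by rewrite sumEFin -mulr_sumr pG_sum ?mulr1 ?proba_wordZ//; exact: Gz.
have fin : P (word Z n z) \is a fin_num by exact: fin_num_measure.
rewrite -[X in X = _]adde0 => /(congr1 (fun x => x - P (word Z n z))%E).
rewrite adde0 subee// addeAC subee// add0e => /esym E.
rewrite (measure_fin_partition P _ (mZ n.+1)); last exact: measurableI.
rewrite (bigID G)/= big1 ?add0e; last first.
  move=> y Gy; rewrite (_ : _ `&` _ = set0) ?measure0//; apply/seteqP; split=> w //=.
  by move=> [[[_ nG] _] wy]; rewrite wy Gy in nG.
apply/eqP; rewrite eq_le sume_ge0 ?andbT// -[leRHS]E; apply: lee_sum => y _.
apply: le_measure; rewrite ?inE.
- by apply: measurableI => //; exact: measurableI.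
- exact: measurableI.
- by move=> w [[_ wz] wy].
Qed.

(** The probabilities of the words of visits add up to 1 because pG is
    stochastic on G, which leaves probability 0 for a last visit. *)
Lemma visits_recurrent : exists N, [/\ measurable N, P N = 0%E &
  forall w, ~ N w -> forall k, G (Z k w)].
Proof.
have m0 := measurable_pred (predC1 x0) (jump_process_chain JP 0).
exists ([set w | xi 0%N w != x0] `|` \bigcup_n escape n); split.
- by apply: measurableU => //; exact: bigcupT_measurable.
- apply: null_setU => //; [exact: bigcupT_measurable|exact: (jump_process_start JP)|].
  exact: null_bigcup.
- move=> w /not_orP[/negP/negPn/eqP xi0 nesc] k.
  suff : forall i, (i <= k)%N -> G (Z i w) by apply.
  elim: k => [|k ih] i; first by rewrite leqn0 => /eqP ->; rewrite /visit_state/= xi0.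
  rewrite leq_eqVlt ltnS => /predU1P[->|/ih//].
  by apply/negPn/negP => nG; apply: nesc; exists k.
Qed.

Lemma visit_jump_process (s0 : {y | G y}) : val s0 = x0 ->
  exists (Y : nat -> Om -> {y | G y}) N,
  [/\ jump_process P (fun y z => pG (val y) (val z)) (fun y => lam (val y)) s0 Y g,
      measurable N, P N = 0%E & forall w, ~ N w -> forall k, val (Y k w) = Z k w].
Proof.
move=> s0x0; have [N [mN PN NG]] := visits_recurrent.
pose Y k w := insubd s0 (Z k w).
have YZ w : ~ N w -> forall k, val (Y k w) = Z k w.
  by move=> Nw k; rewrite /Y insubdK//; exact: NG.
have mY k y : measurable [set w | Y k w = y].
  rewrite (_ : [set w | _] = [set w | insubd s0 (Z k w) == y]).
    exact: (measurable_pred (fun v => insubd s0 v == y) (mZ k)).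
  by apply/seteqP; split=> w /eqP.
exists Y, N; split=> //; split=> //.
- by move=> n; exact: (measurable_visit_time JP).
- move=> n x s s_ge0.
  have /= := @visit_law _ _ _ _ _ _ _ _ _ _ JP G pG pG_cvg n (fun i => val (x i)) s s_ge0
    (fun i => valP (x i)).
  rewrite -s0x0 -(inj_eq val_inj) => <-.
  set A := [set w | _]; set B := [set w | _].
  have mA : measurable A.
    apply: (@measurable_forall_le _ _ (fun i => [set w | Y i w = x i] `&` [set w | s i < g i w])).
    by move=> i; apply: measurableI => //; exact/measurable_gt/(measurable_visit_time JP).
  have mB : measurable B.
    apply: (@measurable_forall_le _ _ (fun i => [set w | Z i w = val (x i)] `&` [set w | s i < g i w])).
    by move=> i; apply: measurableI => //; exact/measurable_gt/(measurable_visit_time JP).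
  apply: (measure_eq_off_null mN PN) => // w Nw; split=> E i ni; have [E1 E2] := E i ni; split=> //.
    by rewrite -(YZ w Nw) E1.
  by apply: val_inj; rewrite YZ.
Qed.

End Recurrence.

(** * Mean hitting times *)

Lemma ge0_integral_fin_partition (R : realType) (d : measure_display)
    (Om : measurableType d) (P : probability Om R) (T : finType) (X : Om -> T)
    (D : set Om) (f : Om -> \bar R) : measurable D ->
  (forall y, measurable [set w | X w = y]) -> measurable_fun D f ->
  (forall w, (0 <= f w)%E) ->
  (\int[P]_(w in D) f w = \sum_(y : T) \int[P]_(w in D `&` [set w | X w = y]) f w)%E.
Proof.
move=> mD mX mf f0; have mDX y : measurable (D `&` [set w | X w = y]) by exact: measurableI.
transitivity (\int[P]_(w in D) \sum_(y : T) (f \_ [set w | X w = y]) w)%E.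
  apply: eq_integral => w _; rewrite (bigD1 (X w))//= big1 ?adde0.
    by rewrite patchE mem_set.
  by move=> y yX; rewrite patchE memNset//= => e; rewrite e eqxx in yX.
rewrite ge0_integral_sum//; first by apply: eq_bigr => y _; rewrite integral_mkcondr.
- move=> y; apply/(measurable_restrict f (mX y) mD).
  by apply: measurable_funS mf => //; exact: subIsetr.
- by move=> y w _; exact: erestrict_ge0.
Qed.

Section HittingTime.
Context {R : realType} {T : finType} {d : measure_display} {Om : measurableType d}.
Variable P : probability Om R.
Variables (pm : T -> T -> R) (lam : T -> R) (x0 : T).
Variables (xi : nat -> Om -> T) (h : nat -> Om -> R).
Hypothesis JP : jump_process P pm lam x0 xi h.
Hypothesis lam_gt0 : forall x, 0 < lam x.
Variable b : T.

(** The mean of the k-th holding time of the chain started at y on the event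
    that b is not among its first k.+1 states, when y is not b. *)
Fixpoint survival_time k y : R :=
  if k is k'.+1 then \sum_(z | z != b) pm y z * survival_time k' z else (lam y)^-1.

Let surv n k := [set w | forall i, (n < i <= n + k)%N -> xi i w != b].

Let mxib i : measurable [set w | xi i w != b] :=
  measurable_pred (predC1 b) (jump_process_chain JP i).

Let msurv n k : measurable (surv n k).
Proof.
by apply: (@bigcap_measurableType _ _ (fun i => [set w | xi i w != b])
  [set i | (n < i <= n + k)%N]) => i _.
Qed.

Let mh k D : measurable_fun D (fun w => (h k w)%:E).
Proof. by apply/measurable_EFinP; apply: measurable_funTS; exact: (jump_process_time JP). Qed.

Let h_ge0 k w : (0 <= (h k w)%:E)%E.
Proof. by rewrite lee_fin ltW//; exact: (jump_process_gt0 JP). Qed.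

Let integral_surv n k x :
  (\int[P]_(w in word xi n x `&` surv n k) (h (n + k) w)%:E =
   (word_proba pm x0 n x * survival_time k (x n))%:E)%E.
Proof.
elim: k n x => [|k ih] n x /=.
  rewrite (_ : _ `&` _ = word xi n x); first by rewrite addn0 (expectation_time JP).
  apply/seteqP; split=> w; first by case.
  move=> xw; split=> // i; rewrite addn0 => /andP[/leq_trans ni /ni].
  by rewrite ltnn.
rewrite (@ge0_integral_fin_partition _ _ _ P _ (xi n.+1))//; last 2 first.
- by apply: measurableI => //; exact: (measurable_word JP).
- exact: (jump_process_chain JP).
rewrite mulr_sumr -sumEFin [RHS]big_mkcond/=; apply: eq_bigr => y _.
case: ifPn => [yb|/negPn/eqP yb]; last first.
  rewrite (_ : _ `&` _ = set0) ?integral_set0//; apply/seteqP; split=> w //= [[_ sw] wy].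
  by have := sw n.+1; rewrite ltnSn addnS ltnS leq_addr wy yb eqxx => /(_ isT).
rewrite (_ : _ `&` _ = word xi n.+1 (extend n x y) `&` surv n.+1 k).
  by rewrite addnS -addSn ih word_proba_extend /extend ltnn mulrA.
rewrite word_extend; apply/seteqP; split=> w /=.
  move=> [[xw sw] wy]; split; first by split.
  by move=> i /andP[ni ik]; apply: sw; rewrite ltnW//= addnS -addSn.
move=> [[xw wy] sw]; split=> //; split=> // i /andP[].
rewrite leq_eqVlt => /predU1P[<-|ni ik]; first by rewrite wy.
by apply: sw; rewrite ni/= addSn -addnS.
Qed.

Let alive k := [set w | forall i, (i <= k)%N -> xi i w != b].

Let malive k : measurable (alive k).
Proof. exact: (measurable_forall_le k mxib). Qed.

Let integral_alive k : x0 != b ->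
  (\int[P]_(w in alive k) (h k w)%:E = (survival_time k x0)%:E)%E.
Proof.
move=> x0b; rewrite (@ge0_integral_fin_partition _ _ _ P _ (xi 0%N))//; last first.
  exact: (jump_process_chain JP).
have E y : y != b -> alive k `&` [set w | xi 0%N w = y] = word xi 0 (fun=> y) `&` surv 0 k.
  move=> yb; apply/seteqP; split=> w /=.
    move=> [aw wy]; split=> [i|i /andP[_]]; last exact: aw.
    by rewrite leqn0 => /eqP ->.
  move=> [wy sw]; split; last exact: wy.
  by move=> [|i] ik; [rewrite wy|apply: sw].
rewrite (bigD1 x0)//= E// integral_surv /word_proba eqxx big_ord0 !mul1r.
rewrite big1 ?adde0// => y yx.
have [yb|yb] := eqVneq y b.
  rewrite (_ : _ `&` _ = set0) ?integral_set0//; apply/seteqP; split=> w //= [aw wy].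
  by have := aw 0%N isT; rewrite wy yb eqxx.
by rewrite E// integral_surv /word_proba (negPf yx) !mul0r.
Qed.

Let hitting_series (f : R -> T) w : divergent (h ^~ w) ->
  follows f (xi ^~ w) (h ^~ w) ->
  hitting_time [set b] f = (\sum_(0 <= k <oo) ((fun v => (h k v)%:E) \_ (alive k)) w)%E.
Proof.
move=> hoo fw; have h0 i : 0 < h i w by exact: (jump_process_gt0 JP).
have inP t : 0 <= t -> f t = b -> exists2 n, xi n w = b & jump_time (h ^~ w) n <= t.
  move=> t0 ftb; have [n tn] := jump_time_itv h0 hoo t0.
  by exists n; [rewrite -(fw n t tn)|case/andP: tn].
have partial n : (forall i, (i < n)%N -> xi i w != b) ->
    (\sum_(0 <= k < n) ((fun v => (h k v)%:E) \_ (alive k)) w)%E = (jump_time (h ^~ w) n)%:E.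
  move=> nb; rewrite /jump_time -sumEFin big_mkord; apply: eq_bigr => i _.
  rewrite patchE mem_set// => j ji; apply: nb.
  exact: leq_ltn_trans ji _.
have terms_ge0 k : (0 <= ((fun v => (h k v)%:E) \_ (alive k)) w)%E.
  exact: erestrict_ge0.
have [[m bm]|nb] := pselect (exists m, xi m w == b).
  have hb : exists m, xi m w == b by exists m.
  have [n /eqP bn nP] := find_ex_minn hb.
  have nbn i : (i < n)%N -> xi i w != b.
    by move=> ni; apply/negP => /nP; rewrite leqNgt ni.
  transitivity (jump_time (h ^~ w) n)%:E.
    apply/eqP; rewrite eq_le; apply/andP; split.
      apply: ereal_inf_lbound; exists (jump_time (h ^~ w) n) => //=.
      split; first exact: jump_time_ge0.
      by rewrite (fw n)// lexx jump_timeS ltrDl h0.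
    apply: le_ereal_inf_tmp => _ [t [t0 ftb] <-]; rewrite lee_fin.
    have [j bj] := inP t t0 ftb; apply: le_trans; apply: jump_time_le => //.
    by apply: nP; rewrite bj.
  rewrite -partial//; apply/esym/cvg_lim => //; apply: cvg_near_cst; near=> N.
  have nN : (n <= N)%N by near: N; exact: nbhs_infty_ge.
  rewrite (big_cat_nat (leq0n n) nN)//= [X in (_ + X)%E]big1_seq ?adde0// => k.
  rewrite mem_index_iota => /andP[_ /andP[nk _]].
  by rewrite patchE memNset//= => /(_ n nk); rewrite bn eqxx.
have nb' i : xi i w != b by apply/negP => bi; apply: nb; exists i.
rewrite (_ : hitting_time _ _ = +oo%E); last first.
  rewrite /hitting_time (_ : [set _ | _ in _] = set0) ?ereal_inf0//.
  apply/seteqP; split=> // v [t [t0 ftb] _]; have [j /eqP] := inP t t0 ftb.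
  by rewrite (negPf (nb' j)).
apply/esym/eqyP => A A0; have [n An] := hoo A.
apply: (@le_trans _ _ (jump_time (h ^~ w) n)%:E); first by rewrite lee_fin ltW.
rewrite -partial//; apply: nneseries_lim_ge => k _ _; exact: terms_ge0.
Unshelve. all: by end_near. Qed.

(** The hitting time is the sum of the holding times before the first visit
    to b. *)
Lemma integral_hitting_time (X : Om -> R -> T) (N : set Om) (u : R) : x0 != b ->
  measurable N -> P N = 0%E ->
  (forall w, ~ N w -> divergent (h ^~ w) /\ follows (X w) (xi ^~ w) (h ^~ w)) ->
  \sum_(0 <= k < n) survival_time k x0 @[n --> \oo] --> u ->
  (\int[P]_w hitting_time [set b] (X w) = u%:E)%E.
Proof.
move=> x0b mN PN NX su.
rewrite (ge0_integral_eq_off_null mN PN (g := fun w =>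
   (\sum_(0 <= k <oo) ((fun v => (h k v)%:E) \_ (alive k)) w)%E)); last 3 first.
- by move=> w; apply: le_ereal_inf_tmp => _ [t [t0 _] <-]; rewrite lee_fin.
- by move=> w; apply: nneseries_ge0 => k _ _; exact: erestrict_ge0.
- by move=> w /NX[w1 w2]; exact: hitting_series.
rewrite integral_nneseries//; last 2 first.
- by move=> k; apply/(measurable_restrictT _ _).1 => //; exact: mh.
- by move=> k w _; exact: erestrict_ge0.
rewrite (eq_eseriesr (g := fun k => (survival_time k x0)%:E)); last first.
  by move=> k _; rewrite -integral_mkcond integral_alive.
apply/cvg_lim => //; under eq_fun do rewrite sumEFin.
by apply/fine_cvgP; split => //; near=> n.
Unshelve. all: by end_near. Qed.

End HittingTime.

(** The partial sums are value iterates for the cost 1 / [holding_rate]. *)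
Lemma survival_time_cvg (R : realType) (T : finType) (r : T -> T -> R) (b : T)
    (u : T -> R) (y : T) :
  (forall y z, 0 <= r y z) -> (forall y z, connect [rel y z | 0 < r y z] y z) ->
  (forall x, 0 < holding_rate r x) -> u b = 0 ->
  (forall y, y != b -> generator r u y = -1) -> y != b ->
  \sum_(0 <= k < n) survival_time (jump_proba r) (holding_rate r) b k y
    @[n --> \oo] --> u y.
Proof.
move=> r_ge0 r_irr hr_gt0 ub Lu yb.
pose vi := value_iteration r (pred1 b) (fun=> 0) (fun y => (holding_rate r y)^-1).
have viE N z : z != b -> \sum_(0 <= k < N)
    survival_time (jump_proba r) (holding_rate r) b k z = vi N z.
  elim: N z => [|N ih] z zb; first by rewrite big_geq// /vi/= (negPf zb).
  rewrite big_nat_recl//= (negPf zb); congr (_ + _).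
  rewrite exchange_big/= [RHS](bigD1 b)//=.
  rewrite [X in X + _](_ : _ = 0); last by case: N {ih} => /=; rewrite eqxx mulr0.
  by rewrite add0r; apply: eq_bigr => v vb; rewrite -mulr_sumr ih.
under eq_fun do rewrite viE//.
apply: (@value_iteration_cvg _ _ r r_ge0 r_irr hr_gt0 (pred1 b) b) => //=.
- by move=> z; rewrite invr_ge0 ltW.
- by move=> z /eqP ->.
- by move=> z zb; rewrite Lu// divff// gt_eqF.
Qed.

(** * Blocks of self-loops *)

Section BlockWords.
Variables (T : eqType) (x : nat -> T) (m : nat -> nat).

Definition block_start k := (\sum_(i < k) (m i).+1)%N.

(** The word made of m 0 + 1 letters x 0, then m 1 + 1 letters x 1, and so
    on. *)
Fixpoint block_word n j : T :=
  if n is n'.+1 then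
    if (j < block_start n)%N then block_word n' j else x n
  else x 0%N.

Lemma block_startS k : block_start k.+1 = (block_start k + (m k).+1)%N.
Proof. by rewrite /block_start big_ord_recr. Qed.

Lemma block_start0 : block_start 0 = 0%N.
Proof. by rewrite /block_start big_ord0. Qed.

Lemma block_start_le i j : (i <= j)%N -> (block_start i <= block_start j)%N.
Proof.
move=> /subnK <-; elim: (j - i)%N => // k ih.
by rewrite addSn block_startS; apply: leq_trans ih _; exact: leq_addr.
Qed.

Lemma block_start_in n i j : (i <= n)%N -> (j < block_start i.+1)%N ->
  (j <= block_start n + m n)%N.
Proof.
move=> ni ji; have := leq_trans ji (block_start_le (ni : (i.+1 <= n.+1)%N)).
by rewrite block_startS addnS ltnS.
Qed.

Lemma block_wordE n i j : (i <= n)%N -> (block_start i <= j < block_start i.+1)%N ->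
  block_word n j = x i.
Proof.
elim: n => [|n ih]; first by rewrite leqn0 => /eqP ->.
rewrite leq_eqVlt ltnS => /predU1P[->|ni] /andP[ij ji] /=; first by rewrite ltnNge ij.
by rewrite (leq_trans ji)/= ?ih ?ij//; exact: block_start_le.
Qed.

End BlockWords.

Section Blocks.
Context {R : realType} {T : finType} {d : measure_display} {Om : measurableType d}.
Variable P : probability Om R.
Variables (pm : T -> T -> R) (lam : T -> R) (x0 : T).
Variables (xi : nat -> Om -> T) (h : nat -> Om -> R).
Hypothesis JP : jump_process P pm lam x0 xi h.
Hypothesis lam_gt0 : forall x, 0 < lam x.
Hypothesis pm_sum : forall x, \sum_y pm x y = 1.

Lemma word_proba_block (x : nat -> T) (m : nat -> nat) n :
  word_proba pm x0 (block_start m n + m n) (block_word x m n) =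
  (x 0%N == x0)%:R * (\prod_(i < n.+1) pm (x i) (x i) ^+ m i *
    \prod_(i < n) pm (x i) (x i.+1)).
Proof.
elim: n => [|n ih].
  rewrite block_start0 add0n big_ord1 big_ord0 mulr1 /word_proba; congr (_ * _).
  by rewrite /= (eq_bigr (fun=> pm (x 0%N) (x 0%N)))// prodr_const card_ord.
set M := (block_start m n + m n)%N in ih *.
have SM : block_start m n.+1 = M.+1 by rewrite block_startS addnS.
have zM j : (j <= M)%N -> block_word x m n.+1 j = block_word x m n j.
  by rewrite /= SM ltnS => ->.
have zN j : (M < j)%N -> block_word x m n.+1 j = x n.+1.
  by move=> Mj; rewrite /= SM ltnS leqNgt Mj.
rewrite SM /word_proba zM// addSn.
have -> : \prod_(i < (M + m n.+1).+1)
    pm (block_word x m n.+1 i) (block_word x m n.+1 i.+1) =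
    (\prod_(i < M) pm (block_word x m n i) (block_word x m n i.+1)) *
    (pm (x n) (x n.+1) * pm (x n.+1) (x n.+1) ^+ m n.+1).
  rewrite -(big_mkord xpredT (fun i => pm (block_word x m n.+1 i) (block_word x m n.+1 i.+1))).
  rewrite (@big_cat_nat _ _ _ M)//=; last by rewrite -addnS leq_addr.
  rewrite big_mkord; congr (_ * _).
    by apply: eq_bigr => i _; rewrite -!/(block_word x m n.+1 _) !zM// ltnW.
  rewrite big_ltn ?ltnS ?leq_addr// -!/(block_word x m n.+1 _) zM// zN//; congr (pm _ _ * _).
    by apply: block_wordE => //; rewrite leq_addr block_startS addnS ltnSn.
  rewrite big_add1/= -{1}[M]add0n big_addn.
  rewrite (eq_bigr (fun=> pm (x n.+1) (x n.+1))); last first.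
    by move=> i _; rewrite -!/(block_word x m n.+1 _) !zN// ?ltnS -?addSn leq_addl.
  by rewrite prodr_const_nat subn0 addnC addnK.
move: ih; rewrite /word_proba => /(congr1 (fun v => v * (pm (x n) (x n.+1) * pm (x n.+1) (x n.+1) ^+ m n.+1))).
move=> E; rewrite mulrA E; rewrite [in RHS]big_ord_recr/= [X in _ = _ * (_ * X)]big_ord_recr/=.
by ring.
Qed.

(** The first n.+1 sojourns, with their self-loops merged, are in the states
    x with m i self-loops, and each lasts m i + 1 mean times up to an error
    e. *)
Definition block_event (n : nat) (x : nat -> T) (m : nat -> nat) (e : R) : set Om :=
  let M := (block_start m n + m n)%N in
  word xi M (block_word x m n) `&` [set w | xi M.+1 w != x n] `&`
  [set w | forall i, (i <= n)%N ->
    `|\sum_(block_start m i <= j < block_start m i.+1) (h j w - (lam (x i))^-1)| < e].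

Let mxi n y : measurable [set w | xi n w = y]. Proof. exact: (jump_process_chain JP). Qed.

Let mxin n y : measurable [set w | xi n w != y] := measurable_pred (predC1 y) (mxi n).

Lemma measurable_block_event n (x : nat -> T) (m : nat -> nat) e : measurable (block_event n x m e).
Proof.
apply: measurableI; last first.
  apply: (@measurable_forall_le _ _ (fun i => [set w |
    `|\sum_(block_start m i <= j < block_start m i.+1) (h j w - (lam (x i))^-1)| < e])) => i.
  rewrite (_ : [set w | _] = ~` [set w | e <=
      `|\sum_(block_start m i <= j < block_start m i.+1) (h j w - (lam (x i))^-1)|]).
    exact/measurableC/(measurable_deviation JP).
  by apply/seteqP; split=> w /=; rewrite ltNge => /negP.
by apply: measurableI => //; exact: (measurable_word JP).
Qed.

(** Split according to the state which ends the last sojourn, and apply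
    Chebyshev's inequality to each block. *)
Lemma block_event_ge n (x : nat -> T) (m : nat -> nat) e : 0 < e ->
  (((x 0%N == x0)%:R * (\prod_(i < n.+1) pm (x i) (x i) ^+ m i *
    \prod_(i < n) pm (x i) (x i.+1)) * (1 - pm (x n) (x n)) *
    (1 - \sum_(i < n.+1) 3 / e ^+ 2 * ((m i).+1%:R / lam (x i) ^+ 2)))%:E
   <= P (block_event n x m e))%E.
Proof.
move=> e0; set M := (block_start m n + m n)%N; rewrite -word_proba_block -/M.
set z := block_word x m n; set wp := word_proba _ _ _ _.
pose v := \sum_(i < n.+1) 3 / e ^+ 2 * ((m i).+1%:R / lam (x i) ^+ 2).
rewrite (measure_fin_partition P (measurable_block_event n x m e) (mxi M.+1)).
have -> : 1 - pm (x n) (x n) = \sum_(y | y != x n) pm (x n) y.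
  by rewrite -(pm_sum (x n)) (bigD1 (x n))//= addrAC subrr add0r.
rewrite mulr_sumr mulr_suml -sumEFin [leLHS]big_mkcond/=.
apply: lee_sum => y _; case: ifPn => // yx.
have zn : z M = x n.
  by apply: block_wordE => //; rewrite leq_addr block_startS addnS ltnSn.
pose z' := extend M z y.
have wpE : word_proba pm x0 M.+1 z' = wp * pm (x n) y by rewrite word_proba_extend zn.
have z'E i j : (i <= n)%N -> (block_start m i <= j < block_start m i.+1)%N -> z' j = x i.
  move=> ni /andP[ij ji]; rewrite /z' /extend ifT; first by apply: block_wordE => //; rewrite ij.
  exact: block_start_in ni ji.
pose bad i := word xi M.+1 z' `&` [set w |
  e <= `|\sum_(block_start m i <= j < block_start m i.+1) (h j w - (lam (z' j))^-1)|].
have mbad i : measurable (bad i).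
  apply: measurableI; first exact: (measurable_word JP).
  exact: (measurable_deviation JP).
have badE i : (i <= n)%N ->
    (P (bad i) <= (wp * pm (x n) y * (3 / e ^+ 2 * ((m i).+1%:R / lam (x i) ^+ 2)))%:E)%E.
  move=> ni; rewrite -wpE; apply: le_trans.
    apply: (chebyshev_word JP lam_gt0 z' (block_start m i) _ e0).
    by apply: leq_trans (block_start_le m (ni : (i.+1 <= n.+1)%N)) _; rewrite block_startS addnS.
  rewrite lee_fin ler_wpM2l ?(word_proba_ge0 JP)// ler_wpM2l ?divr_ge0 ?exprn_ge0 ?(ltW e0)//.
  rewrite (eq_big_nat _ _ (F2 := fun=> (lam (x i)) ^- 2)); last first.
    by move=> j ij; rewrite (z'E i).
  by rewrite sumr_const_nat block_startS addnC addnK mulr_natl.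
have cover : word xi M.+1 z' `<=`
    (block_event n x m e `&` [set w | xi M.+1 w = y]) `|` \big[setU/set0]_(i < n.+1) bad i.
  move=> w zw; have [good|] := pselect (forall i, (i <= n)%N ->
      `|\sum_(block_start m i <= j < block_start m i.+1) (h j w - (lam (x i))^-1)| < e).
    left; have xM : xi M.+1 w = y by rewrite zw// /z' /extend ltnn.
    split=> //; split=> //; split; last by rewrite /= xM.
    by move=> i iM; rewrite zw ?leqW// /z' /extend iM.
  move=> /existsNP[i /not_implyP[ni /negP]]; rewrite -leNgt => ei; right.
  rewrite -bigcup_mkord; exists i => //; split=> //=.
  by rewrite (eq_big_nat _ _ (F2 := fun j => h j w - (lam (x i))^-1))// => j ij; rewrite (z'E i).
have mB : measurable (block_event n x m e `&` [set w | xi M.+1 w = y]).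
  by apply: measurableI => //; exact: measurable_block_event.
have mbads : measurable (\big[setU/set0]_(i < n.+1) bad i) by exact: bigsetU_measurable.
have h1 : ((wp * pm (x n) y)%:E <= P ((block_event n x m e `&` [set w | xi M.+1 w = y])
    `|` \big[setU/set0]_(i < n.+1) bad i))%E.
  rewrite -wpE -(proba_word JP); apply: le_measure; rewrite ?inE//.
    exact: (measurable_word JP).
  exact: measurableU.
have h2 : (P (\big[setU/set0]_(i < n.+1) bad i) <= (wp * pm (x n) y * v)%:E)%E.
  apply: le_trans (measure_bigsetU_le P _ mbad) _.
  rewrite /v mulr_sumr -sumEFin; apply: lee_sum => i _; apply: badE.
  by rewrite -ltnS.
rewrite mulrBr mulr1 EFinB leeBlDr//.
apply: le_trans h1 _; apply: le_trans (measureU2 P mB mbads) _.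
by rewrite leeD2lE ?fin_num_measure.
Qed.

(** When consecutive states differ, the blocks are the maximal runs of equal
    states, so they can be read off the path. *)
Lemma block_event_inj n (x : nat -> T) (m : nat -> nat) e (x' : nat -> T) (m' : nat -> nat) e' w :
  (forall i, (i < n)%N -> x i != x i.+1) -> (forall i, (i < n)%N -> x' i != x' i.+1) ->
  block_event n x m e w -> block_event n x' m' e' w ->
  forall i, (i <= n)%N -> x i = x' i /\ m i = m' i.
Proof.
move=> xS xS' [[zw endw] _] [[zw' endw'] _].
have at_block y k : word xi (block_start k n + k n) (block_word y k n) w ->
    forall i j, (i <= n)%N -> (block_start k i <= j < block_start k i.+1)%N -> xi j w = y i.
  move=> yk i j ni ij; rewrite yk; first exact: block_wordE ij.
  exact: block_start_in ni (andP ij).2.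
have at_end y k : (forall i, (i < n)%N -> y i != y i.+1) ->
    word xi (block_start k n + k n) (block_word y k n) w ->
    xi (block_start k n + k n).+1 w != y n ->
    forall i, (i <= n)%N -> xi (block_start k i.+1) w != y i.
  move=> yS yk yn i; rewrite leq_eqVlt => /predU1P[->|ni]; first by rewrite block_startS addnS.
  rewrite (at_block _ _ yk i.+1) 1?eq_sym ?yS// leqnn/= [X in (_ < X)%N]block_startS.
  by rewrite addnS ltnS leq_addr.
have key i : (i <= n)%N -> block_start m i = block_start m' i ->
    x i = x' i /\ m i = m' i.
  move=> ni sE.
  have in1 k : (block_start k i <= block_start k i < block_start k i.+1)%N.
    by rewrite leqnn block_startS addnS ltnS leq_addr.
  have xx : x i = x' i.
    by rewrite -(at_block _ _ zw i (block_start m i))// -(at_block _ _ zw' i (block_start m' i))// sE.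
  split=> //; case: (ltngtP (m i) (m' i)) => // lt.
    have := at_end _ _ xS zw endw i ni.
    rewrite (at_block _ _ zw' i) ?xx ?eqxx// !block_startS sE leq_addr/=.
    by rewrite ltn_add2l ltnS.
  have := at_end _ _ xS' zw' endw' i ni.
  rewrite (at_block _ _ zw i) ?xx ?eqxx// !block_startS sE leq_addr/=.
  by rewrite ltn_add2l ltnS.
suff H i : (i <= n)%N -> block_start m i = block_start m' i.
  by move=> i ni; apply: key => //; exact: H.
elim: i => [|i ih] ni; first by rewrite !block_start0.
have sE := ih (ltnW ni); have [_ mm] := key i (ltnW ni) sE.
by rewrite !block_startS sE mm.
Qed.

End Blocks.

Section BinsAndBlocks.
Context {R : realType} {T : finType} {d : measure_display} {Om : measurableType d}.
Variable P : probability Om R.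
Variables (pm : T -> T -> R) (lam : T -> R) (x0 : T).
Variables (xi : nat -> Om -> T) (h : nat -> Om -> R).
Hypothesis JP : jump_process P pm lam x0 xi h.

Lemma jump_process_scale c : 0 < c ->
  jump_process P pm (fun x => lam x * c) x0 xi (fun n w => h n w / c).
Proof.
move=> c0; split.
- exact: (jump_process_chain JP).
- by move=> n; apply: measurable_funM => //; exact: (jump_process_time JP).
- by move=> n w; rewrite divr_gt0//; exact: (jump_process_gt0 JP).
- move=> n x s s0; have := jump_process_law JP n x (s := fun i => s i * c).
  move=> /(_ (fun i => mulr_ge0 (s0 i) (ltW c0))).
  rewrite (_ : [set w | _] = [set w | forall i, (i <= n)%N ->
    xi i w = x i /\ s i < h i w / c]); last first.
    apply/seteqP; split=> w E i ni; have [E1 E2] := E i ni; split=> //.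
      by rewrite ltr_pdivlMr.
    by rewrite -ltr_pdivlMr.
  move=> ->; congr (_ * _)%:E; apply: eq_bigr => i _.
  by congr expR; ring.
Qed.

(** The upper bounds are introduced one coordinate at a time, as differences
    of two events with lower bounds only. *)
Lemma proba_bins n (x : nat -> T) (a b : nat -> R) : (forall i, 0 <= a i <= b i) ->
  P [set w | forall i, (i <= n)%N -> xi i w = x i /\ a i < h i w <= b i] =
  (word_proba pm x0 n x * \prod_(i < n.+1)
     (expR (- (lam (x i) * a i)) - expR (- (lam (x i) * b i))))%:E.
Proof.
pose E r (a : nat -> R) := [set w | forall i, (i <= n)%N ->
  xi i w = x i /\ a i < h i w /\ ((i < r)%N -> h i w <= b i)].
have mle i t : measurable [set w | h i w <= t].
  have := jump_process_time JP i measurableT (measurable_itv `]-oo, t]); rewrite setTI.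
  by congr measurable; apply/seteqP; split=> w /=; rewrite in_itv.
have mE r a' : measurable (E r a').
  apply: (@measurable_forall_le _ _ (fun i => [set w | xi i w = x i] `&`
    ([set w | a' i < h i w] `&` [set w | (i < r)%N -> h i w <= b i]))) => i.
  apply: measurableI; first exact: (jump_process_chain JP).
  apply: measurableI; first exact/measurable_gt/(jump_process_time JP).
  case: ltnP => ir; last by rewrite (_ : [set w | _] = setT)//; apply/seteqP; split.
  rewrite (_ : [set w | _] = [set w | h i w <= b i])//.
  by apply/seteqP; split=> w /=; [apply|].
suff H r : (r <= n.+1)%N -> forall a, (forall i, 0 <= a i <= b i) ->
    P (E r a) = (word_proba pm x0 n x * \prod_(i < n.+1)
      (expR (- (lam (x i) * a i)) - (i < r)%:R * expR (- (lam (x i) * b i))))%:E.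
  move=> ab; have := H n.+1 (leqnn _) a ab.
  rewrite (_ : E n.+1 a = [set w | forall i, (i <= n)%N ->
    xi i w = x i /\ a i < h i w <= b i]); last first.
    apply/seteqP; split=> w Ew i ni; have := Ew i ni.
      by move=> [-> [-> /(_ ni) ->]].
    by move=> [-> /andP[-> ->]].
  by move=> ->; congr (_ * _)%:E; apply: eq_bigr => i _; rewrite ltn_ord mul1r.
move=> {a} rn a ab; elim: r rn a ab => [|r ih] rn a ab.
  rewrite (_ : E 0%N a = cylinder xi h n x a).
    rewrite (jump_process_law JP); last by move=> i; have /andP[] := ab i.
    by congr (_ * _)%:E; apply: eq_bigr => i _; rewrite mul0r subr0.
  apply/seteqP; split=> w Ew i ni; have := Ew i ni; first by move=> [-> [->]].
  by move=> [-> ->].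
pose a' i := if i == r then b r else a i.
have a'b i : 0 <= a' i <= b i.
  rewrite /a'; case: eqP => [->|//]; rewrite lexx andbT.
  by have /andP[/le_trans] := ab r; apply.
have EE : E r a = E r.+1 a `|` E r a'.
  apply/seteqP; split=> w.
    move=> Ew; have [hb|hb] := leP (h r w) (b r); [left|right] => i ni;
      have [E1 [E2 E3]] := Ew i ni.
      split=> //; split=> //; rewrite ltnS leq_eqVlt => /predU1P[->//|]; exact: E3.
    by split=> //; split=> //; rewrite /a'; case: eqP => [->|].
  move=> [] Ew i ni; have [E1 [E2 E3]] := Ew i ni; split=> //; split=> //.
    by move=> ir; apply: E3; exact: leqW.
  move: E2; rewrite /a'; case: eqP => [->|//]; apply: le_lt_trans.
  by have /andP[] := ab r.
have disj : E r.+1 a `&` E r a' = set0.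
  apply/seteqP; split=> w //= [Ew Ew']; have [_ [_ /(_ (ltnSn r))]] := Ew r rn.
  by have [_ [+ _]] := Ew' r rn; rewrite /a' eqxx leNgt => ->.
have : (P (E r a) = P (E r.+1 a) + P (E r a'))%E by rewrite -measureU// EE.
rewrite (ih (ltnW rn) a ab) (ih (ltnW rn) a' a'b); set X := P (E r.+1 a) => XE.
have Xfin : X \is a fin_num by exact: fin_num_measure.
move: XE; rewrite -(fineK Xfin) -EFinD => -[XE]; congr EFin.
have -> : fine X = word_proba pm x0 n x * \prod_(i < n.+1)
      (expR (- (lam (x i) * a i)) - (i < r)%:R * expR (- (lam (x i) * b i))) -
   word_proba pm x0 n x * \prod_(i < n.+1)
      (expR (- (lam (x i) * a' i)) - (i < r)%:R * expR (- (lam (x i) * b i))).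
  by rewrite XE addrK.
rewrite -mulrBr; congr (_ * _).
have pull (F : 'I_n.+1 -> R) :
    \prod_i F i = F (Ordinal rn) * \prod_(i | i != Ordinal rn) F i.
  by rewrite (bigD1 (Ordinal rn)).
rewrite [X in X - _ = _]pull [X in _ - X = _]pull [RHS]pull /= /a' eqxx ltnn ltnSn.
rewrite !mul0r !subr0 mul1r.
have rest : \prod_(i < n.+1 | i != Ordinal rn)
    (expR (- (lam (x i) * (if i == r :> nat then b r else a i))) - (i < r)%:R * expR (- (lam (x i) * b i))) =
  \prod_(i < n.+1 | i != Ordinal rn)
    (expR (- (lam (x i) * a i)) - (i < r)%:R * expR (- (lam (x i) * b i))).
  by apply: eq_bigr => i; rewrite -val_eqE/= => /negPf ->.
have rest' : \prod_(i < n.+1 | i != Ordinal rn)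
    (expR (- (lam (x i) * a i)) - (i < r.+1)%:R * expR (- (lam (x i) * b i))) =
  \prod_(i < n.+1 | i != Ordinal rn)
    (expR (- (lam (x i) * a i)) - (i < r)%:R * expR (- (lam (x i) * b i))).
  by apply: eq_bigr => i; rewrite -val_eqE/= => ir; rewrite ltnS leq_eqVlt (negPf ir).
by rewrite rest rest' -mulrBl.
Qed.

(** The length of a sojourn is within dt of m i + 1 mean times, which are in
    the interval k i; hence the tolerance in [cell]. *)
Lemma block_event_cell n (x : nat -> T) (m k : nat -> nat) dt w (Y : skorokhod R T) :
  (forall y, 0 < lam y) -> 0 < dt ->
  (forall i, (i <= n)%N -> (k i)%:R * dt <= (m i).+1%:R / lam (x i) <= (k i).+1%:R * dt) ->
  block_event lam xi h n x m dt w -> follows Y (xi ^~ w) (h ^~ w) ->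
  cell (fun i : 'I_n.+1 => (x i, k i)) dt Y.
Proof.
move=> lam_gt0 dt0 km [[zw _] dev] Yw.
have h0 i : 0 < h i w by exact: (jump_process_gt0 JP).
exists (fun i => jump_time (h ^~ w) (block_start m i)).
  by rewrite block_start0 jump_time0.
move=> i; have ni : (i <= n)%N by rewrite -ltnS.
have JE : jump_time (h ^~ w) (block_start m i.+1) - jump_time (h ^~ w) (block_start m i) =
    \sum_(block_start m i <= j < block_start m i.+1) h j w.
  rewrite /jump_time -!(big_mkord xpredT (h ^~ w)).
  rewrite (@big_cat_nat _ _ _ (block_start m i) 0 (block_start m i.+1))//=.
    by rewrite addrAC subrr add0r.
  exact: block_start_le.
have sz : (block_start m i.+1 - block_start m i = (m i).+1)%N by rewrite block_startS addnC addnK.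
split.
- apply: (@lt_le_trans _ _ (jump_time (h ^~ w) (block_start m i).+1)).
    by rewrite jump_timeS ltrDl.
  by apply: jump_time_le => //; rewrite block_startS addnS ltnS leq_addr.
- rewrite JE; have := dev i ni; rewrite sumrB sumr_const_nat sz -[_ *+ _]mulr_natl.
  rewrite ltr_norml => /andP[d1 d2]; have /andP[] := km i ni; rewrite -[(k i).+1%:R]natr1 /=.
  by move: d1 d2; set S := \sum_(_ <= _ < _) _; set q := _ / _ => d1 d2 q1 q2; apply/andP; split; lra.
- move=> t /andP[t1 t2].
  have hm : exists j, t < jump_time (h ^~ w) j by exists (block_start m i.+1).
  have [j tj jP] := find_ex_minn hm.
  case: j tj jP => [|j] tj jP.
    have := le_lt_trans t1 tj; rewrite jump_time0 ltNge.
    by rewrite jump_time_ge0.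
  have jt : jump_time (h ^~ w) j <= t.
    by rewrite leNgt; apply/negP => /jP; rewrite ltnn.
  have ij : (block_start m i <= j)%N.
    rewrite leqNgt; apply/negP => ji.
    by have := lt_le_trans tj (jump_time_le h0 ji); rewrite ltNge t1.
  have ji : (j < block_start m i.+1)%N by exact: jP.
  rewrite (Yw j t) ?jt ?tj// zw.
    by apply: block_wordE => //; rewrite ij ji.
  exact: block_start_in ni ji.
Qed.

End BinsAndBlocks.

Lemma geometric_range (R : realType) (p : R) (A B : nat) : p < 1 -> (A <= B)%N ->
  \sum_(A <= j < B) p ^+ j = (p ^+ A - p ^+ B) / (1 - p).
Proof.
move=> p1 AB; have p0 : 1 - p != 0 by rewrite subr_eq0 gt_eqF.
apply: (mulIf p0); rewrite divfK//.
rewrite mulr_suml (eq_bigr (fun j => - p ^+ j.+1 - - p ^+ j)); last first.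
  by move=> j _; rewrite exprS; ring.
by rewrite (telescope_sumr (fun j => - p ^+ j) AB) opprK addrC.
Qed.

Section BlockSum.
Context {R : realType} {T : finType} {d : measure_display} {Om : measurableType d}.
Variable P : probability Om R.
Variables (pm : T -> T -> R) (lam : T -> R) (x0 : T).
Variables (xi : nat -> Om -> T) (h : nat -> Om -> R).
Hypothesis JP : jump_process P pm lam x0 xi h.
Hypothesis lam_gt0 : forall x, 0 < lam x.
Hypothesis pm_ge0 : forall x y, 0 <= pm x y.
Hypothesis pm_sum : forall x, \sum_y pm x y = 1.
Hypothesis pm_diag : forall x, pm x x < 1.

(** The sum over the numbers of self-loops factorizes into geometric sums. *)
Lemma block_event_sum_ge n (x : nat -> T) (A B : nat -> nat) (K : nat) e : 0 < e ->
  (forall i, (A i <= B i <= K)%N) ->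
  (((x 0%N == x0)%:R *
    (\prod_(i < n.+1) (pm (x i) (x i) ^+ A i - pm (x i) (x i) ^+ B i) *
     \prod_(i < n) (pm (x i) (x i.+1) / (1 - pm (x i) (x i)))) *
    (1 - \sum_(i < n.+1) 3 / e ^+ 2 * ((B i)%:R / lam (x i) ^+ 2)))%:E
   <= \sum_(m in family (fun i : 'I_n.+1 => [pred j : 'I_K | (A i <= j < B i)%N]))
        P (block_event lam xi h n x (fun i => m (inord i)) e))%E.
Proof.
move=> e0 AB; set eps := \sum_(i < n.+1) _.
set rhs := (X in (_ <= X)%E).
have diag0 y : 0 < 1 - pm y y by rewrite subr_gt0.
have -> : (x 0%N == x0)%:R *
    (\prod_(i < n.+1) (pm (x i) (x i) ^+ A i - pm (x i) (x i) ^+ B i) *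
     \prod_(i < n) (pm (x i) (x i.+1) / (1 - pm (x i) (x i)))) * (1 - eps) =
  \sum_(m in family (fun i : 'I_n.+1 => [pred j : 'I_K | (A i <= j < B i)%N]))
   ((x 0%N == x0)%:R * (\prod_(i < n.+1) pm (x i) (x i) ^+ m i *
     \prod_(i < n) pm (x i) (x i.+1)) * (1 - pm (x n) (x n)) * (1 - eps)).
  rewrite -mulr_suml -mulr_suml -mulr_sumr -mulr_suml; congr (_ * _).
  rewrite -(bigA_distr_big_dep (fun (i : 'I_n.+1) (j : 'I_K) => (A i <= j < B i)%N)
    (fun i j => pm (x i) (x i) ^+ j)).
  have -> : \prod_(i < n.+1) \sum_(j < K | (A i <= j < B i)%N) pm (x i) (x i) ^+ j =
      \prod_(i < n.+1) ((pm (x i) (x i) ^+ A i - pm (x i) (x i) ^+ B i) / (1 - pm (x i) (x i))).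
    apply: eq_bigr => i _; have /andP[AiBi BiK] := AB i.
    rewrite -geometric_range// -(big_mkord (fun j => (A i <= j < B i)%N) (fun j => pm (x i) (x i) ^+ j)).
    rewrite [RHS](big_nat_widen _ _ K)// [RHS](big_nat_widenl _ 0)//.
    by apply: eq_bigl => j; rewrite andTb andbC.
  rewrite !big_split/= [in RHS]big_ord_recr/= [X in _ = _ * (_ * X * _) * _]big_ord_recr/=.
  rewrite [in LHS]big_ord_recr/=.
  by field; rewrite gt_eqF.
rewrite -sumEFin; apply: lee_sum => m /familyP mAB.
have := block_event_ge JP lam_gt0 pm_sum n x (fun i => m (inord i)) e0.
apply: le_trans; rewrite lee_fin.
have -> : \prod_(i < n.+1) pm (x i) (x i) ^+ m (inord i) =
    \prod_(i < n.+1) pm (x i) (x i) ^+ m i.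
  by apply: eq_bigr => i _; rewrite inord_val.
rewrite ler_wpM2l//.
  rewrite !mulr_ge0// ?(ltW (diag0 _))//; apply: prodr_ge0 => i _ //.
  exact: exprn_ge0.
rewrite lerD2l lerN2; apply: ler_sum => i _.
rewrite ler_wpM2l ?divr_ge0 ?exprn_ge0 ?(ltW e0)//.
rewrite ler_wpM2r ?invr_ge0 ?exprn_ge0 ?(ltW (lam_gt0 _))// ler_nat inord_val.
by have := mAB i; rewrite inE/= => /andP[].
Qed.

End BlockSum.

(** With u = 1 - p, the power is squeezed between exponentials by the
    inequalities exp (- u / (1 - u)) <= 1 - u <= exp (- u). *)
Lemma cvg_expr_trunc (R : realType) (p L : R -> R) (l s : R) : 0 <= s ->
  L b @[b --> +oo] --> +oo -> (1 - p b) * L b @[b --> +oo] --> l ->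
  (\forall b \near +oo, 0 <= p b <= 1) ->
  p b ^+ Num.trunc (s * L b) @[b --> +oo] --> expR (- (l * s)).
Proof.
move=> s0 Loo pL p01.
pose u b := 1 - p b; pose m b := Num.trunc (s * L b).
have L0 : \forall b \near +oo, 0 < L b by move/cvgryPgt : Loo; apply.
have Linv : (L b)^-1 @[b --> +oo] --> 0 by apply/gtr0_cvgV0.
have u0 : u b @[b --> +oo] --> 0.
  have : u b * L b * (L b)^-1 @[b --> +oo] --> l * 0 by exact: cvgM.
  rewrite mulr0; apply: cvg_trans; apply: near_eq_cvg; near=> b.
  by rewrite mulfK// gt_eqF//; near: b.
have mu : (m b)%:R * u b @[b --> +oo] --> l * s.
  apply: (@squeeze_cvgr _ _ _ _ (fun b => s * (u b * L b) - u b) (fun b => s * (u b * L b))).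
  - near=> b.
    have Lb : 0 <= s * L b by rewrite mulr_ge0// ltW//; near: b.
    have /andP[_ p1] : 0 <= p b <= 1 by near: b.
    have ub : 0 <= u b by rewrite subr_ge0.
    have /andP[m1 m2] := Num.Theory.truncn_itv Lb.
    rewrite -/(m b) -natr1 in m1 m2.
    by apply/andP; split; nra.
  - rewrite -[X in _ --> X]subr0 [l * s]mulrC; apply: cvgB => //.
    by apply: cvgM => //; exact: cvg_cst.
  - by rewrite [l * s]mulrC; apply: cvgM => //; exact: cvg_cst.
apply: (@squeeze_cvgr _ _ _ _ (fun b => expR (- ((m b)%:R * u b / (1 - u b))))
    (fun b => expR (- ((m b)%:R * u b)))).
- near=> b.
  have /andP[p0 p1] : 0 <= p b <= 1 by near: b.
  have uh : u b < 1 by near: b; apply: (cvgr_lt _ u0).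
  have pp : 0 < p b by move: uh; rewrite /u; lra.
  have pE : p b = 1 - u b by rewrite /u; ring.
  rewrite -/(m b) -mulrA -!mulrN !expRM_natl; apply/andP; split.
    rewrite lerXn2r ?nnegrE ?expR_ge0//.
    rewrite mulrN expRN invf_ple ?posrE ?expR_gt0//.
    apply: le_trans (expR_ge1Dx _); rewrite -pE le_eqVlt; apply/orP; left; apply/eqP.
    by rewrite /u; field; rewrite gt_eqF.
  rewrite lerXn2r ?nnegrE ?expR_ge0//.
  by apply: le_trans (expR_ge1Dx _); rewrite pE.
- apply: continuous_cvg; first exact: continuous_expR.
  rewrite -[l * s]divr1 -[X in _ / X]subr0; apply: cvgN; apply: cvgM => //.
  apply: cvgV; first by rewrite subr0 oner_eq0.
  by apply: cvgB => //; exact: cvg_cst.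
- apply: continuous_cvg; first exact: continuous_expR.
  exact: cvgN.
Unshelve. all: by end_near. Qed.

(** * Continuous functionals of jump paths *)

Section CellInf.
Context {R : realType} {S : finType}.
Variables (F : skorokhod R S -> R) (C : R).
Hypothesis FC : forall f, 0 <= F f <= C.
Hypothesis C0 : 0 <= C.

Definition cell_inf n (c : 'I_n -> S * nat) : R := inf (F @` cell c (mesh n)).

Lemma cell_inf_le n (c : 'I_n -> S * nat) f : cell c (mesh n) f -> cell_inf c <= F f.
Proof.
move=> cf; apply: ge_inf; last by exists f.
by exists 0 => _ [g _ <-]; have /andP[] := FC g.
Qed.

Lemma cell_inf_bounds n (c : 'I_n -> S * nat) : 0 <= cell_inf c <= C.
Proof.
have [[f cf]|none] := pselect (exists f : skorokhod R S, cell c (mesh n) f).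
  rewrite (le_trans (cell_inf_le cf)) ?andbT; last by have /andP[] := FC f.
  apply: lb_le_inf; first by exists (F f), f.
  by move=> _ [g _ <-]; have /andP[] := FC g.
rewrite /cell_inf (_ : _ @` _ = set0) ?inf0 ?lexx//.
by rewrite -subset0 => y [f cf yE]; apply: none; exists f.
Qed.

(** By continuity, since the cells of Y eventually lie in any neighborhood of
    Y. *)
Lemma cell_inf_cvg (Y : skorokhod R S) (x : nat -> S) (h : nat -> R) : continuous F -> (forall i, 0 < h i) -> divergent h ->
  follows Y x h ->
  cell_inf (fun i : 'I_n => (x i, bin (mesh n) (h i))) @[n --> \oo] --> F Y.
Proof.
move=> Fc h0 hoo Yxh; apply/cvgrPdist_le => e e0.
have /(cell_nbhs h0 hoo Yxh) : nbhs Y [set f | `|F Y - F f| <= e].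
  by move/cvgrPdist_le : (Fc Y); apply.
apply: filterS => n cU; have Yc := cell_self n (mesh_gt0 n) h0 Yxh.
have le := cell_inf_le Yc; rewrite ger0_norm ?subr_ge0// lerBlDr addrC -lerBlDr.
apply: lb_le_inf; first by exists (F Y), Y.
move=> _ [f fc <-]; have /= := cU _ fc; rewrite ler_norml => /andP[_]; lra.
Qed.

End CellInf.

Section DisjointSums.
Context {R : realType} {d : measure_display} {Om : measurableType d}.
Variable P : probability Om R.
Variables (I : finType) (Q : pred I) (a : I -> R) (E : I -> set Om).

Lemma sum_indic_disjoint w :
  (forall i j, Q i -> Q j -> E i w -> E j w -> i = j) ->
  (\sum_(i | Q i) a i * \1_(E i) w = 0) \/
  (exists i, [/\ Q i, E i w & \sum_(i | Q i) a i * \1_(E i) w = a i]).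
Proof.
move=> dis; have [[i [Qi Ei]]|none] := pselect (exists i, Q i /\ E i w).
  right; exists i; split=> //; rewrite (bigD1 i)//= indicE mem_set// mulr1.
  rewrite big1 ?addr0// => j /andP[Qj ji]; rewrite indicE memNset ?mulr0//.
  by move=> Ej; move/eqP : ji; apply; exact: dis.
left; rewrite big1// => i Qi; rewrite indicE memNset ?mulr0// => Ei.
by apply: none; exists i.
Qed.

Lemma integral_sum_indic : (forall i, 0 <= a i) -> (forall i, measurable (E i)) ->
  (\int[P]_w (\sum_(i | Q i) a i * \1_(E i) w)%:E = \sum_(i | Q i) (a i)%:E * P (E i))%E.
Proof.
move=> a0 mE.
rewrite -[RHS]big_filter.
under eq_integral do rewrite -sumEFin -big_filter.
rewrite (ge0_integral_sum _ _ (f := fun i w => (a i * \1_(E i) w)%:E))//.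
- apply: eq_bigr => i _; under eq_integral do rewrite EFinM.
  rewrite ge0_integralZl_EFin//; last by apply/measurable_EFinP; exact: measurable_indic.
  by rewrite integral_indic// setIT.
- by move=> i; apply/measurable_EFinP; apply: measurable_funM => //; exact: measurable_indic.
- by move=> i w _; rewrite lee_fin mulr_ge0.
Qed.

(** The indicators of disjoint events, with weights below f on them, have a
    sum below f. *)
Lemma sum_measure_le_integral (f : Om -> R) (N : set Om) :
  (forall i, 0 <= a i) -> (forall i, measurable (E i)) ->
  measurable N -> P N = 0%E -> (forall w, 0 <= f w) ->
  (forall i w, Q i -> ~ N w -> E i w -> a i <= f w) ->
  (forall i j w, Q i -> Q j -> E i w -> E j w -> i = j) ->
  (\sum_(i | Q i) (a i)%:E * P (E i) <= \int[P]_w (f w)%:E)%E.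
Proof.
move=> a0 mE mN PN f0 af dis; rewrite -integral_sum_indic//.
rewrite (ge0_integral_eq_off_null (P := P) (f := fun w => (\sum_(i | Q i) a i * \1_(E i) w)%:E)
  (g := fun w => ((\sum_(i | Q i) a i * \1_(E i) w) * \1_(~` N) w)%:E) mN PN).
- apply: ge0_le_integral_any => w _.
    by rewrite lee_fin mulr_ge0//; apply: sumr_ge0 => i _; rewrite mulr_ge0.
  rewrite lee_fin indicE; have [Nw|Nw] := pselect (N w).
    by rewrite memNset ?mulr0.
  rewrite mem_set// mulr1; case: (sum_indic_disjoint (w := w)) => [i j| ->//|[i [Qi Ei ->]]].
    by move=> ????; exact: (dis i j w).
  exact: (af i).
- by move=> w; rewrite lee_fin; apply: sumr_ge0 => i _; rewrite mulr_ge0.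
- move=> w; rewrite lee_fin mulr_ge0//; apply: sumr_ge0 => i _; rewrite mulr_ge0//.
- by move=> w Nw; rewrite [\1_(~` N) w]indicE mem_set// mulr1.
Qed.

End DisjointSums.

Section PathFunctional.
Context {R : realType} {S : finType} {d : measure_display} {Om : measurableType d}.
Variable P : probability Om R.
Variables (pm : S -> S -> R) (lam : S -> R) (x0 : S).
Variables (xi : nat -> Om -> S) (h : nat -> Om -> R).
Hypothesis JP : jump_process P pm lam x0 xi h.
Variables (Y : Om -> skorokhod R S) (N : set Om).
Hypotheses (mN : measurable N) (PN : P N = 0%E).
Hypothesis dev : forall w, ~ N w -> divergent (h ^~ w).
Hypothesis YP : forall w, ~ N w -> follows (Y w) (xi ^~ w) (h ^~ w).
Variables (F : skorokhod R S -> R) (C : R).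
Hypothesis Fc : continuous F.
Hypothesis FC : forall f, 0 <= F f <= C.
Hypothesis C0 : 0 <= C.

Definition bins n K (c : {ffun 'I_n.+1 -> S * 'I_K}) : 'I_n.+1 -> S * nat :=
  fun i => ((c i).1, nat_of_ord (c i).2).

Definition bins_event n K (c : {ffun 'I_n.+1 -> S * 'I_K}) : set Om :=
  [set w | forall i, (i <= n)%N -> xi i w = (c (inord i)).1 /\
     (c (inord i)).2%:R * mesh n.+1 < h i w <= (c (inord i)).2.+1%:R * mesh n.+1].

Lemma measurable_bins_event n K (c : {ffun 'I_n.+1 -> S * 'I_K}) : measurable (bins_event c).
Proof.
apply: (@measurable_forall_le _ _ (fun i => [set w | xi i w = (c (inord i)).1] `&`
  [set w | (c (inord i)).2%:R * mesh n.+1 < h i w <= (c (inord i)).2.+1%:R * mesh n.+1])) => i.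
apply: measurableI; first exact: (jump_process_chain JP).
have := jump_process_time JP i measurableT
  (measurable_itv `](c (inord i)).2%:R * mesh n.+1, (c (inord i)).2.+1%:R * mesh n.+1]).
by rewrite setTI; congr measurable; apply/seteqP; split=> w /=; rewrite in_itv.
Qed.

Lemma proba_bins_event n K (c : {ffun 'I_n.+1 -> S * 'I_K}) :
  P (bins_event c) = (word_proba pm x0 n (fun i => (c (inord i)).1) * \prod_(i < n.+1)
     (expR (- (lam (c i).1 * ((c i).2%:R * mesh n.+1))) -
      expR (- (lam (c i).1 * ((c i).2.+1%:R * mesh n.+1)))))%:E.
Proof.
rewrite (proba_bins JP); last first.
  move=> i; rewrite mulr_ge0 ?(ltW (mesh_gt0 _))//=.
  by rewrite ler_wpM2r ?(ltW (mesh_gt0 _))// ler_nat.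
by congr (_ * _)%:E; apply: eq_bigr => i _; rewrite inord_val.
Qed.

Lemma bins_event_bin n K (c : {ffun 'I_n.+1 -> S * 'I_K}) w : bins_event c w ->
  bins c = fun i : 'I_n.+1 => (xi i w, bin (mesh n.+1) (h i w)).
Proof.
move=> cw; apply/funext => i; have [] := cw i; first by rewrite -ltnS.
rewrite inord_val /bins => <- /(binP _ (mesh_gt0 _)); move=> -> //.
exact: (jump_process_gt0 JP).
Qed.

Lemma bins_event_inj n K (c c' : {ffun 'I_n.+1 -> S * 'I_K}) w :
  bins_event c w -> bins_event c' w -> c = c'.
Proof.
move=> /bins_event_bin cw /bins_event_bin; rewrite -cw => E; apply/ffunP => i.
have := congr1 (fun f => f i) E; rewrite /bins.
by case: (c i) => u v; case: (c' i) => u' v' /= [-> /val_inj ->].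
Qed.

Let approx n K w := \sum_(c : {ffun 'I_n.+1 -> S * 'I_K})
  cell_inf F (bins c) * \1_(bins_event c) w.

Let G n w := cell_inf F (fun i : 'I_n.+1 => (xi i w, bin (mesh n.+1) (h i w))).

Let approx_le n K w : 0 <= approx n K w <= C.
Proof.
rewrite /approx; case: (@sum_indic_disjoint R d Om _ xpredT (fun c => cell_inf F (bins c))
   (@bins_event n K) w) => [c c' _ _|E|[c [_ _ E]]].
- exact: bins_event_inj.
- by rewrite [X in _ <= X <= _]E lexx.
- by rewrite [X in _ <= X <= _]E; exact: cell_inf_bounds.
Qed.

Let approx_cvg n w : approx n K w @[K --> \oo] --> G n w.
Proof.
apply: cvg_near_cst; near=> K.
have bK : (forall i : 'I_n.+1, (bin (mesh n.+1) (h i w) < K)%N).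
  move=> i; apply: (@leq_ltn_trans (\max_(i < n.+1) bin (mesh n.+1) (h i w))).
    exact: leq_bigmax.
  by near: K; exact: nbhs_infty_gt.
pose c := [ffun i : 'I_n.+1 => (xi i w, Ordinal (bK i))].
have cw : bins_event c w.
  move=> i ni; have iE : inord i = i :> nat := @inordK n i ni.
  rewrite /c ffunE /= iE; split=> //.
  by apply/(binP _ (mesh_gt0 _)); [exact: (jump_process_gt0 JP)|].
rewrite /approx (bigD1 c)//= indicE mem_set// mulr1 big1 ?addr0 ?(bins_event_bin cw)//.
move=> c' c'c; rewrite indicE memNset ?mulr0// => c'w.
by move/eqP : c'c; apply; exact: bins_event_inj c'w cw.
Unshelve. all: by end_near. Qed.

Let mapprox n K : measurable_fun setT (approx n K).
Proof.
apply: measurable_sum => c; apply: measurable_funM => //.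
exact/measurable_indic/measurable_bins_event.
Qed.

Let mG n : measurable_fun setT (G n).
Proof.
apply: (measurable_fun_cvg (h := approx n)) => // w _.
Qed.

Let G_le n w : 0 <= G n w <= C. Proof. exact: cell_inf_bounds. Qed.

Let g w := F (Y w) * \1_(~` N) w.

Let G_cvg w : G n w * \1_(~` N) w @[n --> \oo] --> g w.
Proof.
rewrite /g indicE; have [Nw|Nw] := pselect (N w).
  rewrite memNset ?mulr0; last by apply.
  by under eq_fun do rewrite mulr0; exact: cvg_cst.
rewrite mem_set// mulr1; under eq_fun do rewrite mulr1.
have := cell_inf_cvg FC Fc (fun i => jump_process_gt0 JP i w) (dev Nw) (YP Nw).
by rewrite -cvg_shiftS.
Qed.

Let ind01 w : 0 <= (\1_(~` N) w : R) <= 1.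
Proof. by rewrite indicE; case: (_ \in _); rewrite ?ler01 ?lexx. Qed.

Let mNC : measurable_fun setT (\1_(~` N) : Om -> R).
Proof. exact/measurable_indic/measurableC. Qed.

Let gE w : ~ N w -> g w = F (Y w).
Proof. by move=> Nw; rewrite /g indicE mem_set// mulr1. Qed.

Let gC w : 0 <= g w <= C.
Proof.
have /andP[F0 F1] := FC (Y w); have /andP[i0 i1] := ind01 w.
by rewrite /g mulr_ge0//=; nra.
Qed.

Let mg : measurable_fun setT g.
Proof.
apply: (measurable_fun_cvg (h := fun n w => G n w * \1_(~` N) w)) => [n|w _].
  exact: measurable_funM.
exact: G_cvg.
Qed.

(** Off the null set, F(Y) is the limit of the infima over the cells of Y,
    which take countably many values; so it has an integrable version and its
    expectation is linear. *)
Lemma path_functional : exists g, [/\ measurable_fun setT g,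
  (forall w, ~ N w -> g w = F (Y w)) & (forall w, 0 <= g w <= C)].
Proof. by exists g. Qed.

(** Let first the bound K on the durations, then the number n of sojourns
    tend to infinity, by dominated convergence. *)
Lemma path_functional_approx e : 0 < e -> exists n K,
  (\int[P]_w (F (Y w))%:E <= (\sum_(c : {ffun 'I_n.+1 -> S * 'I_K})
     cell_inf F (bins c) * fine (P (bins_event c)) + e)%:E)%E.
Proof.
move=> e0.
have iC : P.-integrable setT (EFin \o cst C).
  by apply: finite_measure_integrable_cst.
have step1 : (\int[P]_w (G n w * \1_(~` N) w)%:E @[n --> \oo] --> \int[P]_w (g w)%:E)%E.
  apply: (@dominated_cvg _ _ _ P setT measurableT (fun n w => (G n w * \1_(~` N) w)%:E)
     _ (EFin \o cst C)) => //.
  - by move=> n; apply/measurable_EFinP; apply: measurable_funM.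
  - by move=> w _; apply: cvg_EFin; [exact: nearW|exact: G_cvg].
  - move=> n w _ /=; rewrite lee_fin normrM.
    have /andP[i0 i1] := ind01 w; have /andP[G0 G1] := G_le n w.
    rewrite !ger0_norm//; nra.
have step2 n : (\int[P]_w (approx n K w * \1_(~` N) w)%:E @[K --> \oo] -->
    \int[P]_w (G n w * \1_(~` N) w)%:E)%E.
  apply: (@dominated_cvg _ _ _ P setT measurableT (fun K w => (approx n K w * \1_(~` N) w)%:E)
     _ (EFin \o cst C)) => //.
  - by move=> K; apply/measurable_EFinP; apply: measurable_funM.
  - move=> w _; apply: cvg_EFin; first exact: nearW.
    by apply: cvgM; [exact: approx_cvg|exact: cvg_cst].
  - move=> K w _ /=; rewrite lee_fin normrM.
    have /andP[i0 i1] := ind01 w; have /andP[G0 G1] := approx_le n K w.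
    rewrite !ger0_norm//; nra.
have finI (f : Om -> R) : measurable_fun setT f -> (forall w, 0 <= f w <= C) ->
    (\int[P]_w (f w)%:E \is a fin_num)%E.
  move=> mf fC; rewrite ge0_fin_numE; last first.
    by apply: integral_ge0 => w _; rewrite lee_fin; have /andP[] := fC w.
  apply: (@le_lt_trans _ _ (\int[P]_w C%:E)%E).
    by apply: ge0_le_integral_any => w _; rewrite lee_fin; have /andP[] := fC w.
  have -> : (\int[P]_w C%:E = C%:E * P setT)%E by exact: integral_cst.
  by rewrite ltey_eq fin_numM// fin_num_measure.
have bnd (f : Om -> R) : (forall w, 0 <= f w <= C) -> forall w, 0 <= f w * \1_(~` N) w <= C.
  move=> fC w; have /andP[F0 F1] := fC w; have /andP[i0 i1] := ind01 w.
  by rewrite mulr_ge0//= ; nra.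
have intE : (\int[P]_w (F (Y w))%:E = \int[P]_w (g w)%:E)%E.
  by apply: (integral_eq_off_null mN PN) => w Nw; rewrite gE.
have gfin := finI g mg gC.
have Gfin n := finI _ (measurable_funM (mG n) mNC) (bnd _ (G_le n)).
have e20 : 0 < e / 2 by rewrite divr_gt0.
have close (u : nat -> \bar R) (l : \bar R) : l \is a fin_num ->
    u n @[n --> \oo] --> l -> exists n, (l <= u n + (e / 2)%:E)%E.
  move=> lfin; rewrite -(fineK lfin) => /fine_cvgP[ufin /cvgrPdist_le/(_ _ e20) ul].
  near \oo => n; exists n.
  have un : u n \is a fin_num by near: n.
  have : `|fine l - fine (u n)| <= e / 2 by near: n.
  rewrite -(fineK un) ler_norml -EFinD lee_fin => /andP[_]; lra.
have [n n1] := close _ _ gfin step1; have [K K1] := close _ _ (Gfin n) (step2 n).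
exists n, K; rewrite intE; apply: (le_trans n1).
rewrite [X in (_ <= (_ + X)%:E)%E](splitr e) addrA EFinD; apply: leeD2r; apply: (le_trans K1); rewrite EFinD; apply: leeD2r.
apply: (@le_trans _ _ (\int[P]_w (approx n K w)%:E)%E).
  apply: ge0_le_integral_any => w _; rewrite lee_fin.
    by have /andP[] := bnd _ (approx_le n K) w.
  have /andP[i0 i1] := ind01 w; have /andP[a0 _] := approx_le n K w; nra.
rewrite integral_sum_indic; last 2 first.
- by move=> c; have /andP[] := cell_inf_bounds FC C0 (bins c).
- exact: measurable_bins_event.
rewrite -sumEFin; apply: lee_sum => c _.
by rewrite EFinM fineK// fin_num_measure//; exact: measurable_bins_event.
Unshelve. all: by end_near. Qed.

End PathFunctional.

(** * Weak convergence of jump processes *)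

Definition jump_path {R : realType} {S : finType} {d : measure_display}
    {Om : measurableType d} (P : probability Om R) (pm : S -> S -> R) (lam : S -> R)
    (x0 : S) (Y : Om -> skorokhod R S) : Prop :=
  exists xi h N, [/\ jump_process P pm lam x0 xi h, measurable N, P N = 0%E &
    forall w, ~ N w -> divergent (h ^~ w) /\ follows (Y w) (xi ^~ w) (h ^~ w)].

Section BlockCells.
Context {R : realType} {S : finType}.
Variables (F : skorokhod R S -> R) (C : R).
Hypothesis FC : forall f, 0 <= F f <= C.
Hypothesis C0 : 0 <= C.
Variables (n K : nat).
Local Notation dt := (mesh n.+1 : R).
Local Notation cells := {ffun 'I_n.+1 -> S * 'I_K}.
Implicit Types c : cells.

Definition states c (i : nat) : S := (c (inord i)).1.

Definition alternating c : bool := [forall i : 'I_n, states c i != states c i.+1].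

(** A lower bound for the probability that a jump process with self-loops
    falls in the cell c: x i lasts between A i + 1 and B i steps, and the
    last factor accounts for the fluctuations of the durations. *)
Definition cell_weight (pm : S -> S -> R) (lam : S -> R) x0 c : R :=
  let x := states c in
  let A i := Num.trunc ((c (inord i)).2%:R * dt * lam (x i)) in
  let B i := Num.trunc ((c (inord i)).2.+1%:R * dt * lam (x i)) in
  (x 0%N == x0)%:R *
    (\prod_(i < n.+1) (pm (x i) (x i) ^+ A i - pm (x i) (x i) ^+ B i) *
     \prod_(i < n) (pm (x i) (x i.+1) / (1 - pm (x i) (x i)))) *
    (1 - \sum_(i < n.+1) 3 / dt ^+ 2 * ((B i)%:R / lam (x i) ^+ 2)).

(** The block events with consecutive distinct states and lengths in the
    range of the cell are disjoint and contained in the cell, where F is at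
    least its infimum. *)
Lemma sum_cell_weight_le d (Om : measurableType d) (P : probability Om R)
    (pm : S -> S -> R) (lam : S -> R) x0 (Y : Om -> skorokhod R S) :
  (forall y, 0 < lam y) -> (forall y z, 0 <= pm y z) -> (forall y, \sum_z pm y z = 1) ->
  (forall y, pm y y < 1) -> jump_path P pm lam x0 Y ->
  ((\sum_(c | alternating c) cell_inf F (bins c) * cell_weight pm lam x0 c)%:E <=
    \int[P]_w (F (Y w))%:E)%E.
Proof.
move=> lam_gt0 pm_ge0 pm_sum pm_diag [xi [h [N [JP mN PN YP]]]].
pose A c i := Num.trunc ((c (inord i)).2%:R * dt * lam (states c i)).
pose B c i := Num.trunc ((c (inord i)).2.+1%:R * dt * lam (states c i)).
(* A common bound for the numbers of self-loops. *)
pose M := (\sum_(y : S) Num.trunc (K%:R * dt * lam y))%N.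
have dt0 : 0 < dt by exact: mesh_gt0.
have pos (k : nat) y : 0 <= k%:R * dt * lam y by rewrite !mulr_ge0// ltW.
have le_tr k k' y : (k <= k')%N ->
    (Num.trunc (k%:R * dt * lam y) <= Num.trunc (k'%:R * dt * lam y))%N.
  move=> kk; apply: le_truncn.
  by rewrite ler_wpM2r ?(ltW (lam_gt0 _))// ler_wpM2r ?(ltW dt0)// ler_nat.
have ABM c i : (A c i <= B c i <= M)%N.
  rewrite /A /B le_tr//=; apply: (@leq_trans (Num.trunc (K%:R * dt * lam (states c i)))).
    by apply: le_tr; exact: ltn_ord.
  by rewrite /M (bigD1 (states c i))//= leq_addr.
pose fam c := family (fun i : 'I_n.+1 => [pred j : 'I_M | (A c i <= j < B c i)%N]).
pose E (p : cells * {ffun 'I_n.+1 -> 'I_M}) :=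
  block_event lam xi h n (states p.1) (fun i => p.2 (inord i)) dt.
apply: (@le_trans _ _ (\sum_(p | alternating p.1 && (p.2 \in fam p.1))
    (cell_inf F (bins p.1))%:E * P (E p))%E).
  rewrite -(pair_big_dep alternating (fun c m => m \in fam c)
    (fun c m => ((cell_inf F (bins c))%:E * P (E (c, m)))%E))/= -sumEFin.
  apply: lee_sum => c _; rewrite -ge0_sume_distrr//.
  rewrite EFinM; apply: lee_wpmul2l.
    by rewrite lee_fin; have /andP[] := cell_inf_bounds FC C0 (bins c).
  have := block_event_sum_ge JP lam_gt0 pm_ge0 pm_sum pm_diag n (states c) dt0 (ABM c).
  exact: le_trans.
apply: (sum_measure_le_integral (N := N)) => //.
- by move=> p; have /andP[] := cell_inf_bounds FC C0 (bins p.1).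
- by move=> p; exact: (measurable_block_event JP).
- by move=> w; have /andP[] := FC (Y w).
- move=> [c m] w /= /andP[alt /familyP mf] Nw Ew; have [dev Yw] := YP w Nw.
  apply: (cell_inf_le FC); rewrite (_ : bins c = fun i : 'I_n.+1 =>
      (states c i, nat_of_ord (c (inord i)).2)); last first.
    by apply/funext => i; rewrite /bins /states inord_val.
  apply: (block_event_cell JP (m := fun i => m (inord i))
    (k := fun i => nat_of_ord (c (inord i)).2)) Ew Yw => //.
  move=> i ni; have := mf (inord i); rewrite inE/= inordK// => /andP[Am mB].
  rewrite ler_pdivlMr// ler_pdivrMr//; apply/andP; split.
    have := Num.Theory.truncnS_gt ((c (inord i)).2%:R * dt * lam (states c i)).
    move=> /ltW/le_trans; apply; rewrite ler_nat ltnS//.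
  have /andP[+ _] := Num.Theory.truncn_itv (pos (c (inord i)).2.+1 (states c i)).
  by apply: le_trans; rewrite ler_nat.
- move=> [c m] [c' m'] w /= /andP[/forallP alt /familyP mf] /andP[/forallP alt' /familyP mf'] Ew Ew'.
  have inj := block_event_inj (fun i ni => alt (Ordinal ni)) (fun i ni => alt' (Ordinal ni)) Ew Ew'.
  have mm i : m i = m' i.
    have ni : (i <= n)%N by rewrite -ltnS.
    have [_] := inj i ni.
    by rewrite inord_val => /val_inj.
  have xx i : (c i).1 = (c' i).1.
    have ni : (i <= n)%N by rewrite -ltnS.
    have [+ _] := inj i ni.
    by rewrite /states inord_val.
  congr pair; last exact/ffunP; apply/ffunP => i.
  have : (c i).2 = (c' i).2.
    apply/val_inj/eqP; rewrite eqn_leq.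
    have := mf i; have := mf' i; rewrite !inE/= /A /B /states !inord_val xx mm.
    move=> /andP[a1 b1] /andP[a2 b2].
    have lt k k' y : (Num.trunc (k%:R * dt * lam y) < Num.trunc (k'.+1%:R * dt * lam y) -> k <= k')%N.
      by move=> H; rewrite -ltnS ltnNge; apply/negP => /(le_tr _ _ y); rewrite leqNgt H.
    by rewrite (lt _ _ _ (leq_ltn_trans a1 b2)) (lt _ _ _ (leq_ltn_trans a2 b1)).
  by move: (xx i); case: (c i) => u v; case: (c' i) => u' v' /= -> ->.
Qed.

(** The number of steps is of the order of lam and the square of the mean of
    a step is 1 / lam ^ 2, so the fluctuations vanish. *)
Lemma cell_weight_cvg (pm : R -> S -> S -> R) (lam : R -> S -> R) x0
    (pi : S -> S -> R) (l : S -> R) c :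
  (forall y, lam b y @[b --> +oo] --> +oo) ->
  (forall y, (1 - pm b y y) * lam b y @[b --> +oo] --> l y) ->
  (forall y, \forall b \near +oo, 0 <= pm b y y <= 1) ->
  (forall y z, y != z -> pm b y z / (1 - pm b y y) @[b --> +oo] --> pi y z) ->
  alternating c ->
  cell_weight (pm b) (lam b) x0 c @[b --> +oo] -->
  word_proba pi x0 n (states c) * \prod_(i < n.+1)
     (expR (- (l (c i).1 * ((c i).2%:R * dt))) -
      expR (- (l (c i).1 * ((c i).2.+1%:R * dt)))).
Proof.
move=> lamoo pml pm01 pmpi /forallP alt.
have dt0 : 0 < dt by exact: mesh_gt0.
have -> : word_proba pi x0 n (states c) * \prod_(i < n.+1)
     (expR (- (l (c i).1 * ((c i).2%:R * dt))) -
      expR (- (l (c i).1 * ((c i).2.+1%:R * dt)))) =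
   (states c 0%N == x0)%:R * (\prod_(i < n.+1)
     (expR (- (l (c i).1 * ((c i).2%:R * dt))) -
      expR (- (l (c i).1 * ((c i).2.+1%:R * dt)))) *
     \prod_(i < n) pi (states c i) (states c i.+1)) * (1 - \sum_(i < n.+1) 3 / dt ^+ 2 * 0).
  rewrite (_ : \sum_(i < n.+1) _ = 0); last by rewrite big1// => i _; rewrite mulr0.
  by rewrite subr0 mulr1 /word_proba -!mulrA; congr (_ * _); rewrite mulrC.
apply: cvgM; last first.
  apply: cvgB; first exact: cvg_cst.
  apply: cvg_big => [|i _]; first exact: add_continuous.
  apply: cvgM; first exact: cvg_cst.
  set s := _ * dt; set y := states c i.
  have s0 : 0 <= s by rewrite mulr_ge0// ltW.
  have Linv : (lam b y)^-1 @[b --> +oo] --> 0.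
    apply/gtr0_cvgV0 => //; move/cvgryPgt : (lamoo y); apply.
  apply: (@squeeze_cvgr _ _ _ _ (fun=> 0) (fun b => s * (lam b y)^-1)).
  - near=> b; have l0 : 0 < lam b y by near: b; move/cvgryPgt : (lamoo y); apply.
    have sl : 0 <= s * lam b y by rewrite mulr_ge0// ltW.
    have /andP[t1 _] := Num.Theory.truncn_itv sl.
    rewrite divr_ge0 ?exprn_ge0 ?(ltW l0)//= ler_pdivrMr ?exprn_gt0//.
    by apply: le_trans t1 _; rewrite expr2 mulrA divfK// gt_eqF.
  - exact: cvg_cst.
  - by rewrite -[X in _ --> X](mulr0 s); apply: cvgM => //; exact: cvg_cst.
apply: cvgM; first exact: cvg_cst.
apply: cvgM.
  apply: cvg_big => [|i _]; first exact: mul_continuous.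
  rewrite /states !inord_val; apply: cvgB; apply: cvg_expr_trunc => //; rewrite mulr_ge0// ltW//.
apply: cvg_big => [|i _]; first exact: mul_continuous.
exact: pmpi.
Unshelve. all: by end_near. Qed.

End BlockCells.

Section WeakConvergence.
Context {R : realType} {S : finType}.
Variables (d : R -> measure_display) (Om : forall b, measurableType (d b)).
Variables (P : forall b, probability (Om b) R) (Y : forall b, Om b -> skorokhod R S).
Variables (pm : R -> S -> S -> R) (lam : R -> S -> R) (x0 : S).
Variables (d' : measure_display) (Om' : measurableType d') (Q : probability Om' R).
Variables (Y' : Om' -> skorokhod R S) (pi : S -> S -> R) (l : S -> R).
Hypothesis YP : forall b, 0 < b -> jump_path (P b) (pm b) (lam b) x0 (@Y b).
Hypothesis YP' : jump_path Q pi l x0 Y'.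
Hypothesis lam_gt0 : forall b y, 0 < b -> 0 < lam b y.
Hypothesis pm_ge0 : forall b y z, 0 < b -> 0 <= pm b y z.
Hypothesis pm_sum : forall b y, 0 < b -> \sum_z pm b y z = 1.
Hypothesis pm_diag : forall b y, 0 < b -> pm b y y < 1.
Hypothesis lamoo : forall y, lam b y @[b --> +oo] --> +oo.
Hypothesis pml : forall y, (1 - pm b y y) * lam b y @[b --> +oo] --> l y.
Hypothesis pmpi : forall y z, y != z -> pm b y z / (1 - pm b y y) @[b --> +oo] --> pi y z.
Hypothesis pi_diag : forall y, pi y y = 0.

Let near_gt0 : \forall b \near +oo, (0 : R) < b.
Proof. by exists 0; split => //; rewrite num_real. Qed.

(** Finitely many cells carry the expectation of F(Y') up to e, and the
    weight of each of them converges. Cells with equal consecutive states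
    have probability 0 for the limit since pi vanishes on the diagonal. *)
Lemma expectation_liminf (F : skorokhod R S -> R) C e :
  continuous F -> (forall f, 0 <= F f <= C) -> 0 <= C -> 0 < e ->
  \forall b \near +oo,
    (\int[Q]_w (F (Y' w))%:E <= \int[P b]_w (F (Y w))%:E + e%:E)%E.
Proof.
move=> Fc FC C0 e0; have [xi [h [N [JP mN QN YPN]]]] := YP'.
have e20 : 0 < e / 2 by rewrite divr_gt0.
have [n [K nK]] := path_functional_approx JP mN QN (fun w Nw => proj1 (YPN w Nw))
  (fun w Nw => proj2 (YPN w Nw)) Fc FC C0 e20.
set v := \sum_(c : {ffun 'I_n.+1 -> S * 'I_K} | alternating c) cell_inf F (bins c) *
  (word_proba pi x0 n (states c) * \prod_(i < n.+1)
     (expR (- (l (c i).1 * ((c i).2%:R * mesh n.+1))) -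
      expR (- (l (c i).1 * ((c i).2.+1%:R * mesh n.+1))))).
have vE : \sum_(c : {ffun 'I_n.+1 -> S * 'I_K})
    cell_inf F (bins c) * fine (Q (bins_event xi h c)) = v.
  rewrite [RHS]big_mkcond; apply: eq_bigr => c _.
  rewrite (proba_bins_event JP) -/(states c) /=; case: ifPn => //.
  move=> /forallPn[i]; rewrite negbK => /eqP ii.
  rewrite /word_proba (bigD1 i)//= -[in pi _ _]/(states c i) -[X in pi _ X]/(states c i.+1).
  by rewrite -ii pi_diag mul0r mulr0 mul0r mulr0.
have pm01 y : \forall b \near +oo, 0 <= pm b y y <= 1.
  by near=> b; rewrite pm_ge0 ?(ltW (pm_diag _ _))//; near: b.
have cvg_v : \sum_(c : {ffun 'I_n.+1 -> S * 'I_K} | alternating c) cell_inf F (bins c) *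
    cell_weight (pm b) (lam b) x0 c @[b --> +oo] --> v.
  apply: cvg_big => [|c alt]; first exact: add_continuous.
  by apply: cvgM; [exact: cvg_cst|exact: cell_weight_cvg].
move/cvgrPdist_le : cvg_v => /(_ _ e20) cvg_v.
near=> b; have b0 : 0 < b by near: b.
apply: (le_trans nK); rewrite vE [in leRHS](splitr e) [in leRHS]EFinD addeA EFinD; apply: leeD2r.
have le := sum_cell_weight_le FC C0 n K (fun y => lam_gt0 y b0) (fun y z => pm_ge0 y z b0)
  (fun y => pm_sum y b0) (fun y => pm_diag y b0) (YP b0).
apply: le_trans (leeD2r _ le); rewrite -EFinD lee_fin.
have : `|v - \sum_(c : {ffun 'I_n.+1 -> S * 'I_K} | alternating c) cell_inf F (bins c) *
    cell_weight (pm b) (lam b) x0 c| <= e / 2 by near: b.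
rewrite ler_norml => /andP[_]; lra.
Unshelve. all: by end_near. Qed.

Let expectation_shift d1 (O : measurableType d1) (P1 : probability O R) pm1 lam1 y0
    (Y1 : O -> skorokhod R S) (F : skorokhod R S -> R) M (s : R) :
  jump_path P1 pm1 lam1 y0 Y1 -> continuous F -> (forall f, `|F f| <= M) ->
  (\int[P1]_w (F (Y1 w))%:E \is a fin_num)%E /\
  (\int[P1]_w (M + s * F (Y1 w))%:E = M%:E + s%:E * \int[P1]_w (F (Y1 w))%:E)%E.
Proof.
move=> [xi [h [N [JP mN PN YPN]]]] Fc FM.
have Fb f : - M <= F f <= M by rewrite -ler_norml.
have M0 : 0 <= M by apply: le_trans (FM (cst_path R y0)).
have Gc : continuous (fun f => M + F f).
  by move=> f; apply: (cvgD (cvg_cst M) (Fc f)).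
have GM f : 0 <= M + F f <= M + M by have /andP[f0 f1] := Fb f; apply/andP; split; lra.
have [g [mg gE gM]] := path_functional JP mN (fun w Nw => proj1 (YPN w Nw))
  (fun w Nw => proj2 (YPN w Nw)) Gc GM.
pose f w := g w - M.
have mf : measurable_fun setT f by apply: measurable_funB.
have fM w : `|f w| <= M.
  by rewrite ler_norml /f; have /andP[g0 g1] := gM w; apply/andP; split; lra.
have fE w : ~ N w -> f w = F (Y1 w) by move=> Nw; rewrite /f gE// addrAC subrr add0r.
have intf : P1.-integrable setT (EFin \o f).
  apply: (@le_integrable _ _ _ P1 setT measurableT _ (EFin \o cst M)).
  - exact/measurable_EFinP.
  - by move=> w _ /=; rewrite lee_fin (le_trans (fM w))// ler_norm.
  - exact: finite_measure_integrable_cst.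
have EE : (\int[P1]_w (F (Y1 w))%:E = \int[P1]_w (f w)%:E)%E.
  by apply: (integral_eq_off_null mN PN) => w Nw; rewrite fE.
rewrite EE.
split; first exact: integrable_fin_num.
rewrite (integral_eq_off_null mN PN (g := fun w => (M%:E + s%:E * (f w)%:E)%E)); last first.
  by move=> w Nw; rewrite -EFinM -EFinD fE.
rewrite integralD//=; last 2 first.
- exact: finite_measure_integrable_cst.
- exact: integrableZl.
rewrite integralZl//; congr (_ + _)%E.
have -> : (\int[P1]__ M%:E = M%:E * P1 setT)%E by exact: integral_cst.
by rewrite probability_setT mule1.
Qed.

(** The lower bound [expectation_liminf], for M + F and for M - F, controls
    the expectation of F from both sides. *)
Lemma jump_path_cvg_in_law : cvg_in_law P Y Q Y'.
Proof.
move=> F Fc [M FM].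
have M0 : 0 <= M by apply: le_trans (FM (cst_path R x0)).
have Fb f : - M <= F f <= M by rewrite -ler_norml.
rewrite unlock.
have [Qfin QE] := expectation_shift 1 YP' Fc FM.
have [_ QE'] := expectation_shift (-1) YP' Fc FM.
have MM0 : 0 <= M + M by rewrite addr_ge0.
rewrite -(fineK Qfin); apply/fine_cvgP; split.
  near=> b; have b0 : 0 < b by near: b.
  by have [] := expectation_shift 1 (YP b0) Fc FM.
apply/cvgrPdist_le => e e0.
have Gc (s : R) : continuous (fun f => M + s * F f).
  by move=> f; apply: (cvgD (cvg_cst M) (cvgM (cvg_cst s) (Fc f))).
have GM f : 0 <= M + 1 * F f <= M + M.
  by have /andP[f0 f1] := Fb f; apply/andP; split; lra.
have GM' f : 0 <= M + (-1) * F f <= M + M.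
  by have /andP[f0 f1] := Fb f; apply/andP; split; lra.
have lo := expectation_liminf (Gc 1) GM MM0 e0.
have hi := expectation_liminf (Gc (-1)) GM' MM0 e0.
near=> b; have b0 : 0 < b by near: b.
have [Pfin PE] := expectation_shift 1 (YP b0) Fc FM.
have [_ PE'] := expectation_shift (-1) (YP b0) Fc FM.
have : (\int[Q]_w (M + 1 * F (Y' w))%:E <= \int[P b]_w (M + 1 * F (Y w))%:E + e%:E)%E.
  by near: b.
have : (\int[Q]_w (M + (-1) * F (Y' w))%:E <= \int[P b]_w (M + (-1) * F (Y w))%:E + e%:E)%E.
  by near: b.
rewrite QE QE' PE PE' -(fineK Qfin) -(fineK Pfin) -!EFinM -!EFinD !lee_fin/=.
move=> h1 h2; rewrite ler_norml; apply/andP; split; lra.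
Unshelve. all: by end_near. Qed.

End WeakConvergence.

(** * Trace rates from mean hitting times *)

Section TraceRates.
Context {R : realType} {T : finType}.
Variable r : T -> T -> R.
Hypothesis r_ge0 : forall y z, 0 <= r y z.
Hypothesis r_irr : forall y z, connect [rel y z | 0 < r y z] y z.
Variables (G : pred T) (om : T -> T -> R).
Hypothesis omP : hitting_distribution r G om.

Lemma hitting_distribution_off a b : G a -> G b -> a != b -> om b a = 0.
Proof. by move=> Ga /omP[/(_ a Ga) -> _] /negPf ->. Qed.

(** Self-loops only change the diagonal, so away from it the kernel of the
    visits is the trace rate over the holding rate. *)
Lemma visit_proba_rate a b : G a -> G b -> a != b ->
  \sum_u jump_proba r a u * om b u = trace_rate r om a b / holding_rate r a.
Proof.
move=> Ga Gb ab; rewrite /trace_rate mulr_suml; apply: eq_bigr => u _.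
rewrite /jump_proba; case: eqP => [->|_]; first by rewrite (hitting_distribution_off Ga Gb ab) !(mulr0, mul0r).
by rewrite mulrAC.
Qed.

Lemma sum_visit_proba a : (forall y, 0 < holding_rate r y) -> G a ->
  \sum_(z | G z) \sum_u jump_proba r a u * om z u = 1.
Proof.
move=> h0 Ga; rewrite exchange_big/= -[RHS](sum_jump_proba h0 a); apply: eq_bigr => u _.
by rewrite -mulr_sumr (hitting_distribution_sum r_ge0 r_irr Ga omP) mulr1.
Qed.

(** With f b the mean hitting time of b and g b the part of it spent off G, e
    = f b - g b is harmonic off G, so it satisfies the equation of the trace
    chain, and [cycle_formula] bounds g b. *)
Lemma ground_hitting_time (mu : T -> R) (f : T -> T -> R) b :
  (forall y, 0 < mu y) -> (forall u, \sum_y mu y * generator r u y = 0) ->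
  1 <= \sum_y mu y ->
  (forall c, f c c = 0) -> (forall c y, y != c -> generator r (f c) y = -1) ->
  G b -> exists e : T -> R, [/\ e b = 0,
    forall c, c != b ->
      f b c - (\sum_(y | ~~ G y) mu y) * (f b c + f c b) <= e c <= f b c
  & forall a, G a -> a != b -> \sum_(c | G c) trace_rate r om a c * (e c - e a) = -1].
Proof.
move=> mu_gt0 mu_st mu1 fc Lf Gb.
have /choice[g gP] : forall c, exists g : T -> R, g c = 0 /\
    forall y, y != c -> generator r g y = - (~~ G y)%:R.
  move=> c; have [g [g1 g2]] := dirichlet_exists r_ge0 r_irr (fun=> 0)
    (fun y => - (~~ G y)%:R) (eqxx c : pred1 c c).
  by exists g; split=> [|y yc]; [rewrite g1//=|rewrite g2].
have g_ge0 c y : 0 <= g c y.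
  rewrite -oppr_le0; apply: (maximum_principle r_ge0 r_irr (B := pred1 c) (b := c)
    (u := fun y => - g c y)) => /=.
  - exact: eqxx.
  - move=> z zc; have [_ /(_ z zc) gz] := gP c.
    have := generatorZ r (-1) (g c) z; rewrite gz mulrN mulNr mul1r opprK => E.
    rewrite (_ : (fun y => - g c y) = fun y => -1 * g c y) ?E ?ler0n//.
    by apply/funext => y'; rewrite mulN1r.
  - by move=> z /eqP ->; have [-> _] := gP c; rewrite oppr0.
exists (fun y => f b y - g b y); split.
- by rewrite fc; have [-> _] := gP b; rewrite subr0.
- move=> c cb; apply/andP; split; last by rewrite gerBl.
  rewrite lerD2l lerN2.
  have [gb Lgb] := gP b; have [gc Lgc] := gP c.
  have := cycle_formula r_ge0 r_irr mu_gt0 mu_st cb (fc b) (fc c) gb gc (Lf b) (Lf c) Lgb Lgc.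
  move=> <-; have := g_ge0 b c; have := g_ge0 c b.
  by set u := g c b; set v := g b c => u0 v0; nra.
- move=> a Ga ab.
  have e_harm y : ~~ G y -> generator r (fun y => f b y - g b y) y = 0.
    move=> Gy; have yb : y != b by apply: contraNneq Gy => ->.
    by rewrite generatorB Lf// (gP b).2// Gy opprK addrC subrr.
  rewrite -(trace_generator r_ge0 r_irr Gb omP a e_harm) generatorB Lf// (gP b).2// Ga.
  by rewrite oppr0 subr0.
Qed.

End TraceRates.

(** If all the times eta were equal to kappa, the equation at (x, y) would
    reduce to rho x y kappa = 1. In general the error is of the order of dl
    times the exit rate of x, and summing the equations over y shows that
    this exit rate stays bounded. *)
Lemma rates_of_mean_times (R : realType) (T : finType) (G : pred T) (kappa : R)
    (rho : R -> T -> T -> R) (eta : R -> T -> T -> R) :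
  0 < kappa ->
  (\forall b \near +oo, forall x y, G y -> 0 <= rho b x y) ->
  (forall b y, eta b y y = 0) ->
  (forall x y, G x -> G y -> x != y -> eta b x y @[b --> +oo] --> kappa) ->
  (\forall b \near +oo, forall x y, G x -> G y -> x != y ->
    \sum_(z | G z) rho b x z * (eta b z y - eta b x y) = -1) ->
  forall x y, G x -> G y -> x != y -> rho b x y @[b --> +oo] --> kappa^-1.
Proof.
move=> k0 rho0 eta0 eta_cvg sys.
pose m : R := #|T|%:R.
have m0 : 0 <= m by rewrite ler0n.
move=> x y Gx Gy xy; apply/cvgrPdist_le => e e0.
(* The first bound keeps the exit rate below 2 m / kappa; the second one turns
   the final error 6 m dl / kappa ^ 2 into at most e. *)
pose dl := Num.min (kappa / (2 * (1 + 2 * m))) (e * kappa ^+ 2 / (6 * m + 1)).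
have m6 : 0 < 6 * m + 1 by lra.
have m2 : 0 < 2 * (1 + 2 * m) by lra.
have dl0 : 0 < dl.
  by rewrite lt_min; apply/andP; split; apply: divr_gt0 => //; rewrite mulr_gt0// exprn_gt0.
have close : \forall b \near +oo, forall u v, G u -> G v -> u != v -> `|kappa - eta b u v| <= dl.
  apply: filter_forall => u; apply: filter_forall => v.
  have [/and3P[Gu Gv uv]|] := boolP [&& G u, G v & u != v].
    by move/cvgrPdist_le : (eta_cvg u v Gu Gv uv) => /(_ _ dl0); apply: filterS => b h _ _ _.
  by move=> n; apply: nearW => b Gu Gv uv; move: n; rewrite Gu Gv uv.
near=> b.
have cl : forall u v, G u -> G v -> u != v -> `|kappa - eta b u v| <= dl by near: b.
have sy v : G v -> x != v -> \sum_(z | G z) rho b x z * (eta b z v - eta b x v) = -1.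
  suff sysb : forall u v, G u -> G v -> u != v ->
      \sum_(z | G z) rho b u z * (eta b z v - eta b u v) = -1 by exact: sysb.
  by near: b.
have r0 v : G v -> 0 <= rho b x v.
  suff rb : forall u v, G v -> 0 <= rho b u v by exact: rb.
  by near: b.
pose S := \sum_(z | G z && (z != x)) rho b x z.
have S0 : 0 <= S by apply: sumr_ge0 => z /andP[/r0].
have err v : G v -> x != v -> `|rho b x v * eta b x v - 1| <= 2 * dl * S.
  move=> Gv xv.
  have -> : rho b x v * eta b x v - 1 =
      \sum_(z | [&& G z, z != x & z != v]) rho b x z * (eta b z v - eta b x v).
    have := sy v Gv xv; rewrite (bigD1 x)//= subrr mulr0 add0r (bigD1 v)/=; last by rewrite Gv eq_sym.
    rewrite eta0 (eq_bigl (fun z => [&& G z, z != x & z != v])); last by move=> z; rewrite andbA.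
    by set W := \sum_(_ | _) _ => E; lra.
  apply: le_trans (ler_norm_sum _ _ _) _.
  apply: (@le_trans _ _ (\sum_(z | [&& G z, z != x & z != v]) 2 * dl * rho b x z)).
    apply: ler_sum => z /and3P[Gz zx zv]; rewrite normrM (ger0_norm (r0 _ Gz)) mulrC.
    rewrite ler_wpM2r ?r0//.
    have := cl z v Gz Gv zv; have := cl x v Gx Gv xv.
    rewrite !ler_norml => /andP[a1 a2] /andP[b1 b2]; apply/andP; split; lra.
  rewrite -mulr_sumr ler_wpM2l ?mulr_ge0 ?(ltW dl0)// /S [leRHS](bigID (pred1 v))/=.
  rewrite -[leLHS]add0r lerD//; first by apply: sumr_ge0 => z /andP[/andP[/r0]].
  by rewrite le_eqVlt; apply/orP; left; apply/eqP/eq_bigl => z; rewrite andbA.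
have Sb : S * (kappa - dl) <= m * (1 + 2 * dl * S).
  rewrite /S mulr_suml; apply: (@le_trans _ _ (\sum_(z | G z && (z != x)) (1 + 2 * dl * S))).
    apply: ler_sum => z /andP[Gz zx]; rewrite eq_sym in zx.
    have := err z Gz zx; have := cl x z Gx Gz zx; have := r0 _ Gz.
    rewrite !ler_norml; move: S0; set u := rho b x z; set w := eta b x z => S0 u0 /andP[a1 a2] /andP[b1 b2]; nra.
  rewrite sumr_const -[_ *+ _]mulr_natl ler_wpM2r ?addr_ge0 ?mulr_ge0 ?(ltW dl0)//.
  by rewrite /m ler_nat max_card.
have [dl1 dl2] : dl * (2 * (1 + 2 * m)) <= kappa /\ dl * (6 * m + 1) <= e * kappa ^+ 2.
  split; rewrite -ler_pdivlMr ?ge_min ?lexx ?orbT//; nra.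
have Sk : S * kappa <= 2 * m by nra.
have := err y Gy xy; have := cl x y Gx Gy xy; have := r0 _ Gy.
have rS : rho b x y <= S.
  rewrite /S (bigD1 y)/= ?Gy 1?eq_sym ?xy// lerDl; apply: sumr_ge0 => z /andP[/andP[/r0]]//.
move: rS; set u := rho b x y; set w := eta b x y => uS u0 c1 c2.
have main : `|1 - u * kappa| <= 3 * dl * S.
  rewrite (_ : 1 - u * kappa = (1 - u * w) - u * (kappa - w)); last by ring.
  apply: le_trans (ler_normB _ _) _; rewrite distrC normrM (ger0_norm u0).
  have := normr_ge0 (kappa - w); nra.
have -> : kappa^-1 - u = (1 - u * kappa) / kappa by field; rewrite gt_eqF.
rewrite normrM normfV (gtr0_norm k0) ler_pdivrMr//; apply: (le_trans main).
rewrite -(ler_pM2r k0) -!mulrA -expr2; nra.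
Unshelve. all: by end_near. Qed.

(** * The trace of the Potts dynamics on the ground states *)

Lemma sum_sig (R : realType) (T : finType) (G Q : pred T) (F : T -> R) :
  \sum_(z | G z && Q z) F z = \sum_(z : {x | G x} | Q (val z)) F (val z).
Proof.
rewrite (reindex_omap (val : {x | G x} -> T) insub); last first.
  by move=> z /andP[Gz _]; rewrite insubT.
by apply: eq_bigl => z; rewrite (valP z) valK eqxx andbT.
Qed.

Section TraceProcess.
Context {R : realType} (K L q : nat) (D : dynamics).
Hypotheses (K_gt0 : (0 < K)%N) (L_gt0 : (0 < L)%N) (q_ge : (min_spins D <= q)%N).
Local Notation config := (config K L q).
Local Notation ground := (ground K L q).
Local Notation G := (@is_ground K L q).
Variables (beta : R) (om : config -> config -> R).
Local Notation r := (@rate K L q R D beta).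
Local Notation theta := (expR ((Gamma K D)%:R * beta)).
Hypothesis omP : hitting_distribution r G om.

Let r_ge0 := @rate_ge0 R K L q D beta.
Let r_irr := @rate_irreducible R K L q D beta.
Let hold_gt0 := holding_rate_gt0 K_gt0 L_gt0 q_ge beta.

Definition trace_kernel (y z : ground) : R := \sum_u jump_proba r (val y) u * om (val z) u.

Definition trace_intensity (y : ground) : R := holding_rate r (val y) * theta.

Lemma trace_process_jump_path (d : measure_display) (Om : measurableType d)
    (P : probability Om R) (a : ground) (X : Om -> skorokhod R config) :
  is_ctmc r P (val a) X ->
  jump_path P trace_kernel trace_intensity a (fun w => trace_process D beta a (X w)).
Proof.
move=> /ctmc_jump_process[xi [h [N [JP mN PN NP]]]].
have [Z [N' [ZP mN' PN' ZE]]] := visit_jump_process JP (valP a)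
  (fun y z Gz => excursion_cvg r_ge0 r_irr hold_gt0 omP Gz)
  (fun y Gy => sum_visit_proba r_ge0 r_irr omP hold_gt0 Gy) (erefl (val a)).
have th0 : 0 < theta by exact: expR_gt0.
have [N'' [mN'' PN'' gdiv]] := jump_process_divergent ZP (fun y => hold_gt0 (val y)).
exists Z, (fun n w => visit_time xi h G n w / theta), (N `|` N' `|` N''); split.
- exact: jump_process_scale.
- by apply: measurableU => //; exact: measurableU.
- by apply: null_setU => //; [exact: measurableU|exact: null_setU].
- move=> w /not_orP[/not_orP[Nw Nw'] Nw''].
  have [xi0 hdiv Xw] := NP w Nw; have gd := gdiv w Nw''.
  split; first exact: divergent_scale.
  pose b j := G (xi j w).
  have bv k : b (visit b k).
    by rewrite /b -[xi _ w]/(visit_state xi G k w) -(ZE w Nw'); exact: valP.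
  apply: (@trace_process_follows _ K L q D beta a (X w) (xi ^~ w) (h ^~ w) (visit b) (Z ^~ w)) => //.
  + by move=> i; exact: (jump_process_gt0 JP).
  + by move=> k; exact: visitS_gt.
  + by move=> k; exact: ZE.
  + by move=> k j; apply: next_visit_in; exact: (bv k.+1).
Qed.

Lemma sum_trace_kernel y : \sum_z trace_kernel y z = 1.
Proof.
rewrite -[RHS](sum_visit_proba r_ge0 r_irr omP hold_gt0 (valP y)).
rewrite (eq_bigl (fun z => G z && xpredT z)); last by move=> z; rewrite andbT.
by rewrite (sum_sig G xpredT).
Qed.

Lemma trace_kernel_ge0 y z : 0 <= trace_kernel y z.
Proof.
apply: sumr_ge0 => u _; rewrite mulr_ge0//; first exact: jump_proba_ge0.
exact: (hitting_distribution_ge0 r_ge0 r_irr (valP z) omP u (valP z)).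
Qed.

Lemma trace_kernelE y z : y != z ->
  trace_kernel y z = trace_rate r om (val y) (val z) / holding_rate r (val y).
Proof.
move=> yz; apply: (visit_proba_rate omP); [exact: valP|exact: valP|].
by rewrite (inj_eq val_inj).
Qed.

Lemma trace_kernel_diag y : 1 - trace_kernel y y = \sum_(z | z != y) trace_kernel y z.
Proof. by rewrite -(sum_trace_kernel y) (bigD1 y)//= addrAC subrr add0r. Qed.

(** Otherwise the trace chain could not leave y, and the mean time spent in G
    before hitting z would be infinite. *)
Lemma trace_kernel_diag_lt1 y z : z != y -> trace_kernel y y < 1.
Proof.
move=> zy; rewrite ltNge; apply/negP => y1.
have kernel0 x : x != y -> trace_kernel y x = 0.
  move=> xy; apply/eqP; rewrite eq_le trace_kernel_ge0 andbT.
  apply: (@le_trans _ _ (1 - trace_kernel y y)); last by rewrite subr_le0.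
  rewrite trace_kernel_diag (bigD1 x)//= lerDl.
  by apply: sumr_ge0 => ? _; exact: trace_kernel_ge0.
have rate0 x : G x -> x != val y -> trace_rate r om (val y) x = 0.
  move=> Gx xy; have xy' : Sub x Gx != y :> ground by rewrite -(inj_eq val_inj).
  have := kernel0 _ xy'; rewrite trace_kernelE 1?eq_sym// => /eqP.
  by rewrite mulf_eq0 invr_eq0 (gt_eqF (hold_gt0 _)) orbF => /eqP.
have [u [uz Lu]] := dirichlet_exists r_ge0 r_irr (fun=> 0) (fun x => - (G x)%:R)
  (eqxx (val z) : pred1 (val z) (val z)).
have u_harm x : ~~ G x -> generator r u x = 0.
  move=> Gx; rewrite Lu ?(negPf Gx) ?oppr0//=.
  by apply: contraNneq Gx => ->; exact: valP.
have := trace_generator r_ge0 r_irr (valP z) omP (val y) u_harm.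
rewrite Lu ?(valP y)/=; last by rewrite (inj_eq val_inj) eq_sym.
rewrite big1 => [/eqP|x Gx]; first by rewrite oppr_eq0 oner_eq0.
have [->|xy] := eqVneq x (val y); first by rewrite subrr mulr0.
by rewrite rate0// mul0r.
Qed.

Lemma trace_kernel_rate y z : y != z ->
  trace_kernel y z * trace_intensity y = trace_rate r om (val y) (val z) * theta.
Proof.
by move=> yz; rewrite trace_kernelE// /trace_intensity mulrA divfK// gt_eqF.
Qed.

Lemma trace_escape_rate y : (1 - trace_kernel y y) * trace_intensity y =
  \sum_(z | z != y) trace_rate r om (val y) (val z) * theta.
Proof.
rewrite trace_kernel_diag mulr_suml; apply: eq_bigr => z zy.
by rewrite trace_kernel_rate// eq_sym.
Qed.

Lemma trace_intensity_gt0 y : 0 < trace_intensity y.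
Proof. by rewrite mulr_gt0// expR_gt0. Qed.

(** The ground states are left at rate at least exp (- 4 beta), and Gamma is
    at least 5. *)
Lemma trace_intensity_ge y : (11 <= K)%N -> 0 <= beta -> beta <= trace_intensity y.
Proof.
move=> K11 b0; have /existsP[s /eqP yE] := valP y.
have := holding_rate_constant K_gt0 L_gt0 q_ge s b0; rewrite -yE => hy.
apply: (@le_trans _ _ (expR (- (beta * 4)) * theta)); last first.
  by rewrite ler_wpM2r// expR_ge0.
apply: (@le_trans _ _ (expR beta)).
  by apply: le_trans (expR_ge1Dx _); rewrite lerDr.
rewrite -expRD ler_expR.
have : (5 : R) <= (Gamma K D)%:R.
  rewrite (ler_nat R 5); apply: (@leq_trans (2 * K)%N); first by rewrite (leq_trans _ (leq_mul (leqnn 2) K11)).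
  by case: D; rewrite /Gamma leq_addr.
by move: b0; set g := _%:R => b0 g5; nra.
Qed.

End TraceProcess.

Section Asymptotics.
Context {R : realType} (K L q : nat) (D : dynamics).
Hypotheses (K_ge11 : (11 <= K)%N) (K_le_L : (K <= L)%N) (q_ge : (min_spins D <= q)%N).
Local Notation config := (config K L q).
Local Notation ground := (ground K L q).
Local Notation G := (@is_ground K L q).
Local Notation r := (@rate K L q R D).
Local Notation theta beta := (expR ((Gamma K D)%:R * beta)).

Let K_gt0 : (0 < K)%N := ltn_trans (isT : (0 < 10)%N) K_ge11.
Let L_gt0 : (0 < L)%N := leq_trans K_gt0 K_le_L.
Let hold_gt0 beta := holding_rate_gt0 K_gt0 L_gt0 q_ge (beta : R).

Variables (d : R -> measure_display) (Om : forall beta : R, measurableType (d beta))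
    (P : forall beta : R, config -> probability (Om beta) R)
    (sigma : forall beta : R, Om beta -> skorokhod R config) (kappa : R).
Hypothesis sigmaP : forall (beta : R) (x : config), 0 < beta ->
  is_ctmc (r beta) (P beta x) x (@sigma beta).
Hypothesis kappaP : is_Eyring_Kramers_constant D P sigma kappa.

Lemma expectation_hitting_time beta (x y : config) (u : config -> R) : 0 < beta ->
  x != y -> u y = 0 -> (forall z, z != y -> generator (r beta) u z = -1) ->
  (\int[P beta x]_w hitting_time [set y] (sigma w) = (u x)%:E)%E.
Proof.
move=> b0 xy uy Lu; have [xi [h [N [JP mN PN NP]]]] := ctmc_jump_process (sigmaP x b0).
apply: (integral_hitting_time JP (@hold_gt0 beta) xy mN PN).
  by move=> w /NP[_ hd Xw].
exact: (survival_time_cvg (@rate_ge0 R K L q D beta) (@rate_irreducible R K L q D beta)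
  (@hold_gt0 beta)).
Qed.

Lemma mean_hitting_time_exists beta : exists f : config -> config -> R,
  (forall c, f c c = 0) /\ (forall c y, y != c -> generator (r beta) (f c) y = -1).
Proof.
have /choice[f fP] : forall c, exists g : config -> R, g c = 0 /\
    forall y, y != c -> generator (r beta) g y = -1.
  move=> c; have [g [g1 g2]] := dirichlet_exists (@rate_ge0 R K L q D beta)
    (@rate_irreducible R K L q D beta) (fun=> 0) (fun=> -1) (eqxx c : pred1 c c).
  by exists g; split=> [|y yc]; [rewrite g1//=|rewrite g2].
by exists f; split=> [c|c y]; have [] := fP c => // _; apply.
Qed.

Let near_gt0 : \forall b \near +oo, (0 : R) < b.
Proof. by exists 0; split => //; rewrite num_real. Qed.

Lemma mean_hitting_time_cvg (f : R -> config -> config -> R) (x y : config) :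
  (forall beta c, f beta c c = 0) ->
  (forall beta c z, z != c -> generator (r beta) (f beta c) z = -1) ->
  G x -> G y -> x != y -> f beta y x / theta beta @[beta --> +oo] --> kappa.
Proof.
move=> fc Lf Gx Gy xy.
have xy' : Sub x Gx <> Sub y Gy :> ground.
  by move=> /(congr1 val) /= E; rewrite E eqxx in xy.
have [_ /(_ _ _ xy') /= lim] := kappaP.
have /fine_cvgP[_] : (f beta y x / theta beta)%:E @[beta --> +oo] --> kappa%:E.
  apply: cvg_trans lim; apply: near_eq_cvg; near=> beta.
  have b0 : 0 < beta by near: beta.
  rewrite (expectation_hitting_time b0 xy (fc beta y) (Lf beta y)) -EFinM.
  by rewrite expRN mulrC.
exact.
Unshelve. all: by end_near. Qed.

(** The mean times spent on the ground states before hitting y satisfy the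
    equations of the trace chain and, divided by theta, tend to kappa because
    the Gibbs weight of the other configurations vanishes. *)
Lemma trace_rate_cvg (om : R -> config -> config -> R) (x y : config) :
  (forall beta, hitting_distribution (r beta) G (om beta)) ->
  G x -> G y -> x != y ->
  trace_rate (r beta) (om beta) x y * theta beta @[beta --> +oo] --> kappa^-1.
Proof.
move=> omP Gx Gy xy.
have /choice[f fP] := mean_hitting_time_exists.
have fc beta c : f beta c c = 0 by have [] := fP beta.
have Lf beta c z : z != c -> generator (r beta) (f beta c) z = -1.
  by have [_] := fP beta; apply.
pose m beta : R := \sum_(z | ~~ G z) gibbs beta z.
have /choice[e eP] : forall p : R * config, exists e : config -> R,
    e p.2 = 0 /\ (G p.2 -> [/\ forall c, c != p.2 ->
      f p.1 p.2 c - m p.1 * (f p.1 p.2 c + f p.1 c p.2) <= e c <= f p.1 p.2 c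
      & forall a, G a -> a != p.2 ->
        \sum_(c | G c) trace_rate (r p.1) (om p.1) a c * (e c - e a) = -1]).
  move=> [beta b] /=; have [Gb|/negP nGb] := boolP (G b); last by exists (fun=> 0).
  have [e [e1 e2 e3]] := ground_hitting_time (@rate_ge0 R K L q D beta)
    (@rate_irreducible R K L q D beta) (omP beta) (gibbs_gt0 beta)
    (gibbs_stationary q_ge beta) (gibbs_sum_ge1 K L q_ge beta) (fc beta) (Lf beta) Gb.
  by exists e.
have th0 beta : 0 < theta beta :> R by exact: expR_gt0.
have m_cvg : m beta @[beta --> +oo] --> 0.
  apply: (@squeeze_cvgr _ _ _ _ (fun=> 0) (fun beta => #|{: config}|%:R * expR (- beta))).
  - near=> beta; have b0 : 0 <= beta by apply: ltW; near: beta.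
    rewrite (gibbs_nonground q K_gt0 L_gt0 b0) andbT.
    by apply: sumr_ge0 => z _; exact/ltW/gibbs_gt0.
  - exact: cvg_cst.
  - rewrite -[X in _ --> X](mulr0 (#|{: config}|%:R : R)).
    by apply: cvgM; [exact: cvg_cst|exact: cvgr_expR].
apply: (rates_of_mean_times (G := G)
  (rho := fun beta a b => trace_rate (r beta) (om beta) a b * theta beta)
  (eta := fun beta a b => e (beta, b) a / theta beta)) => //.
- by have [] := kappaP.
- apply: nearW => beta u v Gv; rewrite mulr_ge0 ?(ltW (th0 _))//.
  apply: (trace_rate_ge0 _ _ Gx (omP beta)) => //.
    exact: rate_ge0.
  exact: rate_irreducible.
- by move=> beta u; have [/= -> _] := eP (beta, u); rewrite mul0r.
- move=> u v Gu Gv uv.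
  have fuv := mean_hitting_time_cvg fc Lf Gu Gv uv.
  have fvu : f beta u v / theta beta @[beta --> +oo] --> kappa.
    by apply: mean_hitting_time_cvg => //; rewrite eq_sym.
  apply: (@squeeze_cvgr _ _ _ _ (fun beta => f beta v u / theta beta -
    m beta * (f beta v u / theta beta + f beta u v / theta beta))
    (fun beta => f beta v u / theta beta)) => //.
    apply: nearW => beta; have [_ /= /(_ Gv)[+ _]] := eP (beta, v).
    move=> /(_ u uv)/andP[e1 e2].
    rewrite [in X in X && _](_ : _ - _ = (f beta v u - m beta * (f beta v u + f beta u v)) / theta beta);
      last by ring.
    by rewrite !ler_pM2r ?invr_gt0// e1.
  rewrite -[X in _ --> X]subr0 -[X in _ - X](mul0r (kappa + kappa)).
  by apply: cvgB => //; apply: cvgM => //; exact: cvgD.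
- apply: nearW => beta u v Gu Gv uv; have [_ /= /(_ Gv)[_ +]] := eP (beta, v).
  move=> /(_ u Gu uv) <-; apply: eq_bigr => z _.
  by field; rewrite gt_eqF.
Unshelve. all: by end_near. Qed.

End Asymptotics.

(** * Convergence in law of the trace *)

Lemma other_ground (K L q : nat) (x : ground K L q) :
  (0 < K)%N -> (0 < L)%N -> (1 < q)%N -> exists y : ground K L q, y != x.
Proof.
move=> K_gt0 L_gt0 q_gt1; have /existsP[s /eqP xs] := valP x.
exists (Sub (constant_config K L (ordS s)) (is_ground_constant K L (ordS s))).
rewrite -(inj_eq val_inj) /= xs; apply: contra (ordS_neq s q_gt1) => /eqP/ffunP.
by move=> /(_ (site0 K_gt0 L_gt0)); rewrite !ffunE => ->.
Qed.

Theorem theorem3p4 (R : realType) (K L q : nat) (D : dynamics)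
    (K_ge11 : (11 <= K)%N) (K_le_L : (K <= L)%N) (q_ge : (min_spins D <= q)%N)
    (* the dynamics sigma_beta, under the laws P_x of the chain started at x *)
    (d : R -> measure_display) (Om : forall beta : R, measurableType (d beta))
    (P : forall beta : R, config K L q -> probability (Om beta) R)
    (sigma : forall beta : R, Om beta -> skorokhod R (config K L q))
    (sigmaP : forall (beta : R) (x : config K L q), 0 < beta ->
       is_ctmc (rate D beta) (P beta x) x (sigma beta))
    (kappa : R) (kappaP : is_Eyring_Kramers_constant D P sigma kappa)
    (a : ground K L q)
    (* the limiting chain, started at a *)
    (d' : measure_display) (Om' : measurableType d') (Q : probability Om' R)
    (Y : Om' -> skorokhod R (ground K L q))
    (YP : is_ctmc (fun _ _ => kappa^-1) Q a Y) :
  cvg_in_law (fun beta => P beta (val a))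
    (fun beta w => trace_process D beta a (sigma beta w)) Q Y.
Proof.
have K_gt0 : (0 < K)%N by exact: leq_trans K_ge11.
have L_gt0 : (0 < L)%N by exact: leq_trans K_le_L.
have q_gt1 : (1 < q)%N by case: D q_ge {sigmaP kappaP} => //; exact: ltnW.
have k0 : 0 < kappa by have [] := kappaP.
have /choice[om omP] : forall beta : R, exists om,
    hitting_distribution (rate D beta) (@is_ground K L q) om.
  move=> beta; apply: (hitting_distribution_exists (@rate_ge0 R K L q D beta)
    (@rate_irreducible R K L q D beta) (valP a)).
pose pm beta := trace_kernel D beta (om beta).
pose lam (beta : R) (y : ground K L q) := trace_intensity D beta y.
pose rho beta (y z : ground K L q) :=
  trace_rate (rate D beta) (om beta) (val y) (val z) * expR ((Gamma K D)%:R * beta).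
pose rY := fun _ _ : ground K L q => kappa^-1.
have rho_cvg y z : y != z -> rho beta y z @[beta --> +oo] --> kappa^-1.
  move=> yz; apply: (trace_rate_cvg K_ge11 K_le_L q_ge sigmaP kappaP omP) => //.
  - exact: valP.
  - exact: valP.
have escE beta y : (1 - pm beta y y) * lam beta y = \sum_(z | z != y) rho beta y z.
  exact: trace_escape_rate.
have hY y : holding_rate rY y = \sum_(z | z != y) kappa^-1 by [].
have hY_gt0 y : 0 < holding_rate rY y.
  have [z zy] := other_ground y K_gt0 L_gt0 q_gt1.
  rewrite hY (bigD1 z)//= ltr_wpDr ?invr_gt0//.
  by apply: sumr_ge0 => ? _; rewrite invr_ge0 ltW.
have esc_cvg y : (1 - pm beta y y) * lam beta y @[beta --> +oo] --> holding_rate rY y.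
  under eq_fun do rewrite escE.
  apply: cvg_big => [|z zy]; first exact: add_continuous.
  by apply: rho_cvg; rewrite eq_sym.
have lam_gt0 beta y : 0 < lam beta y by exact: trace_intensity_gt0.
have pm_ge0 beta y z : 0 <= pm beta y z by exact: trace_kernel_ge0.
apply: (jump_path_cvg_in_law (pm := pm) (lam := lam) (x0 := a) (pi := jump_proba rY)
   (l := holding_rate rY)).
- by move=> beta b0; apply: trace_process_jump_path => //; exact: sigmaP.
- have [xi [h [N [JP mN PN NP]]]] := ctmc_jump_process YP.
  by exists xi, h, N; split=> // w /NP[].
- by move=> beta y _; exact: lam_gt0.
- by move=> beta y z _; exact: pm_ge0.
- by move=> beta y _; exact: sum_trace_kernel.
- move=> beta y _; have [z zy] := other_ground y K_gt0 L_gt0 q_gt1.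
  exact: (trace_kernel_diag_lt1 K_gt0 L_gt0 q_ge (omP beta) zy).
- move=> y; apply: (@ger_cvgy _ _ _ _ id).
    near=> beta; apply: trace_intensity_ge => //; near: beta.
  exact: cvg_id.
- exact: esc_cvg.
- move=> y z yz.
  have : rho beta y z / ((1 - pm beta y y) * lam beta y) @[beta --> +oo] -->
      kappa^-1 / holding_rate rY y.
    by apply: cvgM; [exact: rho_cvg|apply: cvgV => //; rewrite gt_eqF].
  rewrite /jump_proba eq_sym (negPf yz) /=; apply: cvg_trans; apply: near_eq_cvg.
  apply: nearW => beta; rewrite /rho -(trace_kernel_rate K_gt0 L_gt0 q_ge _ yz)//.
  by rewrite invfM mulrACA mulfV ?mulr1// gt_eqF// lam_gt0.
- by move=> y; rewrite /jump_proba eqxx.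
Unshelve. all: by end_near. Qed.
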